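(* Let $(a_n)_n$ be an approximately uncorrelated triangular scheme (with constants $C(k)$ and sequences $(C^{(\ell)}_n)_n$), let $(b_n)_n$ be a sequence of bandwidths ($b_n$ an $n$-bandwidth) with $b_n\to\infty$, and let $(X_n)_n$ be the sequence of periodic random band matrices based on $(a_n)_n$ with bandwidths $(b_n)_n$. Then: (i) The semicircle law holds for $(X_n)_n$ in probability. (ii) If there exists $p\in\mathbb{N}$ such that $b_n^{-p}$ is summable over $n$, and if for all $\ell\in\mathbb{N}$ the sequence $(C^{(\ell)}_n)_n$ is summable, then the semicircle law holds for $(X_n)_n$ almost surely.
   Context: All random variables are real-valued and defined on a common probability space. Write $[\ell]=\{1,\ldots,\ell\}$. Index pairs $(p_1,q_1),\ldots,(p_\ell,q_\ell)\in[n]^2$ are called fundamentally different if $\{p_i,q_i\}\neq\{p_j,q_j\}$ for all $i\neq j$. Approximately uncorrelated triangular scheme: a sequence $(a_n)_n$ where $a_n$ is a real symmetric $n\times n$ random matrix, such that there are constants $(C(k))_{k\in\mathbb N}$ and sequences $(C^{(\ell)}_n)_n$, $\ell\in\mathbb{N}$, with $\lim_{n\to\infty}C^{(\ell)}_n=0$ for each $\ell$, such that for all $n,\ell\in\mathbb{N}$, all fundamentally different $P_1,\ldots,P_\ell\in[n]^2$ and all $\delta_1,\ldots,\delta_\ell\in\mathbb{N}=\{1,2,\dots\}$: $$\left|\mathbb{E}\, a_n(P_1)^{\delta_1}\cdots a_n(P_\ell)^{\delta_\ell}\right|\le \frac{C(\delta_1+\ldots+\delta_\ell)}{n^{\frac12\#\{i\in[\ell]:\delta_i=1\}}},\qquad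 \left|\mathbb{E}\, a_n(P_1)^2\cdots a_n(P_\ell)^2-1\right|\le C^{(\ell)}_n .$$ An $n$-bandwidth is a number $b_n$ which is either equal to $n$ or an odd natural number with $1\le b_n<n$. A pair $(p,q)\in[n]^2$ is $b_n$-relevant if $b_n=n$, or $|p-q|\le (b_n-1)/2$, or $|p-q|\ge n-(b_n-1)/2$. The periodic random band matrices based on $(a_n)_n$ with bandwidths $(b_n)_n$ are $X_n=\frac{1}{\sqrt{b_n}}a_n^b$, where $a_n^b(P)=a_n(P)$ if $P\in[n]^2$ is $b_n$-relevant and $a_n^b(P)=0$ otherwise. The empirical spectral distribution (ESD) of an $n\times n$ symmetric matrix is the uniform probability measure on its $n$ eigenvalues (with multiplicity). The semicircle distribution $\sigma$ has density $\frac{1}{2\pi}\sqrt{4-x^2}\,1_{[-2,2]}(x)$. The semicircle law holds for $(X_n)_n$ in probability (resp. almost surely) if the ESDs of $X_n$ converge weakly to $\sigma$ in probability, i.e. the integral of every bounded continuous function converges in probability (resp. almost surely). *)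

(* Defs.v *)
From HB Require Import structures.
From mathcomp Require Import all_boot all_order all_algebra.
From mathcomp Require Import all_classical all_reals all_analysis.
From mathcomp Require Import measurable_realfun.
From mathcomp Require polyrcf.

Set Implicit Arguments.
Unset Strict Implicit.
Unset Printing Implicit Defensive.

Import Order.TTheory GRing.Theory Num.Theory.
Import numFieldNormedType.Exports.

Local Open Scope classical_set_scope.
Local Open Scope ring_scope.

Definition fundamentally_different (n l : nat) (Q : 'I_l -> 'I_n * 'I_n) : Prop :=
  forall i j : 'I_l, i != j ->
    ([set (Q i).1; (Q i).2] != [set (Q j).1; (Q j).2] :> {set 'I_n})%SET.

Section Scheme.
Context d (T : measurableType d) (R : realType) (P : probability T R).

(* The matrix of size 0 in the sequence is a dummy: every clause is vacuous at
   n = 0. The expectation 'E_P[_] takes values in \bar R and is infinite on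
   functions that are not integrable, so the two moment bounds below also assert
   that the moments involved exist. *)
Record approx_uncorrelated (a : forall n : nat, T -> 'M[R]_n)
    (C : nat -> R) (Cl : nat -> nat -> R) : Prop := ApproxUncorrelated {
  au_measurable : forall (n : nat) (p q : 'I_n),
    measurable_fun [set: T] (fun w => a n w p q) ;
  au_symmetric : forall (n : nat) (w : T), (a n w)^T = a n w ;
  au_cvg0 : forall l : nat, (0 < l)%N -> Cl l n @[n --> \oo] --> (0 : R) ;
  au_moment : forall (n l : nat) (Q : 'I_l -> 'I_n * 'I_n) (delta : 'I_l -> nat),
    (0 < l)%N -> fundamentally_different Q -> (forall i, (0 < delta i)%N) ->
    (`| 'E_P[fun w => (\prod_(i < l) a n w (Q i).1 (Q i).2 ^+ delta i)%R] |
      <= (C (\sum_(i < l) delta i)%N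
          / n%:R `^ (2^-1 * #|[pred i | delta i == 1%N]|%:R))%:E)%E ;
  au_square : forall (n l : nat) (Q : 'I_l -> 'I_n * 'I_n),
    (0 < l)%N -> fundamentally_different Q ->
    (`| 'E_P[fun w => (\prod_(i < l) a n w (Q i).1 (Q i).2 ^+ 2)%R] - 1 |
      <= (Cl l n)%:E)%E
}.

End Scheme.

Definition is_bandwidth (n b : nat) : bool :=
  (b == n) || [&& odd b, (1 <= b)%N & (b < n)%N].

(* When b != n, b is odd and b < n, so that (b - 1)./2 is (b - 1) / 2 and the
   second natural-number subtraction is exact. *)
Definition relevant (n b : nat) (p q : 'I_n) : bool :=
  [|| b == n,
      (`|(p : nat) - (q : nat)| <= (b - 1)./2)%N |
      (n - (b - 1)./2 <= `|(p : nat) - (q : nat)|)%N].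

Definition band_matrix (R : realType) (n b : nat) (A : 'M[R]_n) : 'M[R]_n :=
  (Num.sqrt b%:R)^-1 *: \matrix_(p, q) (if relevant b p q then A p q else 0).

Section EmpiricalSpectralDistribution.
Variables (R : realType) (n : nat).

Definition spectrum (A : 'M[R]_n) : seq R :=
  flatten [seq nseq (mup x (char_poly A)) x
          | x <- polyrcf.rootsR (char_poly A)].

Lemma mem_spectrum (A : 'M[R]_n) (x : R) : (x \in spectrum A) = eigenvalue A x.
Proof.
have p0 : char_poly A != 0 by rewrite monic_neq0// char_poly_monic.
rewrite eigenvalue_root_char; apply/flatten_mapP/idP => [[y]|rx].
  by rewrite -polyrcf.roots_on_rootsR// => /andP[_ ry] /nseqP[-> _].
exists x; first by rewrite -polyrcf.roots_on_rootsR// rx in_itv.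
by apply/nseqP; split=> //; rewrite mup_geq// expr1 dvdp_XsubCl.
Qed.

Lemma count_spectrum (A : 'M[R]_n) (x : R) :
  count_mem x (spectrum A) = mup x (char_poly A).
Proof.
have p0 : char_poly A != 0 by rewrite monic_neq0// char_poly_monic.
rewrite /spectrum count_flatten -map_comp.
rewrite (eq_map (g := fun y => ((y == x) * mup y (char_poly A))%N)); last first.
  by move=> y /=; rewrite count_nseq.
rewrite sumnE big_map; have [rx|rx] := boolP (root (char_poly A) x).
  have xs : x \in polyrcf.rootsR (char_poly A).
    by rewrite -polyrcf.roots_on_rootsR// rx in_itv.
  rewrite (bigD1_seq x)//= ?polyrcf.uniq_roots// eqxx mul1n big1 ?addn0//.
  by move=> y /negbTE ->.
rewrite (_ : mup x _ = 0%N); last first.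
  by apply/eqP; rewrite -leqn0 mup_leq// expr1 dvdp_XsubCl.
rewrite big_seq big1// => y; rewrite -polyrcf.roots_on_rootsR// => /andP[_ ry].
by case: eqP ry rx => [->|//] ->.
Qed.

(* A probability measure when n > 0 and A is symmetric, since then
   size (spectrum A) = n. *)
Definition esd (A : 'M[R]_n) : {measure set R -> \bar R} :=
  mscale (n%:R^-1)%:nng
    (msum (fun i => \d_((spectrum A)`_i)) (size (spectrum A))).

End EmpiricalSpectralDistribution.

Section Semicircle.
Variable R : realType.

Definition semicircle_pdf (x : R) : R :=
  (2 * pi)^-1 * Num.sqrt (4 - x ^+ 2) * \1_(`[-2, 2]%classic : set R) x.

Definition semicircle (V : set R) : \bar R :=
  (\int[lebesgue_measure]_(x in V) (semicircle_pdf x)%:E)%E.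

Lemma semicircle_pdf_ge0 x : 0 <= semicircle_pdf x.
Proof.
by rewrite /semicircle_pdf !mulr_ge0 ?invr_ge0 ?mulr_ge0 ?pi_ge0 ?sqrtr_ge0.
Qed.

Lemma measurable_semicircle_pdf : measurable_fun [set: R] semicircle_pdf.
Proof.
apply: measurable_funM; last exact: measurable_indic.
apply: measurable_funM => //.
apply: (@measurableT_comp _ _ _ _ _ _ (@Num.sqrt R)).
  by apply: continuous_measurable_fun; exact: sqrt_continuous.
by apply: measurable_funB => //; exact: measurable_funX.
Qed.

Let semicircle0 : semicircle set0 = 0%E.
Proof. by rewrite /semicircle integral_set0. Qed.

Let semicircle_ge0 V : (0 <= semicircle V)%E.
Proof.
by apply: integral_ge0 => x _; rewrite lee_fin semicircle_pdf_ge0.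
Qed.

Let semicircle_sigma_additive : semi_sigma_additive semicircle.
Proof.
move=> /= F mF tF mUF.
rewrite /semicircle ge0_integral_bigcup//=; last first.
- by move=> x _; rewrite lee_fin semicircle_pdf_ge0.
- apply/measurable_EFinP.
  exact: (measurable_funS measurableT _ measurable_semicircle_pdf).
apply: is_cvg_ereal_nneg_natsum_cond => n _ _.
by apply: integral_ge0 => x _; rewrite lee_fin semicircle_pdf_ge0.
Qed.

HB.instance Definition _ := isMeasure.Build _ _ _
  semicircle semicircle0 semicircle_ge0 semicircle_sigma_additive.

End Semicircle.

Section SemicircleLaw.
Context d (T : measurableType d) (R : realType) (P : probability T R).

(* Measurability is part of the notion: P carries no information on
   non-measurable sets. *)
Definition cvg_in_probability (Y : nat -> T -> R) (c : R) : Prop :=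
  (forall n, measurable_fun [set: T] (Y n)) /\
  forall eps : R, 0 < eps ->
    P [set w | eps < `|Y n w - c|] @[n --> \oo] --> 0%E.

Definition cvg_almost_surely (Y : nat -> T -> R) (c : R) : Prop :=
  {ae P, forall w, Y n w @[n --> \oo] --> c}.

Definition semicircle_law_in_probability (X : forall n, T -> 'M[R]_n) : Prop :=
  forall f : R -> R, continuous f -> bounded_fun f ->
    cvg_in_probability (fun n w => \int[esd (X n w)]_x f x)
      (\int[@semicircle R]_x f x).

Definition semicircle_law_almost_surely (X : forall n, T -> 'M[R]_n) : Prop :=
  forall f : R -> R, continuous f -> bounded_fun f ->
    cvg_almost_surely (fun n w => \int[esd (X n w)]_x f x)
      (\int[@semicircle R]_x f x).

End SemicircleLaw.

(* Main.v *)
Require Import Defs.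
From HB Require Import structures.
From mathcomp Require Import all_boot all_order all_algebra.
From mathcomp Require Import all_classical all_reals all_analysis.
From mathcomp Require Import measurable_realfun zify ring lra.
From mathcomp Require Import spectral complex.
Import Order.TTheory GRing.Theory Num.Theory.
Import numFieldNormedType.Exports.
Local Open Scope classical_set_scope.
Local Open Scope ring_scope.
Set Implicit Arguments.
Unset Strict Implicit.
Unset Printing Implicit Defensive.

(** The proof is the moment method, organised so that one estimate serves both
    modes of convergence.

    The k-th moment of the empirical spectral distribution of the band matrix
    is a normalised sum, over closed walks of length k along relevant pairs, of
    the product of the entries met by the walk ([trace_band]).  The walks fall
    into three classes ([emoment_split]).

    - Walks crossing some edge exactly once.  Such an edge is not a bridge, so
      the walk visits no more vertices than it has distinct edges
      ([card_vset_single]); this scarcity, together with the factor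
      n^(-1/2) that the hypothesis attaches to each single entry, makes the
      second moment of their contribution of order 1/(n b)
      ([single_part_moment]).
    - Walks crossing no edge exactly once but not tracing a tree.  There are so
      few of them that their contribution has a 2p-th moment of order b^(-p)
      for every p, entries being merely bounded in all moments
      ([rest_part_moment]).
    - Walks tracing a tree, each edge of it twice.  Their number, divided by the
      normalisation, tends to the moment of the semicircle distribution
      ([Ntree_approx]), a Catalan number if k is even ([sc_momentE]).  Their products are
      centred at 1 and two walks without a common edge are almost uncorrelated,
      so that the fluctuation has a second moment of order 1/(n b) plus the
      errors in the second hypothesis of the scheme ([tree_part_moment]).

    Markov's inequality then bounds the probability that the k-th moment is far
    from the semicircle moment by a multiple of [rate] ([moment_tail]).  This
    rate tends to 0, whence convergence in probability.  It is summable under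
    the extra assumptions, since 1/(n b) is at most the sum of n^(-1-1/p) and
    b^(-p) ([inv_prod_le]); Borel-Cantelli then gives convergence almost surely.

    Convergence of moments yields weak convergence by a deterministic inequality
    ([esd_approx]): a continuous bounded f is approximated by a polynomial on a
    segment containing the semicircle support strictly, and the error outside is
    dominated by a high even moment. *)

(** * Edges and vertices of a closed walk *)

Section Edges.
Variable n : nat.
Implicit Types (x y z : 'I_n) (p t : seq 'I_n) (e : 'I_n * 'I_n).

(** An undirected edge is represented by its increasingly ordered endpoints, so
    that equality of edges is equality of pairs. *)
Definition uedge x y := if (x <= y)%N then (x, y) else (y, x).

Lemma uedgeC x y : uedge x y = uedge y x.
Proof.
rewrite /uedge; case: (ltngtP x y) => // /val_inj ->; by [].
Qed.

Lemma uedge_inj z x y : uedge z x = uedge z y -> x = y.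
Proof.
by rewrite /uedge; case: ifP => _; case: ifP => _ [] // -> ->.
Qed.

Lemma uedge_id x y : uedge (uedge x y).1 (uedge x y).2 = uedge x y.
Proof.
rewrite {2 3 4}/uedge; case: ifP => //= h; first by rewrite /uedge h.
by rewrite /uedge; case: ltngtP h.
Qed.

Fixpoint edges x p := if p is y :: p' then uedge x y :: edges y p' else [::].

Definition cedges t := if t is x :: p then edges x (rcons p x) else [::].

Lemma size_edges x p : size (edges x p) = size p.
Proof. by elim: p x => //= y p IH x; rewrite IH. Qed.

Lemma size_cedges t : size (cedges t) = size t.
Proof. by case: t => //= x p; rewrite size_edges size_rcons. Qed.

Lemma edges_cat x p p' : edges x (p ++ p') = edges x p ++ edges (last x p) p'.
Proof. by elim: p x => //= y p IH x; rewrite IH. Qed.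

Lemma edges_rcons x p y :
  edges x (rcons p y) = rcons (edges x p) (uedge (last x p) y).
Proof. by rewrite -cats1 edges_cat /= cats1. Qed.

Lemma cedges_rot1 t : cedges (rot 1 t) = rot 1 (cedges t).
Proof.
case: t => [|x [|y p]] //; rewrite rot1_cons /= rot1_cons.
by rewrite !edges_rcons last_rcons.
Qed.

Lemma perm_cedges_rot i t : perm_eq (cedges (rot i t)) (cedges t).
Proof.
have [h|h] := leqP i (size t); last by rewrite rot_oversize // ltnW.
elim: i h => [|i IH] h; first by rewrite rot0.
rewrite -addn1 addnC rotD; last by rewrite add1n.
by rewrite cedges_rot1 perm_rot; apply: IH; apply: ltnW.
Qed.

Lemma mem_edgesP x p e : e \in edges x p ->
  exists p1 y p2, p = p1 ++ y :: p2 /\ e = uedge (last x p1) y.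
Proof.
elim: p x => //= z p IH x; rewrite in_cons => /orP[/eqP ->|/IH].
  by exists [::], z, p.
by move=> [p1 [y [p2 [-> ->]]]]; exists (z :: p1), y, p2.
Qed.

Lemma edges_in x p e : e \in edges x p -> e.1 \in x :: p /\ e.2 \in x :: p.
Proof.
elim: p x => //= z p IH x; rewrite in_cons => /orP[/eqP ->|/IH [h1 h2]].
  by rewrite /uedge; case: ifP => _; rewrite /= !inE !eqxx !orbT.
by rewrite [_ \in x :: _]in_cons h1 [e.2 \in x :: _]in_cons h2 !orbT.
Qed.

Lemma cedges_in t e : e \in cedges t -> e.1 \in t /\ e.2 \in t.
Proof.
case: t => //= x p /edges_in.
by rewrite !inE !mem_rcons !inE !orbA !orbb.
Qed.

Lemma edges_norm x p e : e \in edges x p -> uedge e.1 e.2 = e.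
Proof. by move=> /mem_edgesP[p1 [y [p2 [_ ->]]]]; rewrite uedge_id. Qed.

Lemma cedges_norm t e : e \in cedges t -> uedge e.1 e.2 = e.
Proof. by case: t => //= x p; exact: edges_norm. Qed.

Definition vset p : {set 'I_n} := [set x in p]%SET.
Definition eset (L : seq ('I_n * 'I_n)) : {set 'I_n * 'I_n} := [set e in L]%SET.

Lemma vset_cons x p : vset (x :: p) = (x |: vset p)%SET.
Proof. by apply/setP => y; rewrite !inE. Qed.

Lemma eset_cons e L : eset (e :: L) = (e |: eset L)%SET.
Proof. by apply/setP => y; rewrite !inE. Qed.

Lemma card_eset L : #|eset L| = size (undup L).
Proof.
rewrite -(card_uniqP (undup_uniq L)); apply: eq_card => e.
by rewrite inE mem_undup.
Qed.

Lemma card_vset_le p : (#|vset p| <= size p)%N.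
Proof. by rewrite (leq_trans _ (card_size p)) // subset_leq_card //; apply/fintype.subsetP => x; rewrite inE. Qed.

Lemma vset_rot i t : vset (rot i t) = vset t.
Proof. by apply/setP => x; rewrite !inE mem_rot. Qed.

(** Every step of a walk that reaches a new vertex uses a new edge.  The walk is
    attached at y to a graph with vertices U and edges F, which is what the
    induction needs, and which allows a second walk to be attached to a first
    one that it meets. *)
Lemma extend_walk y p (U : {set 'I_n}) (F : {set 'I_n * 'I_n}) : y \in U ->
  (forall e, e \in F -> e.1 \in U /\ e.2 \in U) ->
  (#|U :|: vset p|%SET + #|F| <= #|U| + #|F :|: eset (edges y p)|%SET)%N.
Proof.
elim: p y U F => [|z p IH] y U F yU FU.
  have -> : (U :|: vset [::] = U)%SET by apply/setP => x; rewrite !inE orbF.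
  by rewrite leq_add2l subset_leq_card // finset.subsetUl.
have := IH z (z |: U)%SET (uedge y z |: F)%SET.
rewrite !inE eqxx /= => /(_ isT).
have FU' : forall e, e \in (uedge y z |: F)%SET ->
    e.1 \in (z |: U)%SET /\ e.2 \in (z |: U)%SET.
  move=> e; rewrite !inE => /orP[/eqP ->|/FU [-> ->]]; last by rewrite !orbT.
  by rewrite /uedge; case: ifP => _ /=; rewrite yU eqxx !orbT.
move=> /(_ FU').
rewrite vset_cons eset_cons -/edges !cardsU1.
have -> : (z |: U :|: vset p = U :|: (z |: vset p))%SET.
  by rewrite finset.setUCA finset.setUA.
have -> : (uedge y z |: F :|: eset (edges z p) =
           F :|: (uedge y z |: eset (edges z p)))%SET.
  by rewrite finset.setUCA finset.setUA.
have : (z \notin U <= (uedge y z \notin F))%N.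
  case: (boolP (z \in U)) => //= zU.
  case: (boolP (_ \in F)) => //= /FU; rewrite /uedge.
  by case: ifP => _ /= [h1 h2]; move: zU; rewrite ?h1 ?h2.
by case: (z \notin U); case: (_ \notin F) => /=; lia.
Qed.

Lemma vset_rcons p x : vset (rcons p x) = (x |: vset p)%SET.
Proof. by apply/setP => y; rewrite !inE mem_rcons inE. Qed.

Lemma eset_rcons L e : eset (rcons L e) = (e |: eset L)%SET.
Proof. by apply/setP => y; rewrite !inE mem_rcons inE. Qed.

Lemma card_vset_walk x p : (#|vset (x :: p)| <= #|eset (edges x p)|.+1)%N.
Proof.
have := @extend_walk x p [set x]%SET finset.set0.
rewrite inE eqxx => /(_ isT); rewrite vset_cons cards0 finset.set0U cards1 addn0.
by apply=> e; rewrite inE.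
Qed.

Lemma card_vset_closed t : (#|vset t| <= #|eset (cedges t)|.+1)%N.
Proof.
case: t => [|x p] /=; first exact: (leq_trans (card_vset_le [::])).
apply: leq_trans (card_vset_walk x (rcons p x)).
by rewrite !vset_cons vset_rcons finset.setUA finset.setUid.
Qed.

(** Rotated so as to end with the edge crossed once, the walk still visits all
    its vertices before that edge: the edge is not a bridge, and one distinct
    edge is gained over the bound for trees. *)
Lemma card_vset_single t e : count_mem e (cedges t) = 1%N ->
  (#|vset t| <= #|eset (cedges t)|)%N.
Proof.
move=> he.
suff [s [x [p [st sp h1]]]] : exists s x p, [/\ s = x :: p, exists i, s = rot i t
    & uedge (last x p) x = e].
  case: sp => i sp; rewrite -(vset_rot i t) -sp.
  have pm : perm_eq (cedges s) (cedges t) by rewrite sp perm_cedges_rot.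
  have -> : eset (cedges t) = eset (cedges s).
    by apply/setP => f; rewrite !inE (perm_mem pm).
  move/permP: pm => /(_ (pred1 e)); rewrite he st /= edges_rcons h1.
  rewrite -cats1 count_cat /= eqxx addn0 addn1 => -[] ne.
  rewrite cats1 eset_rcons cardsU1.
  have -> : e \notin eset (edges x p).
    by rewrite inE -has_pred1 has_count ne.
  exact: card_vset_walk.
have : e \in cedges t by rewrite -has_pred1 has_count he.
case: t he => //= x p _ /mem_edgesP [p1 [y [p2 [E ->]]]].
case: (lastP p2) E => [|p3 w] E.
  have [-> ->] : p = p1 /\ x = y.
    by move: E; rewrite cats1 => /rcons_inj [].
  by exists (y :: p1), y, p1; split => //; exists 0%N; rewrite rot0.
have [-> ->] : p = p1 ++ y :: p3 /\ x = w.
  by move: E; rewrite -rcons_cons -rcons_cat => /rcons_inj [].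
exists (y :: p3 ++ w :: p1), y, (p3 ++ w :: p1); split => //.
  exists (size (w :: p1)); rewrite -cat_cons rot_size_cat; by [].
by rewrite last_cat.
Qed.

Definition nsingle (L : seq ('I_n * 'I_n)) :=
  count (fun e => count_mem e L == 1%N) (undup L).

Lemma size_sum_count (L : seq ('I_n * 'I_n)) :
  size L = (\sum_(e <- undup L) count_mem e L)%N.
Proof.
rewrite -sum1_size -[LHS](big_undup_iterop_count _ L predT (fun=> 1%N)).
by apply: eq_bigr => e _; rewrite Monoid.iteropE iter_addn mul1n addn0.
Qed.

(** Double counting of the crossings: each distinct edge accounts for two of them,
    except those crossed once.  The excess at a chosen edge e0 is kept, in order
    to exclude edges crossed three times or more in extremal cases. *)
Lemma leq_eset_size (L : seq ('I_n * 'I_n)) e0 :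
  (2 * #|eset L| + (count_mem e0 L - 2) <= size L + nsingle L)%N.
Proof.
have [e0L|e0L] := boolP (e0 \in L); last first.
  rewrite (count_memPn e0L) addn0 card_eset size_sum_count /nsingle.
  rewrite -(sum1_count (undup L)) [X in (_ <= _ + X)%N]big_mkcond /= -big_split /= -sum1_size big_distrr /=.
  rewrite big_seq [leqRHS]big_seq leq_sum // => e; rewrite mem_undup => eL.
  have : (0 < count_mem e L)%N by rewrite -has_count has_pred1.
  by case: (count_mem e L) => [|[|c]].
rewrite card_eset size_sum_count /nsingle.
rewrite -(sum1_count (undup L)) [X in (_ <= _ + X)%N]big_mkcond /= -big_split /= -sum1_size big_distrr /=.
rewrite !(bigD1_seq e0) ?mem_undup ?undup_uniq //=.
rewrite addnAC leq_add //.
  have : (0 < count_mem e0 L)%N by rewrite -has_count has_pred1.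
  by case: (count_mem e0 L) => [|[|c]] //= _; rewrite ?subSS ?subn0; lia.
rewrite big_seq_cond [leqRHS]big_seq_cond leq_sum // => e.
rewrite mem_undup => /andP[eL _].
have : (0 < count_mem e L)%N by rewrite -has_count has_pred1.
by case: (count_mem e L) => [|[|c]].
Qed.

End Edges.

(** * Sums over walks in a graph of bounded degree *)

Lemma sum_tuple_cons (R : nmodType) (T : finType) k (P : pred (seq T))
    (F : seq T -> R) :
  \sum_(t : k.+1.-tuple T | P t) F t =
  \sum_(x : T) \sum_(t : k.-tuple T | P (x :: t)) F (x :: t).
Proof.
rewrite pair_big_dep /=.
rewrite (reindex (fun u : T * k.-tuple T => cons_tuple u.1 u.2)) //=.
exists (fun t : k.+1.-tuple T => (thead t, [tuple of behead t])).
  by move=> [x t] _ /=; congr (_, _) => //; apply: val_inj.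
by move=> t _ /=; rewrite [RHS]tuple_eta; apply: val_inj.
Qed.

Lemma sum_tuple0 (R : nmodType) (T : finType) (P : pred (seq T)) (F : seq T -> R) :
  \sum_(t : 0.-tuple T | P t) F t = if P [::] then F [::] else 0.
Proof.
rewrite big_mkcond /= (big_pred1 [tuple]) // => t.
by apply/esym/eqP; rewrite tuple0.
Qed.

(** Rotation turns a sum over closed walks through a marked vertex into one over
    closed walks starting there. *)
Lemma sum_tuple_rotr (R : nmodType) (T : finType) k i (P : pred (seq T))
    (F : seq T -> R) :
  \sum_(t : k.-tuple T | P t) F t =
  \sum_(t : k.-tuple T | P (rotr i t)) F (rotr i t).
Proof.
rewrite (reindex (fun t : k.-tuple T => [tuple of rotr i t])) //=.
apply: onW_bij; exists (fun t : k.-tuple T => [tuple of rot i t]) => t.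
  by apply: val_inj; rewrite /= rotrK.
by apply: val_inj; rewrite /= rotK.
Qed.

Lemma nth_rotr (T : Type) (x0 : T) i t : (i < size t)%N ->
  nth x0 (rotr i t) i = nth x0 t 0.
Proof.
move=> it; rewrite /rotr /rot nth_cat size_drop subKn ?ltnn ?subnn; last exact: ltnW.
by rewrite nth_take // subn_gt0.
Qed.

Section WalkSums.
Variables (R : realFieldType) (n : nat) (r : rel 'I_n) (b : nat).
Hypothesis b_gt0 : (0 < b)%N.
Hypothesis rb : forall y, (#|[set z | r y z]%SET| <= b)%N.
Let q : R := b%:R^-1.

Let q_ge0 : 0 <= q. Proof. by rewrite invr_ge0 ler0n. Qed.

(** With weight q = 1/b per vertex, a step costs at most the number of vertices
    already seen plus one: new vertices are at most b in number, and each brings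
    a factor 1/b. *)
Lemma sum_step y (U : {set 'I_n}) :
  \sum_(z | r y z) q ^+ #|z |: U|%SET <= (#|U|.+1)%:R * q ^+ #|U|.
Proof.
apply: (@le_trans _ _ (\sum_(z in U) q ^+ #|U| + \sum_(z | r y z) q ^+ #|U|.+1)).
  rewrite [leLHS]big_mkcond [X in _ <= X + _]big_mkcond.
  rewrite [X in _ <= _ + X]big_mkcond -big_split /=.
  apply: ler_sum => z _; rewrite cardsU1.
  have q0 m : 0 <= q ^+ m by rewrite exprn_ge0.
  by case: (z \in U); case: (r y z); rewrite /= ?add0n ?add1n ?addr0 ?add0r ?lerDl.
rewrite !sumr_const -natr1 mulrDl mul1r -[q ^+ _ *+ #|U|]mulr_natl lerD2l.
rewrite exprS -mulr_natl mulrA ler_piMl ?exprn_ge0 //.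
rewrite ler_pdivrMr ?ltr0n // mul1r ler_nat.
by have := rb y; rewrite cardsE.
Qed.

Lemma sum_walk N k y (U : {set 'I_n}) : (#|U| + k <= N)%N ->
  \sum_(t : k.-tuple 'I_n | path r y t) q ^+ #|U :|: vset t|%SET
    <= N%:R ^+ k * q ^+ #|U|.
Proof.
elim: k y U => [|k IH] y U hN.
  rewrite (sum_tuple0 (fun t => path r y t) (fun t => q ^+ #|U :|: vset t|%SET)).
  rewrite /= expr0 mul1r; have -> : (U :|: vset [::] = U)%SET => //.
  by apply/setP => x; rewrite !inE orbF.
rewrite (sum_tuple_cons _ (fun t => path r y t) (fun t => q ^+ #|U :|: vset t|%SET)).
apply: (@le_trans _ _ (\sum_(z | r y z) N%:R ^+ k * q ^+ #|z |: U|%SET)).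
  rewrite [leRHS]big_mkcond; apply: ler_sum => z _ /=.
  case: ifP => ryz; last by rewrite big_pred0.
  have := IH z (z |: U)%SET; rewrite cardsU1.
  have /[swap]/[apply] : ((z \notin U) + #|U| + k <= N)%N.
    by case: (z \notin U); move: hN; rewrite ?add0n ?add1n; lia.
  rewrite -cardsU1; congr (_ <= _); apply: eq_bigr => t _.
  by congr (q ^+ #|pred_of_set _|); rewrite vset_cons finset.setUCA finset.setUA.
rewrite -mulr_sumr exprSr -mulrA ler_wpM2l ?exprn_ge0 ?ler0n //.
apply: le_trans (sum_step y U) _.
by rewrite ler_wpM2r ?exprn_ge0 // ler_nat; lia.
Qed.

Lemma sum_closed k : (0 < k)%N ->
  \sum_(t : k.-tuple 'I_n | cycle r t) q ^+ #|vset t|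
    <= k%:R ^+ k * (n%:R * q).
Proof.
case: k => // k _.
rewrite (sum_tuple_cons _ (fun t => cycle r t) (fun t => q ^+ #|vset t|)) /=.
apply: (@le_trans _ _ (\sum_(x : 'I_n) k.+1%:R ^+ k * q)); last first.
  rewrite sumr_const card_ord -[_ *+ n]mulr_natl mulrCA ler_wpM2r ?mulr_ge0 ?ler0n //.
  by rewrite exprS ler_peMl ?exprn_ge0 // ler1n.
apply: ler_sum => x _.
have := @sum_walk k.+1 k x [set x]%SET; rewrite cards1 expr1 => /(_ (leqnn _)).
apply: le_trans; rewrite big_mkcond [leRHS]big_mkcond; apply: ler_sum => t _.
rewrite rcons_path vset_cons; case: (path r x t) => //=.
by case: ifP => // _; rewrite exprn_ge0.
Qed.

(** A closed walk that meets U can be rotated to start in U, which loses a factor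
    k; then no free choice of a starting vertex remains. *)
Lemma sum_closed_meeting N k (U : {set 'I_n}) : (0 < k)%N -> (#|U| + k <= N)%N ->
  \sum_(t : k.-tuple 'I_n | cycle r t && ~~ [disjoint U & vset t])
      q ^+ #|U :|: vset t|%SET
    <= (k * N)%:R * N%:R ^+ k * q ^+ #|U|.
Proof.
case: k => // k _ hN.
have q0 m : 0 <= q ^+ m by rewrite exprn_ge0.
have N0 : 0 <= N%:R :> R by rewrite ler0n.
pose F (t : seq 'I_n) := q ^+ #|U :|: vset t|%SET.
have [x0 _|n0] := pickP 'I_n; last first.
  rewrite big1 ?mulr_ge0 ?exprn_ge0 ?ler0n // => t.
  by have := n0 (thead t).
apply: (@le_trans _ _ (\sum_(i < k.+1) \sum_(t : k.+1.-tuple 'I_n |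
    cycle r t && (nth x0 t i \in U)) F t)).
  rewrite (exchange_big_dep (fun t : k.+1.-tuple 'I_n => cycle r t)) /=; last by move=> i t _ /andP[].
  rewrite [leLHS]big_mkcond [leRHS]big_mkcond /=; apply: ler_sum => t _.
  case: (cycle r t) => //=.
  case: ifPn => [|_]; last by rewrite sumr_ge0 // => i _; exact: q0.
  rewrite disjoint_sym disjoint_subset => /subsetPn[x]; rewrite !inE negbK => xt xU.
  have it : (index x t < k.+1)%N by rewrite -[X in (_ < X)%N](size_tuple t) index_mem.
  have xi : nth x0 t (Ordinal it) \in U by rewrite /= nth_index.
  by rewrite (bigD1 (Ordinal it)) //= lerDl sumr_ge0 // => i _; exact: q0.
apply: (@le_trans _ _ (\sum_(i < k.+1) (N%:R * (N%:R ^+ k * q ^+ #|U|)))); last first.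
  rewrite sumr_const card_ord -[_ *+ k.+1]mulr_natl natrM -!mulrA ler_wpM2l ?ler0n //.
  rewrite ler_wpM2l // ler_wpM2r // exprS ler_peMl ?exprn_ge0 // ler1n.
  by move: hN; lia.
apply: ler_sum => i _.
have -> : \sum_(t : k.+1.-tuple 'I_n | cycle r t && (nth x0 t i \in U)) F t =
          \sum_(t : k.+1.-tuple 'I_n | cycle r t && (head x0 t \in U)) F t.
  rewrite (sum_tuple_rotr _ i (fun t => cycle r t && (nth x0 t i \in U)) F).
  apply: eq_big => t; first by rewrite rotr_cycle nth_rotr ?size_tuple // nth0.
  by move=> _; rewrite /F /rotr vset_rot.
rewrite (sum_tuple_cons _ (fun t => cycle r t && (head x0 t \in U)) F) /=.
apply: (@le_trans _ _ (\sum_(x in U) N%:R ^+ k * q ^+ #|U|)); last first.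
  rewrite sumr_const -[_ *+ #|U|]mulr_natl ler_wpM2r ?mulr_ge0 ?exprn_ge0 //.
  by rewrite ler_nat; move: hN; lia.
rewrite [leRHS]big_mkcond; apply: ler_sum => x _.
case: ifP => xU; last by rewrite big_pred0 // => t; rewrite andbF.
have := @sum_walk N k x U; have /[swap]/[apply] : (#|U| + k <= N)%N by lia.
apply: le_trans; rewrite big_mkcond [leRHS]big_mkcond; apply: ler_sum => t _.
rewrite /F rcons_path vset_cons finset.setUA andbT.
have -> : (U :|: [set x] = U)%SET by apply/finset.setUidPl; rewrite finset.sub1set.
case: (path r x t) => //=.
by case: ifP => // _; rewrite exprn_ge0.
Qed.

Lemma sum_closed_pair k : (0 < k)%N ->
  \sum_(t : k.-tuple 'I_n | cycle r t)
  \sum_(s : k.-tuple 'I_n | cycle r s && ~~ [disjoint vset t & vset s])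
     q ^+ #|vset t :|: vset s|%SET
    <= (k * (2 * k))%N%:R * (2 * k)%N%:R ^+ k * k%:R ^+ k * (n%:R * q).
Proof.
move=> k0; rewrite -mulrA.
apply: le_trans (ler_wpM2l _ (sum_closed k0)); last first.
  by rewrite !mulr_ge0 ?exprn_ge0 ?ler0n.
rewrite mulr_sumr; apply: ler_sum => t _; apply: sum_closed_meeting => //.
have := card_vset_le t; rewrite size_tuple => h.
by rewrite mul2n -addnn leq_add2r.
Qed.

End WalkSums.

(** * Closed walks tracing a tree, and ballot numbers *)

(** The number of nonnegative paths with steps of size 1 leading from height h to
    0 in k steps. *)
Fixpoint ballot k h :=
  if k is k'.+1 then
    (ballot k' h.+1 + (if h is h'.+1 then ballot k' h' else 0))%N
  else (h == 0)%N : nat.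

Lemma ballot_gt k h : (k < h)%N -> ballot k h = 0%N.
Proof.
elim: k h => [|k IH] [|h] //= hk.
by rewrite !IH //; lia.
Qed.

Lemma ballot_odd k h : odd (k + h) -> ballot k h = 0%N.
Proof.
elim: k h => [|k IH] [|h] //= hk.
  by rewrite IH //; move: hk; rewrite addn0 addn1.
by rewrite !IH //; move: hk; rewrite !addnS /= ?negbK.
Qed.

(** The ballot theorem: nonnegative paths from h to 0 in h + 2i steps are the
    proportion (h+1)/(h+i+1) of all choices of i up-steps. *)
Lemma ballotE h i : ((h + i).+1 * ballot (h + 2 * i) h = h.+1 * 'C(h + 2 * i, i))%N.
Proof.
move: {2}(h + 2 * i)%N (erefl (h + 2 * i)%N) => k.
elim: k h i => [|k IH] h i hk.
  have [-> ->] : h = 0%N /\ i = 0%N by lia.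
  by [].
case: i hk => [|i] hk.
  have -> : h = k.+1 by lia.
  rewrite muln0 !addn0 /= bin0 muln1.
  rewrite ballot_gt // add0n.
  have := IH k 0%N; rewrite muln0 !addn0 bin0 muln1 => /(_ erefl) /eqP.
  by rewrite -{2}(muln1 k.+1) eqn_mul2l /= => /eqP ->; rewrite muln1.
have := IH h.+1 i; have -> : (h.+1 + 2 * i = k)%N by lia.
move=> /(_ erefl) A.
have hki : (i.+1 * 'C(k, i.+1) = (h + i.+1) * 'C(k, i))%N.
  by rewrite mul_bin_left; congr (_ * _)%N; lia.
rewrite hk /= binS.
case: h hk A hki => [|h] hk A hki.
  rewrite addn0; apply/eqP; rewrite -(eqn_pmul2l (m := i.+1)) //; apply/eqP.
  by move: A hki; rewrite !add0n; nia.
have := IH h i.+1; have -> : (h + 2 * i.+1 = k)%N by lia.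
move=> /(_ erefl) B.
apply/eqP; rewrite -(eqn_pmul2l (m := (h + i.+1).+1)) //; apply/eqP.
move: A B hki.
move: (ballot k h) (ballot k h.+2) 'C(k, i) 'C(k, i.+1) => b1 b2 c1 c2.
nia.
Qed.

Lemma ballot_catalan j : (j.+1 * ballot (2 * j) 0 = 'C(2 * j, j))%N.
Proof. by have := ballotE 0 j; rewrite !add0n mul1n. Qed.

Section Contour.
Variable n : nat.
Implicit Types (x y z w : 'I_n) (p t st : seq 'I_n) (e : 'I_n * 'I_n).

(** The number of ways to read a walk as a depth-first exploration of a tree: from
    the current vertex z, whose ancestors form the stack st, each step either
    goes down to a child (push) or returns to the parent (pop).  Unlike the
    number of treelike walks, the total number of readings obeys an exact
    recursion in any regular graph. *)
Fixpoint contours z st p : nat :=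
  if p is y :: p' then
    (contours y (z :: st) p' +
     (if st is w :: st' then (y == w) * contours w st' p' else 0))%N
  else (st == [::]) : nat.

Lemma contours_last z st p : contours z st p != 0%N -> last z p = last z st.
Proof.
elim: p z st => [|y p IH] z st /=; first by case: st.
rewrite addn_eq0 negb_and => /orP[/IH //|].
by case: st => [|w st] //; rewrite muln_eq0 negb_or eqb0 negbK =>
  /andP[/eqP -> /IH].
Qed.

Lemma contours_le z st p : (contours z st p <= 2 ^ size p)%N.
Proof.
elim: p z st => [|y p IH] z st /=; first by case: st.
rewrite expnS mul2n -addnn leq_add //.
case: st => // w st; case: (y == w); rewrite ?mul1n ?mul0n //.
Qed.

(** A reading pops each edge that it pushes, so that apart from the edges of the
    initial stack every edge is crossed an even number of times. *)
Lemma contours_count z st p e : contours z st p != 0%N ->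
  exists m, count_mem e (edges z p) = (count_mem e (edges z st) + 2 * m)%N.
Proof.
elim: p z st => [|y p IH] z st /=; first by case: st => //; exists 0%N.
rewrite addn_eq0 negb_and => /orP[/IH [m /= ->]|].
  exists (m + (uedge z y == e))%N; rewrite [uedge y z]uedgeC; lia.
case: st => [|w st] //; rewrite muln_eq0 negb_or eqb0 negbK.
move=> /andP[/eqP -> /IH [m ->]]; exists m => /=; lia.
Qed.

Lemma edges_inP z w p : z \notin w :: p -> forall y, uedge z y \notin edges w p.
Proof.
move=> zp y; apply/negP => /edges_in [h1 h2].
by move: zp h1 h2; rewrite /uedge; case: ifP => _ /= /negP.
Qed.

Lemma eset_cat (L L' : seq ('I_n * 'I_n)) : eset (L ++ L') = (eset L :|: eset L')%SET.
Proof. by apply/setP => e; rewrite !inE mem_cat. Qed.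

(** A walk of which the edges form a tree crossed exactly twice has one reading
    only: a step along an unused edge leads to a new vertex and must push, a step
    along an edge already used must pop.  U and H are the vertices and the edge
    crossings met so far; the parity hypothesis says that the edges crossed an
    odd number of times are those of the stack. *)
Lemma contours_tree z st p H (U : {set 'I_n}) :
  uniq (z :: st) -> (forall x, x \in z :: st -> x \in U) ->
  (forall e, e \in H -> e.1 \in U /\ e.2 \in U) ->
  #|U| = #|eset H|.+1 ->
  (forall e, odd (count_mem e H) = odd (count_mem e (edges z st))) ->
  (forall e, count_mem e (H ++ edges z p) = 0%N \/
             count_mem e (H ++ edges z p) = 2%N) ->
  #|U :|: vset p|%SET = #|eset (H ++ edges z p)|.+1 ->
  contours z st p = 1%N.
Proof.
elim: p z st H U => [|y p IH] z st H U ust sU HU cU par tot fin.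
  case: st ust sU par => [|w st] // ust sU par; exfalso.
  have := par (uedge z w); have /= := tot (uedge z w).
  rewrite cats0 eqxx; have /negbTE : uedge z w \notin edges w st.
    by apply: edges_inP; move: ust => /= /andP[].
  by move=> /negP /negP /count_memPn -> [] ->.
have zU : z \in U by apply: sU; rewrite inE eqxx.
set e := uedge z y.
have [eH|eH] := boolP (e \in H).
  have ce : (0 < count_mem e H)%N by rewrite -has_count has_pred1.
  have ce1 : count_mem e H = 1%N /\ count_mem e (edges y p) = 0%N.
    by have := tot e; rewrite count_cat /= eqxx; move: ce; case: (count_mem e H) => [|[|c1]] //; case: (count_mem _ _) => [|c2] _ [] //; rewrite ?addnS.
  have := par e; rewrite ce1.1 /= => /esym hodd.
  have est : e \in edges z st.
    by rewrite -has_pred1 has_count; move: hodd; case: (count_mem e _).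
  have push0 : contours y (z :: st) p = 0%N.
    apply/eqP; apply/negP => /negP /(contours_count e) [m].
    by rewrite /= [uedge y z]uedgeC eqxx ce1.2; lia.
  case: st ust sU par hodd est push0 => [|w st] // ust sU par hodd est push0.
  have ewz : y = w.
    move: est; rewrite /= in_cons => /orP[/eqP /uedge_inj //|].
    by rewrite (negbTE (edges_inP _ _)) //; move: ust => /= /andP[].
  rewrite /= push0 ewz eqxx mul1n add0n -ewz.
  have Uy : (U :|: vset (y :: p) = U :|: vset p)%SET.
    apply/setP => x; rewrite !inE; case: eqP => //= ->.
    by rewrite sU // !inE ewz eqxx orbT.
  have EH : eset (e :: H) = eset H.
    by apply/setP => f; rewrite !inE; case: eqP => // ->; rewrite eH.
  apply: (IH y st (e :: H) U).
  - by move: ust; rewrite ewz => /= /andP[].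
  - by move=> x xs; apply: sU; rewrite -ewz in_cons xs orbT.
  - move=> f; rewrite in_cons => /orP[/eqP ->|/HU //].
    by have := HU _ eH.
  - by rewrite EH.
  - move=> f /=; rewrite oddD par /= -ewz -/e oddD addbA addbb; by [].
  - by move=> f; have := tot f; rewrite !count_cat /= addnCA addnA.
  - rewrite -Uy fin; congr (#|pred_of_set _|.+1).
    by apply/setP => f; rewrite !(inE, mem_cat) orbCA.
have FU' f : f \in (e |: eset H)%SET -> y \in U -> f.1 \in U /\ f.2 \in U.
  rewrite !inE => /orP[/eqP -> yU|/HU //].
  by rewrite /e /uedge; case: ifP => _ /=; rewrite yU zU.
have yU : y \notin U.
  apply/negP => yU.
  have := @extend_walk _ y p U (e |: eset H)%SET yU (fun f h => FU' f h yU).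
  have -> : (e |: eset H :|: eset (edges y p) = eset (H ++ edges z (y :: p)))%SET.
    by apply/setP => f; rewrite !(inE, mem_cat) orbCA orbA.
  have -> : (U :|: vset p = U :|: vset (y :: p))%SET.
    by apply/setP => x; rewrite !inE; case: eqP => //= ->; rewrite yU.
  rewrite fin cU cardsU1 inE eH; lia.
have pop0 : (if st is w :: st' then (y == w) * contours w st' p else 0)%N = 0%N.
  case: st ust sU par => [|w st] // ust sU par.
  case: eqP => // yw; exfalso; move/negP: yU; apply.
  by apply: sU; rewrite yw !inE eqxx orbT.
rewrite /= pop0 addn0.
apply: (IH y (z :: st) (e :: H) (y |: U)%SET).
- rewrite cons_uniq ust andbT; apply/negP => /sU; exact/negP.
- by move=> x; rewrite in_cons !inE => /orP[-> //|/sU ->]; rewrite orbT.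
- move=> f; rewrite in_cons !inE => /orP[/eqP ->|/HU [-> ->]]; last by rewrite !orbT.
  by rewrite /e /uedge; case: ifP => _ /=; rewrite zU eqxx ?orbT.
- by rewrite cardsU1 yU eset_cons cardsU1 inE eH cU.
- by move=> f /=; rewrite !oddD par [uedge y z]uedgeC.
- by move=> f; have := tot f; rewrite !count_cat /= addnCA addnA.
- have -> : (y |: U :|: vset p = U :|: vset (y :: p))%SET.
    by apply/setP => x; rewrite !inE orbCA orbA.
  rewrite fin; congr (#|pred_of_set _|.+1).
  by apply/setP => f; rewrite !(inE, mem_cat) orbCA.
Qed.

(** Extremal walks among those without single crossings: the vertex count forces
    the edges to form a tree, each crossed exactly twice. *)
Definition treelike t :=
  (nsingle (cedges t) == 0%N) && (2 * #|vset t| == (size t).+2)%N.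

Definition ccontours t := if t is x :: p then contours x [::] (rcons p x) else 0%N.

Lemma nsingle0_count (L : seq ('I_n * 'I_n)) e :
  nsingle L = 0%N -> count_mem e L != 1%N.
Proof.
move=> /eqP h; apply/negP => he; move: h; rewrite /nsingle.
apply/negP; rewrite -lt0n -has_count; apply/hasP; exists e => //.
by rewrite mem_undup -has_pred1 has_count (eqP he).
Qed.

Lemma treelike_eset t : treelike t ->
  #|vset t| = #|eset (cedges t)|.+1 /\
  forall e, count_mem e (cedges t) = 0%N \/ count_mem e (cedges t) = 2%N.
Proof.
move=> /andP[/eqP h1 /eqP h2].
have h3 := card_vset_closed t.
have h4 e : (2 * #|eset (cedges t)| + (count_mem e (cedges t) - 2) <= size t)%N.
  by have := leq_eset_size (cedges t) e; rewrite h1 addn0 size_cedges.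
have h5 e : (2 * #|eset (cedges t)| <= size t)%N.
  by apply: leq_trans (h4 e); rewrite leq_addr.
split.
  case: t h1 h2 h3 h4 h5 => [|x p] h1 h2 h3 h4.
    by have := card_vset_le ([::] : seq 'I_n); move: h2 => /=; move: #|_| => m; lia.
  move=> /(_ (x, x)).
  move: h2 h3; move: #|vset _| #|eset _| (size _) => a c m; lia.
move=> e; have := h4 e; have := h5 e; have := nsingle0_count e h1.
move: h2 h3; move: #|vset _| #|eset _| (size _) (count_mem _ _) => a c m f.
by move=> h2 h3 /eqP f1 h6 h7; case: f f1 h7 => [|[|[|f]]] //; [left|right|lia].
Qed.

Lemma ccontours_treelike t : treelike t -> ccontours t = 1%N.
Proof.
move=> h; have [h1 h2] := treelike_eset h.
case: t h h1 h2 => [|x p] h h1 h2 //=; first by case/andP: h => _ /eqP; have := card_vset_le ([::] : seq 'I_n); move=> /=; move: #|_| => m; lia.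
apply: (@contours_tree x [::] (rcons p x) [::] [set x]%SET) => //.
- by move=> y; rewrite !inE.
- by rewrite cards1 /eset; congr (_.+1); apply/esym/eqP; rewrite cards_eq0; apply/eqP/setP => e; rewrite !inE.
- rewrite /= -/(cedges (x :: p)) -h1; congr (#|pred_of_set _|).
  by apply/setP => y; rewrite !(inE, mem_rcons) orbA orbb.
Qed.

Lemma ccontours_nsingle t : ccontours t != 0%N -> nsingle (cedges t) = 0%N.
Proof.
case: t => //= x p h; apply/eqP; rewrite -leqn0 leqNgt -has_count.
apply/negP => /hasP[e _ /eqP he].
by have [m] := contours_count e h; rewrite he /=; lia.
Qed.

Lemma ccontours_le t : (ccontours t <= 2 ^ size t)%N.
Proof. by case: t => // x p; rewrite /= -(size_rcons p x); exact: contours_le. Qed.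

Variables (r : rel 'I_n) (b : nat).
Hypothesis r_sym : symmetric r.
Hypothesis r_reg : forall y, #|[set z | r y z]%SET| = b.

(** The first step of a walk either pushes, with b choices, or pops, with one: the
    recursion of the ballot numbers, with a factor b for each push.  The number
    of pushes is half the length once the initial stack has been removed. *)
Lemma sum_contours k z st : path r z st ->
  (\sum_(p : k.-tuple 'I_n | path r z p) contours z st p =
   ballot k (size st) * b ^ ((k - size st)./2))%N.
Proof.
elim: k z st => [|k IH] z st rst.
  rewrite (sum_tuple0 (fun p => path r z p) (contours z st)) /=.
  by rewrite muln1; case: st rst.
rewrite (sum_tuple_cons _ (fun p => path r z p) (contours z st)) /=.
have step y : \sum_(t : k.-tuple 'I_n | r z y && path r y t)
    (contours y (z :: st) t +
     (if st is w :: st' then (y == w) * contours w st' t else 0))%N =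
  ((if r z y then ballot k (size st).+1 * b ^ ((k - (size st).+1)./2) else 0) +
   (if st is w :: st' then
      if y == w then ballot k (size st') * b ^ ((k - size st')./2) else 0
    else 0))%N.
  case: (boolP (r z y)) => [rzy|nrzy] /=; last first.
    rewrite big_pred0 //; case: st rst => // w st /= /andP[rzw _].
    by case: eqP => // yw; move: nrzy; rewrite yw rzw.
  rewrite big_split /= IH /= ?[r y z]r_sym ?rzy //.
  congr (_ + _)%N; case: st rst => [|w st] /=; first by rewrite big1.
  case/andP=> rzw rst; case: eqP => [->|_]; last by rewrite big1.
  rewrite -(IH w st) //; by apply: eq_bigr => t _; rewrite mul1n.
rewrite (eq_bigr _ (fun y _ => step y)) big_split /= mulnDl.
congr (_ + _)%N.
  rewrite -big_mkcond sum_nat_const.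
  have -> : #|[pred y | r z y]| = b by rewrite -(r_reg z) cardsE.
  have [hk|hk] := leqP (size st).+1 k; last by rewrite ballot_gt // muln0.
  rewrite mulnCA -expnS; congr (_ * b ^ _)%N.
  by rewrite (_ : (k.+1 - size st = (k - (size st).+1).+2)%N) //; lia.
case: st {step} rst => [|w st] rst /=; first by rewrite big1.
by rewrite -big_mkcond big_pred1_eq subSS.
Qed.

(** A reading from the empty stack returns to its starting vertex, so that summing
    over all walks from x amounts to summing over the closed ones. *)
Lemma sum_ccontours k : (0 < k)%N ->
  (\sum_(t : k.-tuple 'I_n | cycle r t) ccontours t =
   n * (ballot k 0 * b ^ k./2))%N.
Proof.
case: k => // k _.
rewrite (sum_tuple_cons _ (fun t => cycle r t) ccontours) /=.
rewrite -[in RHS](card_ord n) -sum_nat_const; apply: eq_bigr => x _.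
have := @sum_contours k.+1 x [::] isT; rewrite subn0 => <-.
rewrite (sum_tuple_rotr _ k (path r x) (contours x [::])).
rewrite (sum_tuple_cons _ (fun t => path r x (rotr k t)) (fun t => contours x [::] (rotr k t))).
rewrite (bigD1 x) //= [X in _ + X]big1 ?addr0.
  apply: eq_big => t; rewrite /rotr /= size_tuple subSnn rot1_cons //.
move=> y /negbTE xy; apply: big1 => t _; apply/eqP.
apply: contraFT xy; rewrite /rotr /= size_tuple subSnn rot1_cons.
by move=> /contours_last; rewrite last_rcons /= => ->.
Qed.

(** Together with the next bound: treelike walks are the readings counted by the
    ballot number, up to walks that cross every edge at least twice but visit
    too few vertices. *)
Lemma card_treelike_ge k : (0 < k)%N ->
  (\sum_(t : k.-tuple 'I_n | cycle r t && treelike t) 1 <=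
   n * (ballot k 0 * b ^ k./2))%N.
Proof.
move=> k0; rewrite -sum_ccontours // big_mkcond [leqRHS]big_mkcond.
apply: leq_sum => t _; case: (cycle r t) => //=.
by case: ifP => // /ccontours_treelike ->.
Qed.

Lemma card_treelike_le k : (0 < k)%N ->
  (n * (ballot k 0 * b ^ k./2) <=
   \sum_(t : k.-tuple 'I_n | cycle r t && treelike t) 1 +
   2 ^ k * \sum_(t : k.-tuple 'I_n | [&& cycle r t, nsingle (cedges t) == 0%N
                                        & ~~ treelike t]) 1)%N.
Proof.
move=> k0; rewrite -sum_ccontours // big_distrr big_mkcond.
rewrite [X in (_ <= X + _)%N]big_mkcond [X in (_ <= _ + X)%N]big_mkcond.
rewrite -big_split /=; apply: leq_sum => t _; case: (cycle r t) => //=.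
case: (boolP (treelike t)) => [/ccontours_treelike -> //|_ /=].
rewrite andbT; case: eqP => [_|/eqP h].
  by rewrite muln1; have := ccontours_le t; rewrite size_tuple.
rewrite leqn0; apply: contraNT h => /ccontours_nsingle ->; by [].
Qed.

End Contour.

(** * Regularity of the band relation *)

Lemma relevant_sym n b : symmetric (@relevant n b).
Proof. by move=> p q; rewrite /relevant distnC. Qed.

(** When b = 2h + 1 < n, the neighbours of y are the b residues from y - h to
    y + h modulo n. *)
Lemma relevant_reg n b (y : 'I_n) : is_bandwidth n b ->
  #|[set z | relevant b y z]%SET| = b.
Proof.
rewrite /is_bandwidth /relevant; have [-> _|bn /=] := eqVneq b n.
  have -> : [set z : 'I_n | true]%SET = finset.setT by apply/setP => z; rewrite !inE.
  by rewrite cardsT card_ord.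
case/and3P => ob b0 bn'.
pose h := ((b - 1)./2)%N; have hb : b = (2 * h).+1.
  by rewrite /h; move: ob b0; case: (b) => // m; rewrite subn1 /=; have := odd_double_half m; case: (odd m) => // <- _ _; rewrite add0n doubleK mul2n.
rewrite -/h.
have n0 : (0 < n)%N by case: (n) y => // -[].
pose g i := (y + n - h + i)%N.
pose f i := (if (g i < n)%N then g i else if (g i < 2 * n)%N then g i - n else g i - 2 * n)%N.
have yn := ltn_ord y.
have fn (i : 'I_b) : (f i < n)%N.
  by have := ltn_ord i; rewrite /f /g; case: ifP => // h1; case: ifP => h2; lia.
pose F (i : 'I_b) := Ordinal (fn i).
have -> : [set z : 'I_n | (`|y - z| <= h) || (n - h <= `|y - z|)]%N%SET = [set F i | i : 'I_b]%SET.
  apply/setP => z; rewrite !inE; have zn := ltn_ord z; apply/idP/imsetP.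
    move=> hz.
    have [i [ib fi]] : exists i, (i < b)%N /\ f i = z :> nat.
      have [h1|h1] := leqP `|y - z| h.
        exists (z + h - y)%N; rewrite /f /g; split; first by lia.
        by case: ifP => h3; [lia|case: ifP => h4; lia].
      have [h2|h2] := leqP y z.
        exists (z + h - y - n)%N; rewrite /f /g; split; first by lia.
        by case: ifP => h3; [lia|case: ifP => h4; lia].
      exists (z + h + n - y)%N; rewrite /f /g; split; first by lia.
      by case: ifP => h3; [lia|case: ifP => h4; lia].
    by exists (Ordinal ib) => //; apply: val_inj.
  move=> [i _ ->] /=; have := ltn_ord i; rewrite /f /g.
  by case: ifP => h3; [lia|case: ifP => h4; lia].
rewrite card_imset ?card_ord // => i j /(congr1 val) /= /eqP fij.
apply: val_inj; have := ltn_ord i; have := ltn_ord j; move: fij; rewrite /f /g /=.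
case: ifP => h3; [|case: ifP => h4]; (case: ifP => h5; [|case: ifP => h6]); move=> /eqP; lia.
Qed.

(** * Traces of powers as sums over closed walks *)

Section Trace.
Variables (R : comNzRingType) (n : nat).
Implicit Types (A : 'M[R]_n) (x y : 'I_n) (p t : seq 'I_n).

Definition wprod A (L : seq ('I_n * 'I_n)) := \prod_(e <- L) A e.1 e.2.

Lemma wprod_cat A L L' : wprod A (L ++ L') = wprod A L * wprod A L'.
Proof. by rewrite /wprod big_cat. Qed.

(** Symmetry makes the entry depend on the undirected edge only. *)
Lemma symE A : A^T = A -> forall x y, A (uedge x y).1 (uedge x y).2 = A x y.
Proof.
by move=> As x y; rewrite /uedge; case: ifP => _ //=; rewrite -{1}As mxE.
Qed.

Lemma expmx_walk A k x y : A^T = A ->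
  (A ^+ k) x y = \sum_(p : k.-tuple 'I_n | last x p == y) wprod A (edges x p).
Proof.
move=> As; elim: k x => [|k IH] x.
  rewrite (sum_tuple0 (fun p => last x p == y) (fun p => wprod A (edges x p))) /=.
  by rewrite expr0 /wprod big_nil mxE; case: (x == y).
rewrite (sum_tuple_cons _ (fun p => last x p == y) (fun p => wprod A (edges x p))).
rewrite exprS mxE; apply: eq_bigr => z _; rewrite IH mulr_sumr /=.
by apply: eq_bigr => p _; rewrite /wprod big_cons symE.
Qed.

Lemma trace_walk A k : A^T = A -> (0 < k)%N ->
  \tr (A ^+ k) = \sum_(t : k.-tuple 'I_n) wprod A (cedges t).
Proof.
move=> As; case: k => // k _.
rewrite (sum_tuple_cons _ predT (fun t => wprod A (cedges t))) /=.
apply: eq_bigr => x _; rewrite expmx_walk //.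
rewrite (sum_tuple_rotr _ k (fun p => last x p == x) (fun p => wprod A (edges x p))).
rewrite (sum_tuple_cons _ (fun p => last x (rotr k p) == x)
  (fun p => wprod A (edges x (rotr k p)))).
have E y (p : k.-tuple 'I_n) : rotr k (y :: p) = rcons p y.
  by rewrite /rotr /= size_tuple subSnn rot1_cons.
rewrite (bigD1 x) //= [X in _ + X]big1 ?addr0.
  by apply: eq_big => p; rewrite E ?last_rcons ?eqxx.
move=> y /negbTE xy; apply: big_pred0 => p; by rewrite E last_rcons.
Qed.
End Trace.

Section BandTrace.
Variables (R : realType) (n b : nat).
Implicit Types (A : 'M[R]_n) (x y : 'I_n) (p t : seq 'I_n).
Let beta : R := Num.sqrt b%:R.

Lemma band_matrix_sym A : A^T = A -> (band_matrix b A)^T = band_matrix b A.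
Proof.
move=> As; apply/matrixP => i j; rewrite !mxE relevant_sym.
by rewrite -[in LHS]As mxE.
Qed.

Lemma wprod_band A x p : A^T = A ->
  wprod (band_matrix b A) (edges x p) =
  if path (relevant b) x p then beta ^- size p * wprod A (edges x p) else 0.
Proof.
move=> As; elim: p x => [|y p IH] x /=.
  by rewrite /wprod !big_nil expr0 invr1 mul1r.
rewrite /wprod !big_cons -!/(wprod _ _) IH.
rewrite !symE //; last exact: band_matrix_sym.
rewrite !mxE; case: (relevant b x y) => /=; last by rewrite mulr0 mul0r.
case: ifP => _; last by rewrite mulr0.
by rewrite exprS invfM -!mulrA; congr (_ * _); rewrite mulrCA.
Qed.

Lemma trace_band A k : A^T = A -> (0 < k)%N ->
  \tr (band_matrix b A ^+ k) =
  beta ^- k * \sum_(t : k.-tuple 'I_n | cycle (relevant b) t) wprod A (cedges t).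
Proof.
move=> As k0; rewrite trace_walk //; last exact: band_matrix_sym.
rewrite mulr_sumr [RHS]big_mkcond; apply: eq_bigr => t _.
case: k t k0 => // k t _; case/tupleP: t => x p /=.
by rewrite wprod_band // size_rcons size_tuple.
Qed.
End BandTrace.

(** * Spectrum of a real symmetric matrix *)

Section Spectral.
Variables (R : rcfType) (n : nat).
Local Notation toC := (real_complex R).

Lemma char_poly_conj (F : fieldType) (P D : 'M[F]_n) : P \in unitmx ->
  char_poly (invmx P *m D *m P) = char_poly D.
Proof.
move=> uP; rewrite /char_poly /char_poly_mx.
have PP : map_mx (@polyC F) (invmx P) *m map_mx (@polyC F) P = 1%:M.
  by rewrite -map_mxM mulVmx // map_mx1.
have -> : 'X%:M - map_mx (@polyC F) (invmx P *m D *m P) =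
  map_mx (@polyC F) (invmx P) *m ('X%:M - map_mx (@polyC F) D) *m map_mx (@polyC F) P.
  rewrite mulmxBr mulmxBl !map_mxM; congr (_ - _).
  by rewrite scalar_mxC -mulmxA PP mulmx1.
by rewrite !det_mulmx mulrAC -det_mulmx PP det1 mul1r.
Qed.

Lemma char_poly_diag (F : fieldType) (D : 'rV[F]_n) :
  char_poly (diag_mx D) = \prod_i ('X - (D 0 i)%:P).
Proof.
rewrite char_poly_trig ?diag_mx_is_trig //.
by apply: eq_bigr => i _; rewrite mxE eqxx mulr1n.
Qed.

Lemma expmx_conj (F : fieldType) (P D : 'M[F]_n) k : P \in unitmx ->
  (invmx P *m D *m P) ^+ k = invmx P *m (D ^+ k) *m P.
Proof.
move=> uP; elim: k => [|k IH].
  by rewrite !expr0 -[1]/(1%:M) mulmx1 mulVmx.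
rewrite !exprS IH -![_ * _]/(_ *m _) !mulmxA; congr (_ *m _).
by rewrite -!mulmxA mulKVmx.
Qed.

Lemma expmx_diag (F : fieldType) (D : 'rV[F]_n) k :
  diag_mx D ^+ k = diag_mx (\row_i D 0 i ^+ k).
Proof.
elim: k => [|k IH].
  by rewrite expr0; apply/matrixP => i j; rewrite !mxE expr0.
rewrite exprS IH -[_ * _]/(_ *m _) mulmx_diag; congr diag_mx.
by apply/rowP => i; rewrite !mxE exprS.
Qed.

(** A real symmetric matrix is hermitian over the complex numbers, hence unitarily
    diagonalisable there with real eigenvalues; the characteristic polynomial and
    the traces of powers are then read off the diagonal. *)
Lemma sym_spectral (A : 'M[R]_n) : A^T = A ->
  exists l : 'rV[R]_n, char_poly A = \prod_i ('X - (l 0 i)%:P) /\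
    forall k, \tr (A ^+ k) = \sum_i l 0 i ^+ k.
Proof.
move=> As; pose A' := map_mx toC A.
have hA : A' \is hermsymmx.
  apply: realsym_hermsym.
    apply/is_hermitianmxP; rewrite expr0 scale1r map_mx_id_in //.
      by rewrite /A' map_trmx As.
  by apply/mxOverP => i j; rewrite mxE; apply/complex_realP; exists (A i j).
have /orthomx_spectralP E := hermitian_normalmx hA.
have rD := hermitian_spectral_diag_real hA.
set P := spectralmx A' in E; set D := spectral_diag A' in E rD.
have uP : P \in unitmx := spectral_unit _.
pose l : 'rV[R]_n := map_mx (@complex.Re R) D.
have Dl : D = map_mx toC l.
  apply/rowP => i; rewrite !mxE; have /mxOverP /(_ 0 i) /complex_realP [x ->] := rD.
  by [].
exists l; split.
  apply: (@map_poly_inj _ _ toC); rewrite map_char_poly -/A' E char_poly_conj //.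
  rewrite char_poly_diag Dl rmorph_prod; apply: eq_bigr => i _.
  by rewrite rmorphB /= map_polyX map_polyC /= mxE.
move=> k; apply: (@complexI R); rewrite -[LHS]trace_map_mx rmorph_sum /=.
have -> : map_mx toC (A ^+ k) = A' ^+ k by rewrite rmorphXn.
rewrite E expmx_conj // -mulmxA mxtrace_mulC mulmxK // expmx_diag mxtrace_diag.
by apply: eq_bigr => i _; rewrite Dl !mxE rmorphXn.
Qed.

End Spectral.

Lemma spectrum_sym (R : realType) n (A : 'M[R]_n) : A^T = A ->
  size (spectrum A) = n /\
  forall k, \sum_(x <- spectrum A) x ^+ k = \tr (A ^+ k).
Proof.
move=> /sym_spectral [l [h1 h2]].
have pm : perm_eq (spectrum A) [seq l 0 i | i <- index_enum 'I_n].
  apply/allP => x _ /=; rewrite count_spectrum h1.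
  by rewrite -(big_map (fun i => l 0 i) predT (fun y => 'X - y%:P)) mu_prod_XsubC.
split; first by rewrite (perm_size pm) size_map /index_enum -enumT size_enum_ord.
by move=> k; rewrite h2 (perm_big _ pm) /= big_map.
Qed.

(** * Moments of the semicircle distribution *)

Section SemicircleMoments.
Variable R : realType.
Local Notation mu := (@lebesgue_measure R).
Local Notation I := (`[- (pi / 2), pi / 2]%classic : set R).

Let pi2 : - (pi / 2) < pi / 2 :> R.
Proof. by rewrite gtrN ?divr_gt0 ?pi_gt0. Qed.

Lemma continuous_itv_integrable (f : R -> R) (a b : R) : continuous f ->
  mu.-integrable `[a, b] (EFin \o f).
Proof.
move=> cf; apply: continuous_compact_integrable; first exact: segment_compact.
exact: continuous_subspaceT.
Qed.

Lemma Rintegral_FTC (f F : R -> R) (a b : R) : a < b -> continuous f ->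
  (forall x : R, is_derive x 1 F (f x)) ->
  \int[mu]_(x in `[a, b]) f x = F b - F a.
Proof.
move=> ab cf dF.
have cF : continuous F.
  by move=> x; apply: differentiable_continuous; apply/derivable1_diffP.
rewrite /Rintegral (@continuous_FTC2 _ f F) //.
- exact: continuous_subspaceT.
- split; first by move=> x _; case: (dF x).
  + exact/cvg_at_right_filter/cF.
  + exact/cvg_at_left_filter/cF.
- by move=> x _; rewrite derive1E; case: (dF x).
Qed.

Lemma continuous_sqrt4 : continuous (fun x : R => Num.sqrt (4 - x ^+ 2)).
Proof.
move=> x; have h : {for x, continuous (fun x : R => 4 - x ^+ 2)}.
  by apply: cvgB; [exact: cvg_cst|exact: exprn_continuous].
exact: (continuous_comp h (@sqrt_continuous R _)).
Qed.

(** Up to a constant, the moment of the semicircle distribution after the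
    substitution x = 2 sin t. *)
Definition trig_moment k := \int[mu]_(x in I) (sin x ^+ k * cos x ^+ 2).

Lemma continuous_sinX k : continuous (fun x : R => sin x ^+ k).
Proof.
move=> x; apply: (@continuous_comp _ _ _ sin (fun y => y ^+ k)).
  exact: continuous_sin.
exact: exprn_continuous.
Qed.

Lemma continuous_cosX k : continuous (fun x : R => cos x ^+ k).
Proof.
move=> x; apply: (@continuous_comp _ _ _ cos (fun y => y ^+ k)).
  exact: continuous_cos.
exact: exprn_continuous.
Qed.

Lemma continuous_sincosX k m : continuous (fun x : R => sin x ^+ k * cos x ^+ m).
Proof.
move=> x; apply: cvgM; first exact: continuous_sinX.
exact: continuous_cosX.
Qed.

Lemma trig_moment0 : trig_moment 0 = pi / 2.
Proof.
rewrite /trig_moment.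
have -> : (fun x : R => sin x ^+ 0 * cos x ^+ 2) = fun x => cos x ^+ 2.
  by apply/funext => x; rewrite expr0 mul1r.
have dF (x : R) : is_derive x 1 (fun x => 2^-1 * (x + sin x * cos x)) (cos x ^+ 2).
  apply: is_derive_eq; rewrite /GRing.scale /=.
  have := cos2Dsin2 x; rewrite !expr2 => h.
  have -> : sin x * - sin x = cos x * cos x - 1 by rewrite -h; ring.
  by rewrite /=; lra.
rewrite (Rintegral_FTC pi2 _ dF).
- by rewrite sinN cosN cos_pihalf !mulr0 !addr0; lra.
- exact: continuous_cosX.
Qed.

Lemma trig_moment1 : trig_moment 1 = 0.
Proof.
have dF (x : R) : is_derive x 1 (fun x => - 3^-1 * cos x ^+ 3) (sin x ^+ 1 * cos x ^+ 2).
  by apply: is_derive_eq; rewrite /GRing.scale /= expr1 ?mulr1; field.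
rewrite /trig_moment (Rintegral_FTC pi2 _ dF); first by rewrite cosN subrr.
exact: continuous_sincosX.
Qed.

(** Integration by parts, in the form of the primitive - sin^(k+1) cos^3, which
    vanishes at both ends. *)
Lemma trig_moment_rec k : k.+4%:R * trig_moment k.+2 = k.+1%:R * trig_moment k.
Proof.
apply/eqP; rewrite -subr_eq0; apply/eqP.
pose f (x : R) := k.+4%:R * (sin x ^+ k.+2 * cos x ^+ 2) -
                  k.+1%:R * (sin x ^+ k * cos x ^+ 2).
have c1 m c : continuous (fun x : R => c * (sin x ^+ m * cos x ^+ 2)).
  by move=> x; apply: cvgM; [exact: cvg_cst|exact: continuous_sincosX].
have -> : k.+4%:R * trig_moment k.+2 - k.+1%:R * trig_moment k =
          \int[mu]_(x in I) f x.
  rewrite RintegralB //; try exact: continuous_itv_integrable.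
  by rewrite !RintegralZl //; exact/continuous_itv_integrable/continuous_sincosX.
have dF (x : R) : is_derive x 1 (fun x => - (sin x ^+ k.+1 * cos x ^+ 3)) (f x).
  have ds : is_derive x 1 (fun x => sin x ^+ k.+1) ((k.+1%:R * sin x ^+ k) *: cos x).
    by have := is_deriveX k.+1 (is_derive_sin x); rewrite exprfctE.
  have dc : is_derive x 1 (fun x => cos x ^+ 3) ((3%:R * cos x ^+ 2) *: - sin x).
    by have := is_deriveX 3 (is_derive_cos x); rewrite exprfctE.
  apply: (is_derive_eq (is_deriveN (is_deriveM ds dc))).
  rewrite /f /GRing.scale /=.
  rewrite -!natr1 !exprS expr0.
  have h : cos x * cos x = 1 - sin x * sin x.
    by have := cos2Dsin2 x; rewrite !expr2 => <-; ring.
  apply/eqP; rewrite -subr_eq0; apply/eqP.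
  transitivity (- (k%:R + 1) * sin x ^+ k * (cos x * cos x) *
    (cos x * cos x - (1 - sin x * sin x))); first by ring.
  by rewrite h subrr mulr0.
rewrite (Rintegral_FTC pi2 _ dF).
  by rewrite cosN cos_pihalf !expr0n /= !mulr0 subrr.
by move=> x; apply: cvgB; exact: c1.
Qed.

Lemma Rintegral_sqrt_trig k :
  \int[mu]_(x in `[- 2, 2]) (x ^+ k * Num.sqrt (4 - x ^+ 2)) =
  2 ^+ k * 4 * trig_moment k.
Proof.
pose F (x : R) : R := 2 * sin x.
have dF (x : R) : is_derive x 1 F (2 * cos x).
  by apply: is_derive_eq; rewrite /GRing.scale /= ?mulr0 ?addr0.
have F'E : derive1 F = fun x => 2 * cos x.
  by apply/funext => x; rewrite derive1E; case: (dF x).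
have cF' : continuous (derive1 F).
  rewrite F'E => x; apply: cvgM; [exact: cvg_cst|exact: continuous_cos].
have cF : continuous F.
  move=> x; apply: cvgM; [exact: cvg_cst|exact: continuous_sin].
have Fb : F (pi / 2) = 2 by rewrite /F sin_pihalf mulr1.
have Fa : F (- (pi / 2)) = - 2 by rewrite /F sinN sin_pihalf mulrN1.
pose G (x : R) := x ^+ k * Num.sqrt (4 - x ^+ 2).
have cG : continuous G.
  move=> x; apply: cvgM; first exact: exprn_continuous.
  exact: continuous_sqrt4.
have := @integration_by_substitution_increasing R F G _ _ (ltW pi2).
rewrite Fa Fb => sub.
rewrite /Rintegral -[in LHS]/G sub; last first.
- exact: continuous_subspaceT.
- split; first by move=> x _; case: (dF x).
  + exact/cvg_at_right_filter/cF.
  + exact/cvg_at_left_filter/cF.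
- by apply/cvg_ex; exists (derive1 F (pi / 2)); exact/cvg_at_left_filter/cF'.
- by apply/cvg_ex; exists (derive1 F (- (pi / 2))); exact/cvg_at_right_filter/cF'.
- by move=> x _; exact: cF'.
- by move=> x y xI yI xy; rewrite /F ltr_pM2l // ltr_sin.
rewrite -[LHS]/(Rintegral _ _ _) -RintegralZl //; last first.
  exact/continuous_itv_integrable/continuous_sincosX.
apply: eq_Rintegral => x; rewrite inE /= in_itv /= => xI.
rewrite /G /= F'E /F.
have -> : 4 - (2 * sin x) ^+ 2 = (2 * cos x) ^+ 2.
  by rewrite exprMn [in RHS]exprMn cos2sin2 mulrBr mulr1; congr (_ - _); rewrite expr2 -natrM.
rewrite sqrtr_sqr ger0_norm; last first.
  by rewrite mulr_ge0 // cos_ge0_pihalf.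
by rewrite exprMn [cos x ^+ 2]expr2; ring.
Qed.

Definition sc_moment k : R := (2 * pi)^-1 * (2 ^+ k * 4 * trig_moment k).

Lemma sc_moment0 : sc_moment 0 = 1.
Proof.
rewrite /sc_moment trig_moment0 expr0 mul1r.
by have := lt0r_neq0 (pi_gt0 R); move: (pi : R) => c c0; field.
Qed.

(** The recursion of the trigonometric moments is that of the Catalan numbers. *)
Lemma sc_momentE k :
  sc_moment k = if odd k then 0 else ('C(k, k./2))%:R / (k./2).+1%:R.
Proof.
elim/ltn_ind: k => -[|[|k]] IH.
- by rewrite sc_moment0 bin0 invr1 mulr1.
- by rewrite /sc_moment trig_moment1 !mulr0.
have rec : (k + 4)%N%:R * sc_moment k.+2 = 4 * k.+1%:R * sc_moment k.
  rewrite /sc_moment.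
  transitivity ((2 * pi)^-1 * 2 ^+ k.+2 * 4 * (k.+4%:R * trig_moment k.+2)).
    by rewrite addn4; ring.
  by rewrite trig_moment_rec !exprS; ring.
have k4 : (k + 4)%N%:R != 0 :> R by rewrite pnatr_eq0 addn4.
apply: (mulfI k4); rewrite rec IH //= negbK.
case: ifP => ok; first by rewrite !mulr0.
have [j kj jE] : exists2 j, k = (2 * j)%N & k./2 = j.
  by exists k./2 => //; rewrite mul2n -[LHS]odd_double_half ok.
rewrite jE.
have hb : (j.+1 * 'C(k.+2, j.+1) = 2 * k.+1 * 'C(k, j))%N.
  have h1 : (j.+1 * 'C(k.+2, j.+1) = k.+2 * 'C(k.+1, j))%N by rewrite mul_bin_diag.
  have h2 : (j.+1 * 'C(k.+1, j) = k.+1 * 'C(k, j))%N.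
    have := mul_bin_down k.+1 j.
    by have -> : (k.+1 - j = j.+1)%N by lia.
  rewrite h1; have -> : k.+2 = (2 * j.+1)%N by lia.
  by rewrite -mulnA h2 mulnA.
have hR : j.+1%:R * 'C(k.+2, j.+1)%:R = 2 * k.+1%:R * 'C(k, j)%:R :> R.
  by rewrite -!natrM hb !natrM.
have j1 : j.+1%:R != 0 :> R by rewrite pnatr_eq0.
have j2 : j.+2%:R != 0 :> R by rewrite pnatr_eq0.
have -> : (k + 4)%N%:R = 2 * j.+2%:R :> R by rewrite -natrM; congr (_%:R); lia.
move: hR j1 j2; move: (j.+1%:R : R) (j.+2%:R : R) => a c hR a0 c0.
transitivity (2 * (2 * k.+1%:R * 'C(k, j)%:R) / a); first by field.
by rewrite -hR; field; rewrite a0 c0.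
Qed.
End SemicircleMoments.

(** * Integration against the semicircle distribution *)

Section SemicircleIntegral.
Variable R : realType.
Local Notation mu := (@lebesgue_measure R).
Local Notation sc := (@semicircle R).
Local Notation I2 := (`[-2, 2]%classic : set R).

Let wt (x : R) : R := (2 * pi)^-1 * Num.sqrt (4 - x ^+ 2).

Let continuous_wt : continuous wt.
Proof.
move=> x; apply: cvgM; first exact: cvg_cst.
exact: continuous_sqrt4.
Qed.

Let pdfE : @semicircle_pdf R = wt \_ I2.
Proof.
apply/funext => x; rewrite /semicircle_pdf patchE indicE.
by case: ifPn => xI; rewrite ?mulr1 ?mulr0.
Qed.

Lemma integral_pdf (f : R -> R) :
  (\int[mu]_x (f x * semicircle_pdf x)%:E =
   \int[mu]_(x in I2) (f x * wt x)%:E)%E.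
Proof.
rewrite [RHS]integral_mkcond; apply: eq_integral => x _.
by rewrite pdfE !patchE; case: ifPn; rewrite ?mulr0.
Qed.

Lemma semicircle_setT : sc setT = 1%E.
Proof.
rewrite /semicircle.
have -> : (\int[mu]_(x in setT) (semicircle_pdf x)%:E =
  \int[mu]_x ((fun=> 1) x * semicircle_pdf x)%:E)%E.
  by apply: eq_integral => x _; rewrite mul1r.
rewrite integral_pdf.
have iw : mu.-integrable I2 (EFin \o (fun x => 1 * wt x)).
  by apply: continuous_itv_integrable => x; apply: cvgM; [exact: cvg_cst|exact: continuous_wt].
rewrite -(fineK (integrable_fin_num _ iw)) //; congr (_%:E).
transitivity (sc_moment R 0); last exact: sc_moment0.
rewrite /sc_moment -Rintegral_sqrt_trig -RintegralZl //; last first.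
  apply: continuous_itv_integrable => x; apply: cvgM; first exact: exprn_continuous.
  exact: continuous_sqrt4.
rewrite -[LHS]/(Rintegral mu _ (fun x => 1 * wt x)).
by apply: eq_Rintegral => x _; rewrite expr0 !mul1r.
Qed.

HB.instance Definition _ :=
  @Measure_isProbability.Build _ _ _ sc semicircle_setT.

(** The semicircle measure on the measurable type that carries the Lebesgue
    measure, where the Radon-Nikodym change of variables can compare the two. *)
Definition semicircleR : set (measurableTypeR R) -> \bar R := sc.

HB.instance Definition _ := @isMeasure.Build _ (measurableTypeR R) R
  semicircleR (measure0 sc) (measure_ge0 sc) (@measure_semi_sigma_additive _ _ _ sc).

HB.instance Definition _ :=
  @Measure_isProbability.Build _ _ _ semicircleR semicircle_setT.

Let mid1 : measurable_fun setT (id : R -> measurableTypeR R).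
Proof. by move=> _ Y mY; rewrite setTI. Qed.

Let mid2 : measurable_fun setT (id : measurableTypeR R -> R).
Proof. by move=> _ Y mY; rewrite setTI. Qed.

Lemma semicircleR_dom : semicircleR `<< mu.
Proof.
apply/null_content_dominatesP => A mA muA0.
rewrite /= /semicircleR /semicircle; apply: null_set_integral => //.
by apply/measurable_EFinP; apply: measurable_funTS; exact: measurable_semicircle_pdf.
Qed.

Let semicircleR_integral (f : R -> R) : semicircleR.-integrable setT (EFin \o f) ->
  (\int[semicircleR]_x (f x)%:E = \int[mu]_(x in I2) (f x * wt x)%:E)%E.
Proof.
move=> fi; rewrite -integral_pdf.
rewrite -(Radon_Nikodym_change_of_variables semicircleR_dom) //=.
have mf := measurable_int _ fi.
apply: ae_eq_integral => //.
- apply: emeasurable_funM => //; apply: (measurable_int mu).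
  by apply: Radon_Nikodym_integrable; exact: semicircleR_dom.
- under eq_fun do rewrite EFinM.
  apply: emeasurable_funM => //; apply/measurable_EFinP.
  exact: measurable_semicircle_pdf.
- under [X in ae_eq _ _ _ X]eq_fun do rewrite EFinM.
  apply: ae_eqe_mul2l => /=.
  rewrite Radon_NikodymE //=; first exact: semicircleR_dom.
  move=> abmu; case: cid => /= h [h1 h2 h3].
  apply: integral_ae_eq => //=.
  + by apply/measurable_EFinP; exact: measurable_semicircle_pdf.
  + by move=> E _ mE; rewrite -h3.
Qed.

Lemma semicircle_outside : sc (~` I2) = 0%E.
Proof.
rewrite /semicircle /=; apply: integral0_eq => x /= nx.
rewrite pdfE patchE; case: ifPn => //; rewrite inE => xI.
by case: nx.
Qed.

Lemma semicircle_integrable (f : R -> R) : continuous f ->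
  sc.-integrable setT (EFin \o f).
Proof.
move=> cf; have mf := continuous_measurable_fun cf.
have mI : measurable I2 by exact: measurable_itv.
have /integrableP[_ h] : sc.-integrable I2 (EFin \o f).
  apply: measurable_bounded_integrable => //.
  - by rewrite (le_lt_trans _ (ltry 1)) // -semicircle_setT le_measure ?inE.
  - exact: measurable_funTS.
  - have := @continuous_compact _ _ f I2.
    move=> /(_ (continuous_subspaceT cf) (@segment_compact _ _ _)) /compact_bounded.
    by move=> [M [Mr hM]]; exists M; split => // y /hM {}hM x /= xI; apply: hM; exists x.
apply/integrableP; split; first exact/measurable_EFinP.
rewrite (ge0_negligible_integral (measurableC mI)) //.
- by rewrite setDE setCK setTI.
- by do 2 apply: measurableT_comp => //.
- exact: semicircle_outside.
Qed.

Lemma semicircle_le (f : R -> R) M : continuous f ->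
  (forall x, - 2 <= x <= 2 -> `|f x| <= M) -> `|\int[sc]_x f x| <= M.
Proof.
move=> cf hM; have fi := semicircle_integrable cf.
apply: le_trans (le_normr_Rintegral _ fi) _ => //.
have mI : measurable I2 by exact: measurable_itv.
have mf := continuous_measurable_fun cf.
have M0 : 0 <= M.
  by apply: le_trans (hM 0 _); rewrite ?normr_ge0 // oppr_le0 !ler0n.
have sI : (sc I2 <= 1)%E by rewrite -semicircle_setT le_measure ?inE.
have mnf : measurable_fun setT (fun x => `|f x|%:E).
  by apply/measurable_EFinP; apply: measurableT_comp.
have le1 : (\int[sc]_x `|f x|%:E <= M%:E)%E.
  rewrite (ge0_negligible_integral (measurableC mI)) //; last exact: semicircle_outside.
  rewrite setDE setCK setTI.
  apply: (@le_trans _ _ (\int[sc]_(x in I2) M%:E)%E).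
    apply: ge0_le_integral => //; exact: measurable_funTS.
  rewrite (integral_cst sc mI M%:E) -[leRHS]mule1.
  by apply: lee_wpmul2l; rewrite ?lee_fin.
rewrite -lee_fin fineK // ge0_fin_numE ?integral_ge0 //.
exact: le_lt_trans le1 (ltry _).
Qed.

Lemma semicircle_integral (f : R -> R) : continuous f ->
  (\int[sc]_x (f x)%:E = \int[mu]_(x in I2) (f x * wt x)%:E)%E.
Proof.
move=> cf; have fi := semicircle_integrable cf.
have mf : measurable_fun setT (EFin \o f).
  by apply/measurable_EFinP; exact: continuous_measurable_fun.
have mf' : measurable_fun [set: measurableTypeR R] (EFin \o f) by exact: mf.
have fiR : semicircleR.-integrable setT (EFin \o f).
  have /integrableP[_ h] := integrable_pushforward mid1 mf' fi measurableT.
  apply/integrableP; split; first exact: mf'.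
  apply: le_lt_trans h; rewrite le_eqVlt; apply/orP; left; apply/eqP.
  by apply: eq_measure_integral => A mA _; reflexivity.
rewrite -(semicircleR_integral fiR).
transitivity (\int[pushforward semicircleR (id : measurableTypeR R -> R)]_x (EFin \o f) x)%E.
  by apply: eq_measure_integral => A mA _; reflexivity.
by rewrite (integral_pushforward mid2 mf fiR measurableT).
Qed.

Lemma semicircle_exp k : \int[sc]_x (x ^+ k) = sc_moment R k.
Proof.
rewrite /Rintegral semicircle_integral; last exact: exprn_continuous.
rewrite /sc_moment -Rintegral_sqrt_trig -RintegralZl //; last first.
  apply: continuous_itv_integrable => x; apply: cvgM; first exact: exprn_continuous.
  exact: continuous_sqrt4.
rewrite -[LHS]/(Rintegral mu _ (fun x => x ^+ k * wt x)).
by apply: eq_Rintegral => x _; rewrite /wt mulrCA.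
Qed.

Lemma continuous_horner (p : {poly R}) : continuous (fun x : R => p.[x]).
Proof.
elim/poly_ind: p => [|p c IH] x.
  by under eq_fun do rewrite horner0; exact: cst_continuous.
under eq_fun do rewrite hornerMXaddC.
by apply: cvgD; [apply: cvgM; [exact: IH|exact: cvg_id]|exact: cvg_cst].
Qed.

Lemma semicircle_poly (p : {poly R}) :
  \int[sc]_x p.[x] = \sum_(i < size p) p`_i * sc_moment R i.
Proof.
have -> : (fun x : R => p.[x]) = fun x => \sum_(i < size p) p`_i * x ^+ i.
  by apply/funext => x; rewrite horner_coef.
elim: (size p) => [|m IH].
  rewrite big_ord0; under eq_fun do rewrite big_ord0.
  by rewrite Rintegral_cst // mul0r.
under eq_fun do rewrite big_ord_recr /=.
rewrite RintegralD //; last 2 first.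
- apply: semicircle_integrable => x.
  by under eq_fun do rewrite -horner_poly; exact: continuous_horner.
- apply: semicircle_integrable => x; apply: cvgM; first exact: cvg_cst.
  exact: exprn_continuous.
rewrite big_ord_recr /= IH RintegralZl ?semicircle_exp //.
exact/semicircle_integrable/exprn_continuous.
Qed.

End SemicircleIntegral.

(** * Polynomial approximation of continuous functions *)

Section Weierstrass.
Variable R : realType.

(** The Bernstein polynomial of the values h 0, ..., h n, by conditioning on the
    first of n Bernoulli trials with success probability 'X. *)
Fixpoint bernstein n (h : nat -> R) : {poly R} :=
  if n is n'.+1 then
    'X * bernstein n' (fun i => h i.+1) + (1 - 'X) * bernstein n' h
  else (h 0%N)%:P.

Lemma bernsteinS n h u : (bernstein n.+1 h).[u] =
  u * (bernstein n (fun i => h i.+1)).[u] + (1 - u) * (bernstein n h).[u].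
Proof. by rewrite /= !hornerE. Qed.

Lemma bernstein0 h u : (bernstein 0 h).[u] = h 0%N.
Proof. by rewrite /= hornerE. Qed.

Lemma bernstein_le n h g u : 0 <= u <= 1 -> (forall i, (i <= n)%N -> h i <= g i) ->
  (bernstein n h).[u] <= (bernstein n g).[u].
Proof.
move=> /andP[u0 u1]; elim: n h g => [|n IH] h g hg.
  by rewrite !bernstein0 hg.
rewrite !bernsteinS lerD // ler_wpM2l ?subr_ge0 //; apply: IH => i ilen.
  exact: hg.
by apply: hg; exact: leqW.
Qed.

Lemma bernstein_lin n a h g u :
  (bernstein n (fun i => a * h i + g i)).[u] =
  a * (bernstein n h).[u] + (bernstein n g).[u].
Proof.
elim: n h g => [|n IH] h g; first by rewrite !bernstein0.
by rewrite !bernsteinS (IH (fun i => h i.+1) (fun i => g i.+1)) IH; ring.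
Qed.

Lemma bernstein_cst n c u : (bernstein n (fun=> c)).[u] = c.
Proof. by elim: n => [|n IH]; rewrite ?bernstein0 // bernsteinS !IH; ring. Qed.

(** The variance of the binomial distribution. *)
Lemma bernstein_sq n c u : (bernstein n (fun i => (i%:R - c) ^+ 2)).[u] =
  n%:R * u * (1 - u) + (n%:R * u - c) ^+ 2.
Proof.
elim: n c => [|n IH] c; first by rewrite bernstein0; ring.
rewrite bernsteinS IH.
have -> : (fun i => (i.+1%:R - c) ^+ 2) = (fun i => (i%:R - (c - 1)) ^+ 2).
  by apply/funext => i; rewrite -natr1; congr (_ ^+ 2); ring.
by rewrite IH -natr1; ring.
Qed.

(** Chebyshev's argument: the quadratic term of the modulus of continuity averages
    to K times the variance of the empirical frequency, at most K / n. *)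
Lemma bernstein_approx n (g : R -> R) u e K : (0 < n)%N -> 0 <= u <= 1 -> 0 <= K ->
  (forall s, 0 <= s <= 1 -> `|g s - g u| <= e + K * (s - u) ^+ 2) ->
  `|(bernstein n (fun i => g (i%:R / n%:R))).[u] - g u| <= e + K / n%:R.
Proof.
move=> n0 u01 K0 hg; have n0R : 0 < n%:R :> R by rewrite ltr0n.
pose H i := (K / n%:R ^+ 2) * (i%:R - n%:R * u) ^+ 2 + e.
have HE : (bernstein n H).[u] <= e + K / n%:R.
  rewrite /H (bernstein_lin n _ (fun i => (i%:R - n%:R * u) ^+ 2) (fun=> e)).
  rewrite bernstein_cst bernstein_sq subrr expr0n /= addr0 addrC lerD2l.
  have -> : K / n%:R ^+ 2 * (n%:R * u * (1 - u)) = K / n%:R * (u * (1 - u)).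
    by field; rewrite gt_eqF.
  rewrite ler_piMr ?divr_ge0 ?ler0n //.
  by case/andP: u01 => u0 u1; rewrite mulr_ile1 ?subr_ge0 // gerBl.
have hi i : (i <= n)%N -> `|g (i%:R / n%:R) - g u| <= H i.
  move=> ilen; have := hg (i%:R / n%:R).
  rewrite divr_ge0 ?ler0n // ler_pdivrMr // mul1r ler_nat ilen => /(_ isT).
  have -> : e + K * (i%:R / n%:R - u) ^+ 2 = H i => //.
  by rewrite /H; field; rewrite gt_eqF.
rewrite ler_norml lerBrDr lerBlDr; apply/andP; split.
  apply: (@le_trans _ _ (g u - (bernstein n H).[u])).
    by rewrite addrC lerD2l lerN2.
  have <- : (bernstein n (fun i => -1 * H i + g u)).[u] = g u - (bernstein n H).[u].
    by rewrite (bernstein_lin n (-1) H (fun=> g u)) bernstein_cst; ring.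
  apply: bernstein_le => // i /hi; rewrite ler_norml => /andP[+ _].
  by lra.
apply: (@le_trans _ _ ((bernstein n H).[u] + g u)); last by rewrite lerD2r.
have <- : (bernstein n (fun i => 1 * H i + g u)).[u] = (bernstein n H).[u] + g u.
  by rewrite (bernstein_lin n 1 H (fun=> g u)) bernstein_cst; ring.
by apply: bernstein_le => // i /hi; rewrite ler_norml => /andP[_]; lra.
Qed.

(** Heine's theorem, with only the first point confined to the segment. *)
Lemma segment_unif (f : R -> R) (a b e : R) : continuous f -> 0 < e ->
  exists2 d, 0 < d & forall x y, a <= x <= b -> `|x - y| < d -> `|f x - f y| < e.
Proof.
move=> cf e0.
have /compact_near_coveringP cK := @segment_compact R a b.
pose P (d x : R) := forall y, `|x - y| < d -> `|f x - f y| < e.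
have : \forall d \near 0^'+, `[a, b]%classic `<=` P d.
  apply: (cK R (0^'+) P) => x _.
  have /cvgr_dist_lt /(_ (e / 2)) := cf x.
  rewrite divr_gt0 // => /(_ isT) /nbhs_ballP[r /= r0 hr].
  exists (ball x (r / 2), [set d : R | d < r / 2]) => /=.
    split; first by apply: nbhsx_ballx; rewrite divr_gt0.
    by apply: nbhs_right_lt; rewrite divr_gt0.
  move=> [z d] /= [xz dr] y zy.
  have h1 := hr z; have h2 := hr y.
  have h1' : `|f x - f z| < e / 2.
    apply: hr; rewrite /ball /=; apply: lt_trans xz _.
    by rewrite ltr_pdivrMr // ltr_pMr // ltr1n.
  have h2' : `|f x - f y| < e / 2.
    apply: hr; rewrite /ball /=; rewrite (splitr r).
    rewrite -(subrKA z); apply: le_lt_trans (ler_normD _ _) _.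
    by apply: ltrD => //; apply: lt_trans zy dr.
  rewrite -(subrKA (f x)) (splitr e); apply: le_lt_trans (ler_normD _ _) _.
  by apply: ltrD => //; rewrite distrC.
move=> h; near (0 : R)^'+ => d.
exists d; first by near: d; exact: nbhs_right_gt.
have hd : `[a, b]%classic `<=` P d by near: d.
by move=> x y xab; apply: hd; rewrite /= in_itv.
Unshelve. all: by end_near. Qed.

(** Uniform continuity handles close points and boundedness distant ones, so that
    f has a modulus e/2 + K (s - u)^2 of the form required by the Bernstein
    approximation, after rescaling [-M, M] to [0, 1]. *)
Lemma weierstrass (f : R -> R) (M e : R) : continuous f -> 0 < M -> 0 < e ->
  exists p : {poly R}, forall x, - M <= x <= M -> `|f x - p.[x]| <= e.
Proof.
move=> cf M0 e0.
have e20 : 0 < e / 2 by rewrite divr_gt0.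
have [d d0 hd] := @segment_unif f (- M) M _ cf e20.
have [B B0 hB] : exists2 B, 0 <= B & forall x, - M <= x <= M -> `|f x| <= B.
  have := @continuous_compact _ _ f `[- M, M]%classic.
  move=> /(_ (continuous_subspaceT cf) (@segment_compact _ _ _)) /compact_bounded.
  move=> [N [Nr hN]]; exists (`|N| + 1); first by rewrite addr_ge0.
  move=> x xM; apply: (hN (`|N| + 1)); first by rewrite (le_lt_trans (ler_norm _)) // ltrDl.
  by exists x => //; rewrite /= in_itv.
have M20 : 0 < 2 * M by rewrite mulr_gt0.
pose l u := - M + 2 * M * u.
have lI u : 0 <= u <= 1 -> - M <= l u <= M.
  by rewrite /l => /andP[u0 u1]; have := mulr_ge0 (ltW M20) u0; nra.
pose g u := f (l u).
pose K := 2 * B / d ^+ 2 * (2 * M) ^+ 2.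
have B2 : 0 <= 2 * B / d ^+ 2.
  by apply: divr_ge0; [exact: mulr_ge0|exact: sqr_ge0].
have K0 : 0 <= K by apply: mulr_ge0 => //; exact: sqr_ge0.
have mod s u : 0 <= s <= 1 -> 0 <= u <= 1 ->
    `|g s - g u| <= e / 2 + K * (s - u) ^+ 2.
  move=> /lI sI /lI uI; rewrite /g.
  have lE : (l s - l u) ^+ 2 = (2 * M) ^+ 2 * (s - u) ^+ 2 by rewrite /l; ring.
  rewrite /K -mulrA -lE.
  have [lt|ge] := ltP `|l s - l u| d.
    apply: le_trans (ltW (hd _ _ sI lt)) _.
    by rewrite lerDl; apply: mulr_ge0 => //; exact: sqr_ge0.
  apply: (@le_trans _ _ (2 * B)).
    apply: le_trans (ler_normB _ _) _; rewrite mulr_natl mulr2n.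
    by rewrite lerD // hB.
  apply: (@le_trans _ _ (2 * B / d ^+ 2 * d ^+ 2)).
    by rewrite divfK // expf_neq0 // gt_eqF.
  apply: ler_wpDl; first exact: ltW.
  apply: ler_wpM2l => //.
  by rewrite -[leRHS]real_normK ?num_real // lerXn2r ?nnegrE // ltW.
have [n n0 hn] : exists2 n, (0 < n)%N & K / n%:R <= e / 2.
  exists (Num.truncn (K / (e / 2))).+1 => //.
  rewrite ler_pdivrMr ?ltr0n // mulrC -ler_pdivrMr //.
  exact/ltW/truncnS_gt.
pose q := bernstein n (fun i => g (i%:R / n%:R)) \Po (((2 * M)^-1)%:P * ('X + M%:P)).
exists q => x xM; rewrite /q horner_comp !hornerE.
set u := _ * (x + M).
have u01 : 0 <= u <= 1.
  rewrite /u mulrC divr_ge0 ?(ltW M20) //=; last by lra.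
  by rewrite ler_pdivrMr // mul1r; lra.
have -> : f x = g u.
  rewrite /g /l /u; congr f; field; by rewrite gt_eqF.
rewrite distrC (splitr e).
apply: le_trans (bernstein_approx n0 u01 K0 (fun s hs => mod s u hs u01)) _.
by rewrite lerD2l.
Qed.

End Weierstrass.

(** * From moments to weak convergence *)

Section ESD.
Variables (R : realType) (n : nat).
Hypothesis n_gt0 : (0 < n)%N.
Implicit Types (A : 'M[R]_n) (f g : R -> R).

Let ge0_esd_integral A f : A^T = A -> measurable_fun setT f -> (forall x, 0 <= f x) ->
  (\int[esd A]_x (f x)%:E = (n%:R^-1 * \sum_(x <- spectrum A) f x)%:E)%E.
Proof.
move=> As mf f0; have mf' : measurable_fun setT (EFin \o f) by exact/measurable_EFinP.
rewrite /esd ge0_integral_mscale //; last by move=> x _; rewrite lee_fin.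
rewrite ge0_integral_measure_sum //; last by move=> x _; rewrite lee_fin.
rewrite EFinM; congr (_ * _)%E.
rewrite (big_nth 0) big_mkord -sumEFin; apply: eq_bigr => i _.
by rewrite integral_dirac //= diracT mul1e.
Qed.

Lemma esd_integral A f : A^T = A -> measurable_fun setT f ->
  \int[esd A]_x f x = n%:R^-1 * \sum_(x <- spectrum A) f x.
Proof.
move=> As mf; rewrite /Rintegral integralE.
pose fp x := Num.max (f x) 0; pose fn x := Num.max (- f x) 0.
have -> : ((fun x => (f x)%:E)^\+ = (fun x => (fp x)%:E))%E.
  by apply/funext => x; rewrite funeposE EFin_max.
have -> : ((fun x => (f x)%:E)^\- = (fun x => (fn x)%:E))%E.
  by apply/funext => x; rewrite funenegE EFin_max.
rewrite !ge0_esd_integral //.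
- rewrite -EFinB /= -mulrBr -sumrB; congr (_ * _); apply: eq_bigr => x _.
  by rewrite /fp /fn; case: (leP 0 (f x)) => h; case: (leP (- f x) 0) => h2; lra.
- by apply: measurable_maxr => //; exact: measurableT_comp.
- by move=> x; rewrite /fn le_max lexx orbT.
- by apply: measurable_maxr.
- by move=> x; rewrite /fp le_max lexx orbT.
Qed.

Definition emoment A k : R := n%:R^-1 * \tr (A ^+ k).

Lemma esd_exp A k : A^T = A ->
  n%:R^-1 * \sum_(x <- spectrum A) x ^+ k = emoment A k.
Proof. by move=> As; have [_ ->] := spectrum_sym As. Qed.

Lemma esd_poly A (p : {poly R}) : A^T = A ->
  n%:R^-1 * \sum_(x <- spectrum A) p.[x] = \sum_(i < size p) p`_i * emoment A i.
Proof.
move=> As; under eq_bigr do rewrite horner_coef.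
rewrite exchange_big mulr_sumr; apply: eq_bigr => i _.
by rewrite -mulr_sumr mulrCA esd_exp.
Qed.

Lemma esd_cst A (c : R) : A^T = A -> n%:R^-1 * \sum_(x <- spectrum A) c = c.
Proof.
move=> As; have [h _] := spectrum_sym As.
rewrite big_const_seq count_predT h iter_addr_0 -[c *+ n]mulr_natl mulrA mulVf ?mul1r //.
by rewrite pnatr_eq0 -lt0n.
Qed.

End ESD.

Lemma sc_moment_le (R : realType) r : `|sc_moment R (2 * r)| <= 4 ^+ r.
Proof.
rewrite -semicircle_exp; apply: semicircle_le; first exact: exprn_continuous.
move=> x x2; rewrite normrX exprM lerXn2r ?nnegrE ?exprn_ge0 //.
have -> : 4 = 2 ^+ 2 :> R by rewrite expr2 -natrM.
by rewrite lerXn2r ?nnegrE // ler_norml.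
Qed.

(** A polynomial p is chosen on [-4, 4], a segment larger than the support.  Off it,
    f - p grows at most like x^D and is dominated by c0 16^(-m) x^(2r) with
    r = D + m.  The semicircle moment of order 2r is at most 4^r, so that this
    term integrates to at most c0 4^D 4^(-m), small for large m, plus the
    deviation of the spectral moment. *)
Lemma esd_approx (R : realType) (f : R -> R) (eps : R) :
  continuous f -> bounded_fun f -> 0 < eps ->
  exists N (K : R), 0 <= K /\ forall n (A : 'M[R]_n), (0 < n)%N -> A^T = A ->
    `|\int[esd A]_x f x - \int[@semicircle R]_x f x| <=
      eps + K * \sum_(k < N) `|emoment A k - sc_moment R k|.
Proof.
move=> cf [B0 [B0r hB0]] e0.
pose B := `|B0| + 1.
have Bge0 : 0 <= B by rewrite addr_ge0.
have hB x : `|f x| <= B.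
  by apply: (hB0 B) => //; rewrite /B (le_lt_trans (ler_norm _)) // ltrDl.
pose e1 := eps / 3; have e10 : 0 < e1 by rewrite divr_gt0.
have M0 : 0 < 4 :> R by [].
have [p hp] := weierstrass cf M0 e10.
pose S := \sum_(i < size p) `|p`_i|.
have S0 : 0 <= S by rewrite sumr_ge0.
pose D := size p; pose c0 := B + S.
have c00 : 0 <= c0 by rewrite addr_ge0.
have [m hm] : exists m, c0 * 4 ^+ D / 4 ^+ m <= e1.
  have h0 : 0 <= c0 * 4 ^+ D / e1 by rewrite divr_ge0 ?mulr_ge0 ?exprn_ge0 // ltW.
  exists (Num.truncn (c0 * 4 ^+ D / e1)).+1.
  rewrite ler_pdivrMr ?exprn_gt0 // [e1 * _]mulrC -ler_pdivrMr //.
  apply: le_trans (ltW (truncnS_gt _)) _.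
  set q := (Num.truncn _).+1; rewrite -(natrX R 4 q) ler_nat ltnW // ltn_expl //.
pose r := (D + m)%N.
exists (2 * r).+1, (S + c0); split; first by rewrite addr_ge0.
move=> n A n0 As.
set dev := \sum_(k < _) _.
have dev_ge k : (k < (2 * r).+1)%N -> `|emoment A k - sc_moment R k| <= dev.
  move=> hk; rewrite /dev (bigD1 (Ordinal hk)) //= lerDl sumr_ge0 //.
have cp := @continuous_horner R p.
have hfp x : `|f x - p.[x]| <= e1 + c0 / 16 ^+ m * x ^+ (2 * r).
  have [x4|x4] := lerP `|x| 4.
    apply: le_trans (hp x _) _; first by rewrite -ler_norml.
    rewrite lerDl mulr_ge0 //; first by rewrite divr_ge0 ?exprn_ge0.
    by rewrite exprM exprn_ge0 // sqr_ge0.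
  have x1 : 1 <= `|x| by apply: le_trans (ltW x4); rewrite ler1n.
  apply: ler_wpDl; first exact: ltW.
  have h1 : `|f x - p.[x]| <= c0 * `|x| ^+ D.
    apply: le_trans (ler_normB _ _) _; rewrite /c0 mulrDl lerD //.
      by apply: le_trans (hB x) _; rewrite ler_peMr // exprn_ege1.
    rewrite horner_coef; apply: le_trans (ler_norm_sum _ _ _) _.
    rewrite /S mulr_suml; apply: ler_sum => i _.
    by rewrite normrM normrX ler_wpM2l // ler_weXn2l // ltnW.
  apply: le_trans h1 _; rewrite -mulrA ler_wpM2l //.
  rewrite mulrC ler_pdivlMr ?exprn_gt0 //.
  have -> : x ^+ (2 * r) = `|x| ^+ (2 * D) * (`|x| ^+ 2) ^+ m.
    by rewrite -exprM -exprD -mulnDr exprM [in RHS]exprM real_normK ?num_real.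
  rewrite ler_pM ?exprn_ge0 //.
    by rewrite ler_weXn2l // leq_pmull.
  rewrite lerXn2r ?nnegrE ?exprn_ge0 //.
  have -> : 16 = 4 ^+ 2 :> R by rewrite expr2 -natrM.
  by rewrite lerXn2r ?nnegrE // ltW.
have mf : measurable_fun setT f by exact: continuous_measurable_fun.
rewrite esd_integral //.
have step1 : `|n%:R^-1 * \sum_(x <- spectrum A) f x -
               n%:R^-1 * \sum_(x <- spectrum A) p.[x]| <= e1 + (e1 + c0 * dev).
  rewrite -mulrBr -sumrB normrM ger0_norm ?invr_ge0 ?ler0n //.
  apply: (@le_trans _ _ (n%:R^-1 *
     \sum_(x <- spectrum A) (e1 + c0 / 16 ^+ m * x ^+ (2 * r)))).
    rewrite ler_wpM2l ?invr_ge0 ?ler0n //.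
    by apply: le_trans (ler_norm_sum _ _ _) _; apply: ler_sum => x _.
  rewrite big_split /= mulrDr esd_cst // lerD2l -mulr_sumr mulrCA esd_exp //.
  rewrite -[emoment _ _](subrK (sc_moment R (2 * r))) mulrDr addrC lerD //.
    apply: le_trans hm; rewrite -!mulrA ler_wpM2l //.
    apply: (@le_trans _ _ ((16 ^+ m)^-1 * 4 ^+ r)).
      rewrite ler_wpM2l ?invr_ge0 ?exprn_ge0 //.
      exact: le_trans (ler_norm _) (sc_moment_le _ _).
    rewrite /r exprD mulrCA ler_wpM2l ?exprn_ge0 //.
    have -> : 16 = 4 * 4 :> R by rewrite -natrM.
    by rewrite exprMn invfM -mulrA mulVf ?mulr1 // expf_neq0.
  apply: (@le_trans _ _ (c0 / 16 ^+ m * dev)).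
    rewrite ler_wpM2l ?divr_ge0 ?exprn_ge0 //.
    by apply: le_trans (ler_norm _) (dev_ge _ _).
  have dev0 : 0 <= dev by rewrite sumr_ge0.
  rewrite ler_wpM2r // ler_piMr // invf_le1 ?exprn_gt0 //.
  by rewrite exprn_ege1 // ler1n.
have step2 : `|n%:R^-1 * \sum_(x <- spectrum A) p.[x] -
               \int[@semicircle R]_x p.[x]| <= S * dev.
  rewrite esd_poly // semicircle_poly -sumrB.
  apply: le_trans (ler_norm_sum _ _ _) _; rewrite /S mulr_suml.
  apply: ler_sum => i _; rewrite -mulrBr normrM ler_wpM2l //.
  by apply: dev_ge; rewrite /r -/D; have := ltn_ord i; rewrite -/D; lia.
have step3 : `|\int[@semicircle R]_x p.[x] - \int[@semicircle R]_x f x| <= e1.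
  rewrite -RintegralB //; try exact: semicircle_integrable.
  apply: semicircle_le; first by move=> x; apply: cvgB; [exact: cp|exact: cf].
  move=> x /andP[x1 x2]; rewrite distrC; apply: hp; apply/andP; split; lra.
rewrite -[X in X - _](subrK (n%:R^-1 * \sum_(x <- spectrum A) p.[x])) -addrA.
rewrite -[X in _ + X](subrKA (\int[@semicircle R]_x p.[x])).
apply: le_trans (ler_normD _ _) _.
apply: (@le_trans _ _ ((e1 + (e1 + c0 * dev)) + (S * dev + e1))).
  by apply: lerD => //; apply: le_trans (ler_normD _ _) _; apply: lerD.
by rewrite /e1; lra.
Qed.

(** * Graphs of one and of two closed walks *)

Section PairGraph.
Variable n : nat.
Implicit Types (x y z : 'I_n) (p t s : seq 'I_n) (e : 'I_n * 'I_n).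

(** The second walk is attached to the first at a common vertex. *)
Lemma card_vset_pair t s : ~~ [disjoint vset t & vset s] ->
  (#|vset t :|: vset s|%SET + #|eset (cedges t)| <=
   #|vset t| + #|eset (cedges t ++ cedges s)|)%N.
Proof.
rewrite disjoint_subset => /subsetPn[x]; rewrite !inE negbK => xt xs.
have [p sp] : exists p, rot (index x s) s = x :: p.
  by exists (drop (index x s).+1 s ++ take (index x s) s); rewrite rot_index.
have pm : perm_eq (edges x (rcons p x)) (cedges s).
  by have := perm_cedges_rot (index x s) s; rewrite sp.
have := @extend_walk _ x (rcons p x) (vset t) (eset (cedges t)).
rewrite inE xt => /(_ isT).
have -> : vset (rcons p x) = vset s.
  by rewrite -(vset_rot (index x s) s) sp vset_rcons vset_cons.
have -> : eset (edges x (rcons p x)) = eset (cedges s).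
  by apply/setP => e; rewrite !inE (perm_mem pm).
rewrite eset_cat; apply => e; rewrite !inE; exact: cedges_in.
Qed.

Lemma nsingle_cat_disjoint (L L' : seq ('I_n * 'I_n)) :
  (forall e, e \in L -> e \notin L') -> nsingle (L ++ L') = (nsingle L + nsingle L')%N.
Proof.
move=> LL'; rewrite /nsingle.
have -> : undup (L ++ L') = undup L ++ undup L'.
  rewrite undup_cat; congr (_ ++ _); apply/all_filterP/allP => e.
  by rewrite mem_undup => /LL'.
rewrite count_cat; congr (_ + _)%N; apply: eq_in_count => e; rewrite mem_undup => eL.
  by rewrite count_cat (count_memPn (LL' _ eL)) addn0.
rewrite count_cat; have /count_memPn -> // : e \notin L.
by apply: contraL eL => /LL'.
Qed.

Lemma nsingle_count (L : seq ('I_n * 'I_n)) : (0 < nsingle L)%N ->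
  exists e, count_mem e L = 1%N.
Proof. by rewrite /nsingle -has_count => /hasP[e _ /eqP he]; exists e. Qed.

Lemma nsingle_eq0 (L : seq ('I_n * 'I_n)) :
  (forall e, count_mem e L != 1%N) -> nsingle L = 0%N.
Proof.
move=> h; apply/eqP; rewrite -leqn0 leqNgt; apply/negP => /nsingle_count[e he].
by have := h e; rewrite he.
Qed.

Lemma closed_single t : (0 < nsingle (cedges t))%N ->
  (2 * #|vset t| <= size t + nsingle (cedges t))%N.
Proof.
move=> /nsingle_count [e he]; have h1 := card_vset_single he.
have := leq_eset_size (cedges t) e; rewrite size_cedges he.
by move: h1; move: #|_| #|_| => v m; lia.
Qed.

Lemma closed_nontree t : nsingle (cedges t) = 0%N -> ~~ treelike t ->
  (2 * #|vset t| <= size t + 1)%N.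
Proof.
rewrite /treelike => s0; rewrite s0 eqxx /= => /eqP h.
case: t s0 h => [|x p] s0 h.
  by have := card_vset_le ([::] : seq 'I_n) => /=; move: #|_| => m; lia.
have := leq_eset_size (cedges (x :: p)) (x, x); rewrite s0 size_cedges.
have := card_vset_closed (x :: p).
by move: h; move: #|_| #|_| (size _) (count_mem _ _) => v m k c; lia.
Qed.

Lemma pair_single t s : (0 < nsingle (cedges t))%N -> size s = size t ->
  ~~ [disjoint vset t & vset s] ->
  (2 * #|vset t :|: vset s|%SET <=
   2 * size t + nsingle (cedges t ++ cedges s))%N.
Proof.
move=> /nsingle_count [e he] st /card_vset_pair.
have h1 := card_vset_single he.
have := leq_eset_size (cedges t ++ cedges s) e; rewrite size_cat !size_cedges st.
move: h1; move: #|_| #|_| #|_| #|_| (size t) (nsingle _) (count_mem _ _) => v1 v2 v3 v4 k m c.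
lia.
Qed.

Lemma disjoint_edges t s e : [disjoint vset t & vset s]%B ->
  e \in cedges t -> e \notin cedges s.
Proof.
move=> dts /cedges_in [h1 _]; apply/negP => /cedges_in [h2 _].
move: dts; rewrite disjoint_subset => /fintype.subsetP /(_ e.1).
by rewrite !inE h1 h2 => /(_ isT).
Qed.

(** An edge common to two treelike walks is crossed four times, two more than
    necessary, which costs the union of the two walks one vertex. *)
Lemma pair_tree t s : treelike t -> treelike s -> size s = size t ->
  has (fun e => e \in cedges s) (cedges t) ->
  ~~ [disjoint vset t & vset s] /\ (2 * #|vset t :|: vset s|%SET <= 2 * size t)%N.
Proof.
move=> Tt Ts st /hasP[e et es].
have meet : ~~ [disjoint vset t & vset s].
  by apply: contraL es => dts; exact: disjoint_edges dts et.
split => //.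
have [ht ct] := treelike_eset Tt; have [_ cs] := treelike_eset Ts.
have s0 : nsingle (cedges t ++ cedges s) = 0%N.
  apply: nsingle_eq0 => f; rewrite count_cat.
  by case: (ct f) => ->; case: (cs f) => ->.
have c4 : count_mem e (cedges t ++ cedges s) = 4%N.
  rewrite count_cat; move: et es; rewrite -!has_pred1 !has_count.
  by case: (ct e) => ->; case: (cs e) => ->.
have := leq_eset_size (cedges t ++ cedges s) e.
rewrite s0 c4 size_cat !size_cedges st.
have := card_vset_pair meet; rewrite ht.
move: #|_| #|_| #|_| (size t) => v1 v2 v3 k; lia.
Qed.

End PairGraph.

(** * Counting closed walks by class *)

Section WalkCounts.
Variables (R : realType) (n b k : nat) (r : rel 'I_n).
Hypothesis b_gt0 : (0 < b)%N.
Hypothesis b_le : (b <= n)%N.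
Hypothesis k_gt0 : (0 < k)%N.
Hypothesis rb : forall y, (#|[set z | r y z]%SET| <= b)%N.
Let q : R := b%:R^-1.
Let beta : R := Num.sqrt b%:R.
Let nu : R := Num.sqrt n%:R.
Let n_gt0 : (0 < n)%N. Proof. exact: leq_trans b_le. Qed.

Let beta_ge1 : 1 <= beta.
Proof.
by rewrite /beta -[leLHS]sqrtr1; apply: ler_wsqrtr; rewrite ler1n.
Qed.
Let beta_gt0 : 0 < beta. Proof. exact: lt_le_trans beta_ge1. Qed.
Let nu_gt0 : 0 < nu. Proof. by rewrite sqrtr_gt0 ltr0n. Qed.
Let beta_le : beta <= nu.
Proof. by apply: ler_wsqrtr; rewrite ler_nat. Qed.
Let beta2 : beta ^+ 2 = b%:R. Proof. by rewrite sqr_sqrtr. Qed.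
Let nu2 : nu ^+ 2 = n%:R. Proof. by rewrite sqr_sqrtr. Qed.
Let q_gt0 : 0 < q. Proof. by rewrite invr_gt0 ltr0n. Qed.

(** Exchange rate between vertices and matrix normalisation: a bound on the
    number v of vertices turns a term of the trace into the summable weight
    q ^+ v, times the normalisation beta ^+ m. *)
Let weight_le v m s : (2 * v <= m + s)%N ->
  nu ^- s <= q ^+ v * beta ^+ m * (beta / nu) ^+ s.
Proof.
move=> vms; rewrite expr_div_n -[q ^+ v * _ * _]mulrA [beta ^+ m * _]mulrA -exprD.
rewrite !mulrA ler_peMl ?invr_ge0 ?exprn_ge0 ?(ltW nu_gt0) //.
rewrite /q exprVn -beta2 -exprM mulrC ler_pdivlMr ?exprn_gt0 // mul1r.
by rewrite ler_weXn2l.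
Qed.

Let ratio_ge0 : 0 <= beta / nu. Proof. by rewrite divr_ge0 // ltW. Qed.
Let ratio_le1 : beta / nu <= 1. Proof. by rewrite ler_pdivrMr // mul1r. Qed.

Definition Kone : R := k%:R ^+ k.
Definition Kpair : R := (k * (2 * k))%N%:R * (2 * k)%N%:R ^+ k * k%:R ^+ k.

Definition single t := cycle r t && (0 < nsingle (cedges t))%N.
Definition tree t := cycle r t && treelike t.
Definition rest t := [&& cycle r t, nsingle (cedges t) == 0%N & ~~ treelike t].

Lemma sum_single : \sum_(t : k.-tuple 'I_n | single t) nu ^- nsingle (cedges t) <=
  Kone * (n%:R * q) * beta ^+ k * (beta / nu).
Proof.
rewrite -mulrA; apply: le_trans (ler_wpM2r _ (sum_closed R b_gt0 rb k_gt0)); last first.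
  by apply: mulr_ge0 => //; apply: exprn_ge0; exact: ltW.
rewrite mulr_suml big_mkcond [leRHS]big_mkcond; apply: ler_sum => t _.
rewrite /single; case: (cycle r t) => //=; case: ifP => [s0|_]; last first.
  apply: mulr_ge0; first by apply: exprn_ge0; exact: ltW.
  by apply: mulr_ge0 => //; apply: exprn_ge0; exact: ltW.
have /weight_le := closed_single s0; rewrite size_tuple => /le_trans; apply.
rewrite -[leLHS]mulrA; apply: ler_wpM2l; first by apply: exprn_ge0; exact: ltW.
apply: ler_wpM2l; first by apply: exprn_ge0; exact: ltW.
case: (nsingle _) s0 => // s _; rewrite exprS ler_piMr //.
by rewrite exprn_ile1.
Qed.

(** Walks with disjoint vertex sets have independent counts, each bounded by
    [sum_single]; walks that meet have only one free starting vertex.  Both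
    contributions are of order n/b in units of beta^(2k). *)
Lemma sum_single_pair :
  \sum_(t : k.-tuple 'I_n | single t) \sum_(s : k.-tuple 'I_n | single s)
    nu ^- nsingle (cedges t ++ cedges s)
  <= (Kone ^+ 2 + Kpair) * (n%:R * q * beta ^+ (2 * k)).
Proof.
have nuV m : 0 <= nu ^- m by rewrite invr_ge0 exprn_ge0 // ltW.
pose F1 (t s : seq 'I_n) := nu ^- nsingle (cedges t) * nu ^- nsingle (cedges s).
pose F2 (t s : seq 'I_n) := if [disjoint vset t & vset s]%B then 0 else
  q ^+ #|vset t :|: vset s|%SET * beta ^+ (2 * k).
have F20 t s : 0 <= F2 t s.
  by rewrite /F2; case: ifP => // _; rewrite mulr_ge0 ?exprn_ge0 // ltW.
apply: (@le_trans _ _ (\sum_(t : k.-tuple 'I_n | single t)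
   \sum_(s : k.-tuple 'I_n | single s) (F1 t s + F2 t s))).
  apply: ler_sum => t /andP[_ t1]; apply: ler_sum => s /andP[_ s1].
  rewrite /F1 /F2; case: (boolP [disjoint _ & _]%B) => [dts|mts].
    rewrite addr0 nsingle_cat_disjoint; last by move=> e; exact: disjoint_edges.
    by rewrite exprD invfM.
  apply: ler_wpDl; first by rewrite mulr_ge0.
  have /weight_le /le_trans : (2 * #|vset t :|: vset s|%SET <=
      2 * k + nsingle (cedges t ++ cedges s))%N.
    by have := @pair_single _ t s t1; rewrite !size_tuple; apply.
  apply; rewrite ler_piMr ?exprn_ile1 //.
  by rewrite mulr_ge0 ?exprn_ge0 // ltW.
under eq_bigr do rewrite big_split /=.
rewrite big_split /= mulrDl lerD //.
  under eq_bigr do rewrite -mulr_sumr.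
  rewrite -mulr_suml -expr2.
  apply: (@le_trans _ _ ((Kone * (n%:R * q) * beta ^+ k * (beta / nu)) ^+ 2)).
    have P0 : 0 <= \sum_(t : k.-tuple 'I_n | single t) nu ^- nsingle (cedges t).
      by apply: sumr_ge0 => t _; exact: nuV.
    by apply: lerXn2r; rewrite ?nnegrE //; [exact: le_trans P0 sum_single|exact: sum_single].
  rewrite /q -beta2 -nu2 le_eqVlt; apply/orP; left; apply/eqP.
  rewrite [(2 * k)%N]mulnC exprM.
  move: (lt0r_neq0 beta_gt0) (lt0r_neq0 nu_gt0).
  by move: beta nu (beta ^+ k) => x y z x0 y0; field; rewrite x0 y0.
rewrite [leRHS]mulrA; apply: le_trans (ler_wpM2r _ (sum_closed_pair R b_gt0 rb k_gt0)); last first.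
  by rewrite exprn_ge0 // ltW.
rewrite mulr_suml big_mkcond [leRHS]big_mkcond; apply: ler_sum => t _.
have q0 m : 0 <= b%:R^-1 ^+ m :> R by rewrite exprn_ge0 // ltW.
case: (boolP (single t)) => [/andP[-> _]|_]; last first.
  by case: ifP => // _; rewrite mulr_ge0 ?sumr_ge0 // exprn_ge0 // ltW.
rewrite mulr_suml big_mkcond [leRHS]big_mkcond; apply: ler_sum => s _.
case: (boolP (single s)) => [/andP[-> _]|_]; last first.
  by case: ifP => // _; rewrite mulr_ge0 // exprn_ge0 // ltW.
by rewrite /F2; case: [disjoint _ & _]%B.
Qed.

Let count_le (A : pred (seq 'I_n)) m :
  (forall t : k.-tuple 'I_n, A t -> cycle r t /\ (2 * #|vset t| <= m)%N) ->
  \sum_(t : k.-tuple 'I_n | A t) 1 <= Kone * (n%:R * q) * beta ^+ m.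
Proof.
move=> hA; apply: le_trans (ler_wpM2r _ (sum_closed R b_gt0 rb k_gt0)); last first.
  by rewrite exprn_ge0 // ltW.
rewrite mulr_suml big_mkcond [leRHS]big_mkcond; apply: ler_sum => t _.
have p0 j : 0 <= b%:R^-1 ^+ j * beta ^+ m.
  by rewrite mulr_ge0 ?exprn_ge0 ?invr_ge0 ?ler0n ?(ltW beta_gt0).
case: (boolP (A t)) => [/hA [-> h]|_]; last by case: ifP.
have := @weight_le #|vset t| m 0; rewrite addn0 => /(_ h).
by rewrite !expr0 invr1 mulr1.
Qed.

Lemma count_rest : \sum_(t : k.-tuple 'I_n | rest t) 1 <=
  Kone * (n%:R * q) * beta ^+ k.+1.
Proof.
apply: count_le => t /and3P[-> /eqP s0 nt]; split => //.
by have := closed_nontree s0 nt; rewrite size_tuple addn1.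
Qed.

Lemma count_tree : \sum_(t : k.-tuple 'I_n | tree t) 1 <=
  Kone * (n%:R * q) * beta ^+ k.+2.
Proof.
apply: count_le => t /andP[-> /andP[_ /eqP ->]]; split => //.
by rewrite size_tuple.
Qed.

Definition share_edge (t s : seq 'I_n) := has (fun e => e \in cedges s) (cedges t).

(** The vertex lost by a common edge makes these pairs fewer by a factor n b than all
    pairs of tree walks. *)
Lemma count_tree_pair :
  \sum_(t : k.-tuple 'I_n | tree t) \sum_(s : k.-tuple 'I_n | tree s && share_edge t s) 1
  <= Kpair * (n%:R * q * beta ^+ (2 * k)).
Proof.
rewrite [leRHS]mulrA; apply: le_trans (ler_wpM2r _ (sum_closed_pair R b_gt0 rb k_gt0)); last first.
  by rewrite exprn_ge0 // ltW.
have q0 m : 0 <= b%:R^-1 ^+ m :> R by rewrite exprn_ge0 // ltW.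
rewrite mulr_suml big_mkcond [leRHS]big_mkcond; apply: ler_sum => t _.
case: (boolP (tree t)) => [/andP[-> Tt]|_]; last first.
  by case: ifP => // _; rewrite mulr_ge0 ?sumr_ge0 // exprn_ge0 // ltW.
rewrite mulr_suml big_mkcond [leRHS]big_mkcond; apply: ler_sum => s _.
case: (boolP (tree s && _)) => [/andP[/andP[-> Ts] sh]|_]; last first.
  by case: ifP => // _; rewrite mulr_ge0 // exprn_ge0 // ltW.
have [-> h] : ~~ [disjoint vset t & vset s] /\ (2 * #|vset t :|: vset s|%SET <= 2 * k)%N.
  by have := pair_tree Tt Ts _ sh; rewrite !size_tuple; apply.
have := @weight_le #|vset t :|: vset s|%SET (2 * k) 0; rewrite addn0 => /(_ h).
by rewrite !expr0 invr1 mulr1.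
Qed.

End WalkCounts.

(** * Markov's inequality and expectations of monomials *)

Section FiniteSums.
Context d (T : measurableType d) (R : realType) (P : probability T R).

Lemma measurable_norm_ge (Y : T -> R) e : measurable_fun setT Y ->
  measurable [set w | e <= `|Y w|].
Proof.
move=> mY; have mN : measurable_fun setT (fun w => `|Y w|) by exact: measurableT_comp.
have := mN measurableT _ (measurable_itv `[e, +oo[); rewrite setTI.
by congr measurable; apply/seteqP; split => w; rewrite /= in_itv /= andbT.
Qed.

Lemma integrable_EFin_sum (I : Type) (s : seq I) (A : pred I) (F : I -> T -> R) :
  (forall i, A i -> P.-integrable setT (EFin \o F i)) ->
  P.-integrable setT (EFin \o (fun w => \sum_(i <- s | A i) F i w)).
Proof.
move=> h.
have := @integrable_sum _ _ _ P setT measurableT _ s A (fun i => EFin \o F i) h.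
by apply: eq_integrable => // w _; rewrite /= sumEFin.
Qed.

Lemma Rintegral_sum (I : Type) (s : seq I) (A : pred I) (F : I -> T -> R) :
  (forall i, A i -> P.-integrable setT (EFin \o F i)) ->
  \int[P]_w (\sum_(i <- s | A i) F i w) = \sum_(i <- s | A i) \int[P]_w F i w.
Proof.
move=> h; elim: s => [|i s IH].
  by under eq_Rintegral do rewrite big_nil; rewrite big_nil Rintegral_cst // mul0r.
under eq_Rintegral do rewrite big_cons; rewrite big_cons -IH.
case: (boolP (A i)) => // Ai.
by rewrite RintegralD //; [exact: h|exact: integrable_EFin_sum].
Qed.

Lemma markov_even (Y : T -> R) p e : 0 < e -> measurable_fun setT Y ->
  P.-integrable setT (EFin \o (fun w => Y w ^+ (2 * p))) ->
  (P [set w | (e <= `|Y w|)%R] <= (e ^- (2 * p) * \int[P]_w Y w ^+ (2 * p))%:E)%E.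
Proof.
move=> e0 mY iY; set A := [set w | _].
have Y0 w : 0 <= Y w ^+ (2 * p) by rewrite exprM exprn_ge0 // sqr_ge0.
have mA : measurable A by exact: measurable_norm_ge.
have ep : 0 < e ^+ (2 * p) by rewrite exprn_gt0.
rewrite EFinM lee_pdivlMl // /Rintegral fineK; last exact: integrable_fin_num.
rewrite -[X in (X <= _)%E](integral_cst P mA (e ^+ (2 * p))%:E).
apply: (@le_trans _ _ (\int[P]_(w in A) (Y w ^+ (2 * p))%:E)%E).
  apply: ge0_le_integral => //=.
  - by move=> w Aw; rewrite lee_fin; exact: ltW.
  - by apply: measurable_funTS; exact: measurable_int iY.
  - move=> w; rewrite /A /= => ew; rewrite lee_fin exprM [leRHS]exprM.
    rewrite lerXn2r ?nnegrE ?sqr_ge0 ?exprn_ge0 ?(ltW e0) //.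
    by rewrite -[leRHS]real_normK ?num_real // lerXn2r ?nnegrE // ltW.
apply: ge0_subset_integral => //=; first exact: measurable_int iY.
by move=> w _; rewrite lee_fin.
Qed.

End FiniteSums.

Section Moments.
Context d (T : measurableType d) (R : realType) (P : probability T R).
Variables (a : forall n : nat, T -> 'M[R]_n) (C : nat -> R) (Cl : nat -> nat -> R).
Hypothesis ha : approx_uncorrelated P a C Cl.
Variable n : nat.
Hypothesis n_gt0 : (0 < n)%N.
Let nu : R := Num.sqrt n%:R.
Implicit Types L : seq ('I_n * 'I_n).

Definition normal_edges L := forall e, e \in L -> uedge e.1 e.2 = e.
Definition mono L w : R := wprod (a n w) L.
(** At least 1, so that it may be used as a nonnegative bound, and also for the
    empty monomial, about which the scheme says nothing. *)
Definition Cb k : R := `|C k| + 1.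

Lemma Cb_ge1 k : 1 <= Cb k. Proof. by rewrite lerDr. Qed.

Lemma monoD L L' w : mono (L ++ L') w = mono L w * mono L' w.
Proof. exact: wprod_cat. Qed.

Lemma measurable_mono L : measurable_fun setT (mono L).
Proof.
elim: L => [|e L IH].
  by rewrite (_ : mono [::] = cst 1) //; apply/funext => w; rewrite /mono /wprod big_nil.
rewrite (_ : mono (e :: L) = (fun w => a n w e.1 e.2 * mono L w)).
  by apply: measurable_funM => //; exact: (au_measurable ha).
by apply/funext => w; rewrite /mono /wprod big_cons.
Qed.

Lemma normal_cat L L' : normal_edges L -> normal_edges L' -> normal_edges (L ++ L').
Proof. by move=> h h' e; rewrite mem_cat => /orP[/h|/h']. Qed.

Lemma normal_cedges t : normal_edges (cedges t).
Proof. by move=> e; exact: cedges_norm. Qed.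

Let Q L (i : 'I_(size (undup L))) := tnth (in_tuple (undup L)) i.
Let delta L (i : 'I_(size (undup L))) := count_mem (@Q L i) L.

Let monoE L w : mono L w = \prod_(i < size (undup L))
  a n w (@Q L i).1 (@Q L i).2 ^+ @delta L i.
Proof.
rewrite /mono /wprod -(prodr_undup_exp_count L predT (fun e => a n w e.1 e.2)).
by rewrite (big_tnth _ _ (undup L)).
Qed.

Let QL L i : @Q L i \in L.
Proof. by rewrite -mem_undup mem_tnth. Qed.

(** Entries in normal form are fundamentally different as soon as they are
    distinct. *)
Let fdQ L : normal_edges L -> fundamentally_different (@Q L).
Proof.
move=> hL i j ij; apply: contra_neq ij => /setP h.
have nQ k : uedge (@Q L k).1 (@Q L k).2 = @Q L k by apply: hL.
suff /val_inj : (i : nat) = j by [].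
have : @Q L i = @Q L j.
  rewrite -nQ -[RHS]nQ.
  have h1 := h (@Q L i).1; have h2 := h (@Q L i).2.
  have h3 := h (@Q L j).1; have h4 := h (@Q L j).2.
  move: h1 h2 h3 h4; rewrite !inE !eqxx ?orbT /=.
  move: (@Q L i) (@Q L j) => [p1 p2] [q1 q2] /=.
  move=> /esym/orP[]/eqP-> /esym/orP[]/eqP-> h3 h4 //.
  - by move: h4; rewrite orbb => /eqP ->.
  - by rewrite uedgeC.
  - by move: h3; rewrite orbb => /eqP ->.
rewrite /Q !(tnth_nth (@Q L i)) /= => /eqP.
by rewrite nth_uniq ?undup_uniq // => /eqP.
Qed.

Let sum_delta L : (\sum_i @delta L i)%N = size L.
Proof. by rewrite size_sum_count (big_tnth _ _ (undup L)). Qed.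

Let card_delta L : #|[pred i | @delta L i == 1%N]| = nsingle L.
Proof.
rewrite -sum1_card /nsingle -sum1_count (big_tnth _ _ (undup L)).
by apply: eq_bigl => i.
Qed.

Let size_undup_gt0 L : L != [::] -> (0 < size (undup L))%N.
Proof. by case: L => // e L _; rewrite -card_eset card_gt0; apply/set0Pn; exists e; rewrite inE mem_head. Qed.

(** Grouping equal entries of the monomial gives the powers of fundamentally
    different entries to which the scheme applies; finiteness of the expectation
    gives integrability. *)
Lemma mono_moment L : normal_edges L ->
  P.-integrable setT (EFin \o mono L) /\
  `|\int[P]_w mono L w| <= Cb (size L) * nu ^- nsingle L.
Proof.
move=> hL; have [->|L0] := eqVneq L [::].
  have -> : mono [::] = cst 1.
    by apply/funext => w; rewrite /mono /wprod big_nil.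
  split; first exact: finite_measure_integrable_cst.
  rewrite (_ : \int[P]_w cst 1 w = 1); last first.
    rewrite /Rintegral (integral_cst P measurableT 1%E) mul1e.
    exact: (congr1 fine (probability_setT P)).
  rewrite normr1 expr0 invr1 mulr1.
  exact: Cb_ge1.
have := au_moment ha (size_undup_gt0 L0) (fdQ hL) (delta := @delta L).
have dpos i : (0 < @delta L i)%N by rewrite -has_count has_pred1.
move=> /(_ dpos); rewrite sum_delta card_delta unlock.
have -> : (fun w => (\prod_(i < size (undup L)) a n w (@Q L i).1 (@Q L i).2 ^+ @delta L i)%:E)
     = EFin \o mono L by apply/funext => w; rewrite /= monoE.
have -> : n%:R `^ (2^-1 * (nsingle L)%:R) = nu ^+ nsingle L.
  by rewrite powRrM powR12_sqrt // powR_mulrn.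
move=> hb.
have fin : (\int[P]_w (mono L w)%:E)%E \is a fin_num.
  by rewrite fin_num_abs (le_lt_trans hb) // ltry.
have int : P.-integrable setT (EFin \o mono L).
  apply/integrableP; split; first exact/measurable_EFinP/measurable_mono.
  by rewrite integral_fin_num_abs //; exact: measurable_mono.
split => //; move: hb; rewrite -(fineK fin) /= lee_fin => /le_trans; apply.
rewrite ler_wpM2r ?invr_ge0 ?exprn_ge0 ?sqrtr_ge0 //.
by rewrite /Cb (le_trans (ler_norm _)) // lerDl.
Qed.

Lemma mono_integrable L : normal_edges L -> P.-integrable setT (EFin \o mono L).
Proof. by move=> /mono_moment[]. Qed.

Lemma mono_bound L : normal_edges L -> `|\int[P]_w mono L w| <= Cb (size L).
Proof.
move=> /mono_moment[_ /le_trans]; apply; rewrite ler_piMr //.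
  exact: le_trans (Cb_ge1 _).
rewrite invf_le1 ?exprn_gt0 ?sqrtr_gt0 ?ltr0n // exprn_ege1 //.
by rewrite -[leLHS]sqrtr1; apply: ler_wsqrtr; rewrite ler1n.
Qed.

Lemma mono_square L : normal_edges L -> L != [::] ->
  (forall e, count_mem e L = 0%N \/ count_mem e L = 2%N) ->
  `|\int[P]_w mono L w - 1| <= `|Cl #|eset L| n|.
Proof.
move=> hL L0 h2; have := au_square ha (size_undup_gt0 L0) (fdQ hL).
rewrite unlock.
have -> : (fun w => (\prod_(i < size (undup L)) a n w (@Q L i).1 (@Q L i).2 ^+ 2)%:E)
     = EFin \o mono L.
  apply/funext => w; rewrite /= monoE; congr (_%:E); apply: eq_bigr => i _.
  congr (_ ^+ _); rewrite /delta; have [h|-> //] := h2 (@Q L i).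
  by have := QL i; rewrite -has_pred1 has_count h.
have fin := integrable_fin_num measurableT (mono_integrable hL).
rewrite -(fineK fin) -EFinB /= lee_fin card_eset => /le_trans; apply.
exact: ler_norm.
Qed.

End Moments.

(** * Moments of the three parts of the trace *)

Section Estimates.
Context d (T : measurableType d) (R : realType) (P : probability T R).
Variables (a : forall n : nat, T -> 'M[R]_n) (C : nat -> R) (Cl : nat -> nat -> R).
Hypothesis ha : approx_uncorrelated P a C Cl.
Variables (n b k : nat).
Hypothesis n_gt0 : (0 < n)%N.
Hypothesis hb : is_bandwidth n b.
Hypothesis b_gt0 : (0 < b)%N.
Hypothesis k_gt0 : (0 < k)%N.
Let r := @relevant n b.
Let q : R := b%:R^-1.
Let beta : R := Num.sqrt b%:R.
Let nu : R := Num.sqrt n%:R.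
Let M (t : seq 'I_n) w := mono a (cedges t) w.

Let rb y : (#|[set z | r y z]%SET| <= b)%N.
Proof. by rewrite relevant_reg. Qed.
Let b_le : (b <= n)%N.
Proof. by move: hb; rewrite /is_bandwidth => /orP[/eqP ->|/and3P[_ _ /ltnW]]. Qed.
Let beta_gt0 : 0 < beta. Proof. by rewrite sqrtr_gt0 ltr0n. Qed.
Let q_gt0 : 0 < q. Proof. by rewrite invr_gt0 ltr0n. Qed.
Let beta2 : beta ^+ 2 = b%:R. Proof. by rewrite sqr_sqrtr. Qed.
Let n0 : 0 < n%:R :> R. Proof. by rewrite ltr0n. Qed.

Definition single_part w := \sum_(t : k.-tuple 'I_n | single r t) M t w.
Definition rest_part w := \sum_(t : k.-tuple 'I_n | rest r t) M t w.
Definition tree_part w := \sum_(t : k.-tuple 'I_n | tree r t) (M t w - 1).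
Definition Ntree : R := \sum_(t : k.-tuple 'I_n | tree r t) 1.
Definition Z : R := n%:R * beta ^+ k.

Lemma emoment_split w : emoment (band_matrix b (a n w)) k - Ntree / Z =
  single_part w / Z + rest_part w / Z + tree_part w / Z.
Proof.
rewrite /emoment trace_band ?(au_symmetric ha) //.
rewrite -!mulrDl mulrA -invfM -/beta -/Z mulrC -mulrBl; congr (_ / Z).
rewrite /tree_part sumrB addrA; congr (_ - _).
rewrite /single_part /rest_part big_mkcond [X in _ = X + _ + _]big_mkcond.
rewrite [X in _ = _ + X + _]big_mkcond [X in _ = _ + _ + X]big_mkcond.
rewrite -!big_split /=; apply: eq_bigr => t _.
rewrite /single /rest /tree -/r; case: (cycle r t) => /=; last by rewrite !addr0.
rewrite lt0n; case: (boolP (nsingle _ == 0%N)) => /= [s0|s0].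
  by case: (treelike t); rewrite /= ?add0r ?addr0.
have -> : treelike t = false by rewrite /treelike (negbTE s0).
by rewrite !addr0.
Qed.

Let intM t : P.-integrable setT (EFin \o M t).
Proof. exact: (mono_integrable ha (@normal_cedges _ t)). Qed.

Let intMM t s : P.-integrable setT (EFin \o (fun w => M t w * M s w)).
Proof.
have -> : (fun w => M t w * M s w) = mono a (cedges t ++ cedges s).
  by apply/funext => w; rewrite monoD.
exact: (mono_integrable ha (normal_cat (@normal_cedges _ t) (@normal_cedges _ s))).
Qed.

Let size_pair (t s : k.-tuple 'I_n) : size (cedges t ++ cedges s) = (2 * k)%N.
Proof. by rewrite size_cat !size_cedges !size_tuple mul2n addnn. Qed.

Lemma single_part_integrable : P.-integrable setT (EFin \o (fun w => single_part w ^+ 2)).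
Proof.
have -> : (fun w => single_part w ^+ 2) = fun w =>
    \sum_(t : k.-tuple 'I_n | single r t) \sum_(s : k.-tuple 'I_n | single r s) M t w * M s w.
  by apply/funext => w; rewrite expr2 big_distrlr.
by apply: integrable_EFin_sum => t _; apply: integrable_EFin_sum => s _.
Qed.

Lemma single_part_moment : \int[P]_w (single_part w ^+ 2) <=
  Cb C (2 * k) * ((Kone R k ^+ 2 + Kpair R k) * (n%:R * q * beta ^+ (2 * k))).
Proof.
have -> : (fun w => single_part w ^+ 2) = fun w =>
    \sum_(t : k.-tuple 'I_n | single r t) \sum_(s : k.-tuple 'I_n | single r s) M t w * M s w.
  by apply/funext => w; rewrite expr2 big_distrlr.
rewrite Rintegral_sum; last by move=> t _; apply: integrable_EFin_sum => s _.
apply: le_trans (ler_wpM2l _ (sum_single_pair R b_gt0 b_le k_gt0 rb)); last first.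
  exact: le_trans (Cb_ge1 _ _).
rewrite mulr_sumr; apply: ler_sum => t _; rewrite Rintegral_sum //.
rewrite mulr_sumr; apply: ler_sum => s _.
have -> : (fun w => M t w * M s w) = mono a (cedges t ++ cedges s).
  by apply/funext => w; rewrite monoD.
apply: le_trans (ler_norm _) _.
have [_] := mono_moment ha
  (normal_cat (@normal_cedges _ t) (@normal_cedges _ s)).
by rewrite size_pair.
Qed.

(** The powers are expanded one factor at a time.  The extra monomial L collects
    the factors already expanded, so that only expectations of monomials occur. *)
Let rest_part_pow m (L : seq ('I_n * 'I_n)) : normal_edges L ->
  P.-integrable setT (EFin \o (fun w => rest_part w ^+ m * mono a L w)) /\
  `|\int[P]_w (rest_part w ^+ m * mono a L w)| <=
    (\sum_(t : k.-tuple 'I_n | rest r t) 1) ^+ m * Cb C (m * k + size L).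
Proof.
elim: m L => [|m IH] L nL.
  have -> : (fun w => rest_part w ^+ 0 * mono a L w) = mono a L.
    by apply/funext => w; rewrite expr0 mul1r.
  rewrite expr0 mul1r mul0n add0n.
  by split; [exact: (mono_integrable ha nL)|exact: (mono_bound ha n_gt0 nL)].
have -> : (fun w => rest_part w ^+ m.+1 * mono a L w) = fun w =>
    \sum_(t : k.-tuple 'I_n | rest r t) rest_part w ^+ m * mono a (cedges t ++ L) w.
  apply/funext => w; rewrite exprSr -mulrA [rest_part w * _]mulr_suml mulr_sumr.
  by apply: eq_bigr => t _; rewrite monoD.
have IHt (t : k.-tuple 'I_n) := IH _ (normal_cat (@normal_cedges _ t) nL).
split; first by apply: integrable_EFin_sum => t _; case: (IHt t).
rewrite Rintegral_sum; last by move=> t _; case: (IHt t).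
apply: le_trans (ler_norm_sum _ _ _) _.
rewrite exprS -mulrA mulr_suml; apply: ler_sum => t _; rewrite mul1r.
have [_ /le_trans] := IHt t; apply.
by rewrite size_cat size_cedges size_tuple addnA mulSn [(k + _)%N]addnC.
Qed.

Lemma rest_part_integrable m : P.-integrable setT (EFin \o (fun w => rest_part w ^+ m)).
Proof.
have nn : normal_edges ([::] : seq ('I_n * 'I_n)) by [].
have [h _] := rest_part_pow m nn; apply: eq_integrable h => // w _ /=.
by rewrite /mono /wprod big_nil mulr1.
Qed.

Lemma rest_part_moment m : \int[P]_w (rest_part w ^+ m) <=
  (Kone R k * (n%:R * q) * beta ^+ k.+1) ^+ m * Cb C (m * k).
Proof.
have nn : normal_edges ([::] : seq ('I_n * 'I_n)) by [].
have [_] := rest_part_pow m nn; rewrite addn0.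
have -> : (fun w : T => rest_part w ^+ m * @mono _ _ _ a n [::] w) = (fun w : T => rest_part w ^+ m).
  by apply/funext => w; rewrite /mono /wprod big_nil mulr1.
move=> h; apply: le_trans (ler_norm _) _; apply: le_trans h _.
rewrite ler_wpM2r //; first exact: le_trans (Cb_ge1 _ _).
have h := count_rest R b_gt0 b_le k_gt0 rb.
apply: lerXn2r; rewrite ?nnegrE //; first by rewrite sumr_ge0.
by apply: le_trans h; rewrite sumr_ge0.
Qed.

(** A treelike walk of length k has k/2 distinct edges, and two of them without a
    common edge have twice as many.  The maximum with 1 keeps the index positive
    when k = 1, where no such walk exists. *)
Definition Cdev := `|Cl (maxn 1 (k./2 + k./2)) n| + 2 * `|Cl (maxn 1 k./2) n|.

Let tree_half (t : k.-tuple 'I_n) : tree r t ->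
  [/\ #|eset (cedges t)| = k./2, cedges t != [::] &
   forall e, count_mem e (cedges t) = 0%N \/ count_mem e (cedges t) = 2%N].
Proof.
move=> /andP[_ Tt]; have [h1 h2] := treelike_eset Tt.
split => //; last by rewrite -size_eq0 size_cedges size_tuple -lt0n.
move: Tt => /andP[_ /eqP]; rewrite h1 size_tuple; move: #|_| => m h.
have -> : k = m.*2 by rewrite -mul2n; lia.
by rewrite doubleK.
Qed.

(** Without a common edge, the joint product and the two single ones are products of
    squares of distinct entries, so that all three expectations are close to 1
    and cancel.  With a common edge, only boundedness is used. *)
Lemma tree_part_pair (t s : k.-tuple 'I_n) : tree r t -> tree r s ->
  \int[P]_w ((M t w - 1) * (M s w - 1)) <=
  (if share_edge t s then Cb C (2 * k) + 2 * Cb C k + 1 else 0) + Cdev.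
Proof.
move=> Tt Ts.
have k2 : (0 < k./2)%N.
  have [<- + _] := tree_half Tt; rewrite card_eset.
  by case: (cedges t) => // e L _; rewrite -card_eset card_gt0; apply/set0Pn; exists e; rewrite inE mem_head.
have Cd0 : 0 <= Cdev by rewrite addr_ge0 // mulr_ge0.
have m1 : maxn 1 k./2 = k./2 by apply/maxn_idPr.
have m2 : maxn 1 (k./2 + k./2) = (k./2 + k./2)%N by apply/maxn_idPr; rewrite addn_gt0 k2.
move: Cd0; rewrite /Cdev m1 m2 => Cd0.
have [h1 h2 h3] := tree_half Tt; have [g1 g2 g3] := tree_half Ts.
have -> : \int[P]_w ((M t w - 1) * (M s w - 1)) =
    \int[P]_w (M t w * M s w) - \int[P]_w M t w - \int[P]_w M s w + 1.
  have i1 : P.-integrable setT (EFin \o (cst 1 : T -> R)).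
    exact: finite_measure_integrable_cst.
  have E1 : \int[P]_w (cst 1 w) = 1 :> R.
    rewrite /Rintegral (integral_cst P measurableT 1%E) mul1e.
    exact: (congr1 fine (probability_setT P)).
  rewrite -[in RHS]E1 -!RintegralB //; last first.
    have := integrableB measurableT (intMM t s) (intM t).
    by apply: eq_integrable => // w _.
  rewrite -RintegralD //; last first.
    have := integrableB measurableT (integrableB measurableT (intMM t s) (intM t)) (intM s).
    by apply: eq_integrable => // w _.
  by apply: eq_Rintegral => w _ /=; ring.
have MM : (fun w => M t w * M s w) = mono a (cedges t ++ cedges s).
  by apply/funext => w; rewrite monoD.
have b1 := mono_bound ha n_gt0 (@normal_cedges _ t).
have b2 := mono_bound ha n_gt0 (@normal_cedges _ s).
have nts := normal_cat (@normal_cedges _ t) (@normal_cedges _ s).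
have b3 := mono_bound ha n_gt0 nts.
rewrite MM; rewrite size_pair in b3.
rewrite !size_cedges !size_tuple in b1 b2.
case: ifPn => [_|nsh].
  move: b1 b2 b3; rewrite !ler_norml -/(M t) -/(M s) => /andP[b1 _] /andP[b2 _] /andP[_ b3].
  by lra.
have cdisj e : e \in cedges t -> e \notin cedges s by move=> et; apply: (hasPn nsh).
have c2 e : count_mem e (cedges t ++ cedges s) = 0%N \/
            count_mem e (cedges t ++ cedges s) = 2%N.
  rewrite count_cat; have [et|et] := boolP (e \in cedges t).
    by rewrite (count_memPn (cdisj _ et)) addn0.
  by rewrite (count_memPn et) add0n.
have eU : #|eset (cedges t ++ cedges s)| = (k./2 + k./2)%N.
  rewrite eset_cat cardsU h1 g1 (_ : _ :&: _ = finset.set0)%SET ?cards0 ?subn0 //.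
  by apply/setP => e; rewrite !inE; case: (boolP (e \in cedges t)) => //= /cdisj /negbTE.
have := mono_square ha nts _ c2; rewrite eU.
have := mono_square ha (@normal_cedges _ t) h2 h3; rewrite h1.
have := mono_square ha (@normal_cedges _ s) g2 g3; rewrite g1.
rewrite -/(M t) -/(M s) => d1 d2 /(_ _) d3.
have {}d3 : `|\int[P]_w mono a (cedges t ++ cedges s) w - 1| <= `|Cl (k./2 + k./2)%N n|.
  by apply: d3; case: (cedges t) h2.
move: d1 d2 d3; rewrite !ler_norml add0r.
move=> /andP[d1 _] /andP[d2 _] /andP[_ d3].
by rewrite /M in d1 d2 *; lra.
Qed.

Lemma tree_part_integrable : P.-integrable setT (EFin \o (fun w => tree_part w ^+ 2)).
Proof.
have -> : (fun w => tree_part w ^+ 2) = fun w =>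
    \sum_(t : k.-tuple 'I_n | tree r t) \sum_(s : k.-tuple 'I_n | tree r s)
     (M t w - 1) * (M s w - 1).
  by apply/funext => w; rewrite expr2 big_distrlr.
apply: integrable_EFin_sum => t _; apply: integrable_EFin_sum => s _.
have i1 : P.-integrable setT (EFin \o (cst 1 : T -> R)).
  exact: finite_measure_integrable_cst.
have := integrableD measurableT (integrableB measurableT
  (integrableB measurableT (intMM t s) (intM t)) (intM s)) i1.
apply: eq_integrable => // w _ /=; rewrite -!EFinB -EFinD; congr (_%:E).
by ring.
Qed.

Lemma tree_part_moment : \int[P]_w (tree_part w ^+ 2) <=
  (Cb C (2 * k) + 2 * Cb C k + 1) * (Kpair R k * (n%:R * q * beta ^+ (2 * k))) +
  Cdev * (Kone R k * (n%:R * q) * beta ^+ k.+2) ^+ 2.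
Proof.
have -> : (fun w => tree_part w ^+ 2) = fun w =>
    \sum_(t : k.-tuple 'I_n | tree r t) \sum_(s : k.-tuple 'I_n | tree r s)
     (M t w - 1) * (M s w - 1).
  by apply/funext => w; rewrite expr2 big_distrlr.
have ims t s : P.-integrable setT (EFin \o (fun w => (M t w - 1) * (M s w - 1))).
  have i1 : P.-integrable setT (EFin \o (cst 1 : T -> R)).
    exact: finite_measure_integrable_cst.
  have := integrableD measurableT (integrableB measurableT
    (integrableB measurableT (intMM t s) (intM t)) (intM s)) i1.
  apply: eq_integrable => // w _ /=; rewrite -!EFinB -EFinD; congr (_%:E).
  by ring.
rewrite Rintegral_sum; last by move=> t _; apply: integrable_EFin_sum => s _.
set c := Cb C (2 * k) + _ + _.
apply: (@le_trans _ _ (\sum_(t : k.-tuple 'I_n | tree r t) \sum_(s : k.-tuple 'I_n | tree r s)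
   ((if share_edge t s then c else 0) + Cdev))).
  apply: ler_sum => t Tt; rewrite Rintegral_sum //; apply: ler_sum => s Ts.
  exact: tree_part_pair.
under eq_bigr do rewrite big_split /=.
rewrite big_split /= lerD //.
  apply: le_trans (ler_wpM2l _ (count_tree_pair R b_gt0 b_le k_gt0 rb)); last first.
    by rewrite /c; have := Cb_ge1 C (2 * k); have := Cb_ge1 C k; lra.
  rewrite mulr_sumr; apply: ler_sum => t _.
  rewrite mulr_sumr -big_mkcondr; apply: ler_sum => s _.
  by rewrite mulr1.
have Cd0 : 0 <= Cdev by rewrite addr_ge0 // mulr_ge0.
have -> : \sum_(t : k.-tuple 'I_n | tree r t) \sum_(s : k.-tuple 'I_n | tree r s) Cdev =
  Cdev * Ntree ^+ 2.
  rewrite expr2 /Ntree big_distrlr mulr_sumr; apply: eq_bigr => t _.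
  rewrite mulr_sumr; apply: eq_bigr => s _.
  by rewrite /= !mulr1.
rewrite ler_wpM2l //.
have h := count_tree R b_gt0 b_le k_gt0 rb.
apply: lerXn2r; rewrite ?nnegrE //; first by rewrite sumr_ge0.
by apply: le_trans h; rewrite sumr_ge0.
Qed.

End Estimates.

(** * Summability of the error terms *)

Section Summability.
Variable R : realType.
Implicit Types u v : nat -> R.

Lemma series_bounded_cvg u M : (forall n, 0 <= u n) ->
  (forall n, \sum_(0 <= i < n) u i <= M) -> cvgn (series u).
Proof.
move=> u0 hM; apply: nondecreasing_is_cvgn.
  by apply/nondecreasing_seqP => n; rewrite /series /= big_nat_recr //= lerDl.
by exists M => _ [n _ <-]; exact: hM.
Qed.

Section Root.
Variable m : nat.
Hypothesis m_gt0 : (0 < m)%N.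

Definition root_nat (n : nat) : R := n%:R `^ (m%:R^-1).

Lemma root_natX n : root_nat n ^+ m = n%:R.
Proof.
rewrite -powR_mulrn ?powR_ge0 // -powRrM mulVf ?powRr1 //.
by rewrite pnatr_eq0 -lt0n.
Qed.

Lemma root_nat_gt0 n : (0 < n)%N -> 0 < root_nat n.
Proof. by move=> n0; rewrite powR_gt0 // ltr0n. Qed.

Lemma root_nat1 : root_nat 1 = 1. Proof. by rewrite /root_nat powR1. Qed.

Lemma root_nat_le n k : (n <= k)%N -> root_nat n <= root_nat k.
Proof.
by move=> nk; apply: ge0_ler_powR; rewrite ?nnegrE ?invr_ge0 ?ler_nat.
Qed.

Let h n : R := (n%:R * root_nat n)^-1.

(** Comparison with a telescoping sum: by the factorisation of y^m - x^m, the
    m-th roots x and y of n and n+1 differ by at least 1 / (m y^(m-1)). *)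
Let h_step n : (0 < n)%N -> h n.+1 <= m%:R * ((root_nat n)^-1 - (root_nat n.+1)^-1).
Proof.
move=> n0; have x0 := root_nat_gt0 n0; have y0 := root_nat_gt0 (ltn0Sn n).
have xy := root_nat_le (leqnSn n).
set x := root_nat n in x0 xy *; set y := root_nat n.+1 in y0 xy *.
have dif : 1 <= (y - x) * (m%:R * y ^+ m.-1).
  rewrite [leLHS](_ : 1 = y ^+ m - x ^+ m); last first.
    by rewrite /x /y !root_natX -natr1 addrAC subrr add0r.
  rewrite subrXX ler_wpM2l ?subr_ge0 //.
  apply: (@le_trans _ _ (\sum_(i < m) y ^+ m.-1)); last first.
    by rewrite sumr_const card_ord mulr_natl.
  apply: ler_sum => i _.
  have -> : y ^+ m.-1 = y ^+ (m.-1 - i) * y ^+ i.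
    by rewrite -exprD subnK // -ltnS prednK.
  by rewrite ler_wpM2l ?exprn_ge0 ?(ltW y0) // lerXn2r ?nnegrE ?(ltW x0) ?(ltW y0).
have yx0 : 0 < y * x by rewrite mulr_gt0.
have -> : m%:R * (x^-1 - y^-1) = m%:R * (y - x) / (y * x).
  by field; rewrite !gt_eqF.
rewrite /h -(root_natX n.+1) -/y.
apply: (@le_trans _ _ (y ^+ m * x)^-1).
  by rewrite lef_pV2 ?posrE ?mulr_gt0 ?exprn_gt0 // ler_wpM2l // exprn_ge0 // ltW.
have -> : y ^+ m * x = y ^+ m.-1 * (y * x) by rewrite mulrA -exprSr prednK.
rewrite invfM; apply: ler_wpM2r; first by rewrite invr_ge0 ltW.
rewrite -div1r ler_pdivrMr ?exprn_gt0 //.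
by rewrite -mulrA mulrCA.
Qed.

Lemma summable_root : cvgn (series (fun n => (n%:R * root_nat n)^-1)).
Proof.
have h0 n : 0 <= h n by rewrite invr_ge0 mulr_ge0 ?powR_ge0.
apply: (@series_bounded_cvg h (1 + m%:R)) => // n.
have B k : \sum_(0 <= i < k.+2) h i + m%:R * (root_nat k.+1)^-1 <= 1 + m%:R.
  elim: k => [|k IH].
    rewrite big_nat_recr //= big_nat1 /h mul0r invr0 root_nat1.
    by rewrite mulr1 invr1 add0r mulr1.
  rewrite big_nat_recr //=; apply: le_trans IH; rewrite -addrA lerD2l.
  by have := @h_step k.+1 isT; rewrite mulrBr; lra.
apply: le_trans (B n); apply: ler_wpDr.
  by rewrite mulr_ge0 // invr_ge0 powR_ge0.
by rewrite 2?big_nat_recr //= -addrA lerDl addr_ge0.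
Qed.

(** According to whether b is at least the m-th root of n or not. *)
Lemma inv_prod_le n b : (0 < n)%N -> (0 < b)%N ->
  (n%:R * b%:R)^-1 <= (n%:R * root_nat n)^-1 + b%:R ^- m :> R.
Proof.
move=> n0 b0; have n0R : 0 < n%:R :> R by rewrite ltr0n.
have b0R : 0 < b%:R :> R by rewrite ltr0n.
have w0 := root_nat_gt0 n0.
have [bw|bw] := lerP (root_nat n) b%:R.
  apply: ler_wpDr; first by rewrite invr_ge0 exprn_ge0.
  by rewrite lef_pV2 ?posrE ?mulr_gt0 // ler_wpM2l // ltW.
apply: ler_wpDl; first by rewrite invr_ge0 mulr_ge0 // ltW.
rewrite lef_pV2 ?posrE ?mulr_gt0 ?exprn_gt0 //.
apply: (@le_trans _ _ n%:R); last by rewrite ler_peMr ?ler1n // ltW.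
by rewrite -(root_natX n); apply: lerXn2r; rewrite ?nnegrE ?ltW.
Qed.

End Root.
End Summability.

(** * Tail bound for the spectral moments *)

Section Convergence.
Context d (T : measurableType d) (R : realType) (P : probability T R).
Variables (a : forall n : nat, T -> 'M[R]_n) (C : nat -> R) (Cl : nat -> nat -> R)
  (b : nat -> nat).
Hypothesis ha : approx_uncorrelated P a C Cl.
Hypothesis hb : forall n : nat, (0 < n)%N -> is_bandwidth n (b n).
Hypothesis hb_oo : b n @[n --> \oo] --> \oo.
Let X n w := band_matrix (b n) (a n w).

Let b_gt0 n : (0 < n)%N -> (0 < b n)%N.
Proof.
move=> n0; have := hb n0; rewrite /is_bandwidth => /orP[/eqP -> //|].
by case/and3P.
Qed.

Let X_sym n w : (X n w)^T = X n w.
Proof. exact/band_matrix_sym/(au_symmetric ha). Qed.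

(** The order of magnitude of the probability that the k-th spectral moment is far
    from its limit.  The exponent p is free: it is chosen to make the rate
    summable. *)
Definition rate k p n : R := (n%:R * (b n)%:R)^-1 + (b n)%:R ^- p +
  (`|Cl (maxn 1 (k./2 + k./2)) n| + `|Cl (maxn 1 k./2) n|).

Lemma rate_ge0 k p n : 0 <= rate k p n.
Proof. by rewrite !addr_ge0 // invr_ge0 ?mulr_ge0 ?exprn_ge0. Qed.

Lemma measurable_emoment n k : measurable_fun setT (fun w => emoment (X n w) k).
Proof.
case: k => [|k].
  have -> : (fun w => emoment (X n w) 0) = cst (n%:R^-1 * \tr (1 : 'M[R]_n)).
    by apply/funext => w; rewrite /emoment expr0.
  exact: measurable_cst.
have -> : (fun w => emoment (X n w) k.+1) = fun w => n%:R^-1 *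
    (Num.sqrt (b n)%:R ^- k.+1 * \sum_(t : k.+1.-tuple 'I_n)
      (if cycle (relevant (b n)) t then mono a (cedges t) w else 0)).
  apply/funext => w; rewrite /emoment trace_band ?(au_symmetric ha) //.
  by rewrite big_mkcond.
apply: measurable_funM => //; apply: measurable_funM => //.
apply: measurable_sum => t.
by case: (cycle (relevant (b n)) t); [exact: (measurable_mono ha)|exact: measurable_cst].
Qed.

Let markov_part (S : T -> R) Z B e p : 0 < e -> 0 < Z -> measurable_fun setT S ->
  P.-integrable setT (EFin \o (fun w => S w ^+ (2 * p))) ->
  \int[P]_w (S w ^+ (2 * p)) <= B ->
  (P [set w | (e <= `|S w / Z|)%R] <= (e ^- (2 * p) * (B / Z ^+ (2 * p)))%:E)%E.
Proof.
move=> e0 Z0 mS iS SB.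
have iSZ : P.-integrable setT (EFin \o (fun w => (S w / Z) ^+ (2 * p))).
  have := integrableZr measurableT (Z ^- (2 * p)) iS.
  by apply: eq_integrable => // w _; rewrite /= -EFinM expr_div_n.
apply: le_trans (markov_even e0 _ iSZ) _; first exact: measurable_funM.
rewrite lee_fin ler_wpM2l ?invr_ge0 ?exprn_ge0 ?(ltW e0) //.
have -> : \int[P]_w (S w / Z) ^+ (2 * p) = \int[P]_w (S w ^+ (2 * p) * Z ^- (2 * p)).
  by apply: eq_Rintegral => w _; rewrite expr_div_n.
by rewrite RintegralZr // ler_wpM2r // invr_ge0 exprn_ge0 // ltW.
Qed.

(** The three parts of the trace are treated separately, each exceeding e with a
    probability controlled by Markov's inequality, with the exponent 2 for the
    first and the last and 2p for the middle one. *)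
Lemma emoment_tail k p e : (0 < k)%N -> 0 < e ->
  exists2 K : R, 0 <= K & forall n, (0 < n)%N ->
  (P [set w | (3 * e <= `|emoment (X n w) k - Ntree R n (b n) k / Z R n (b n) k|)%R]
    <= (K * rate k p n)%:E)%E.
Proof.
move=> k0 e0.
pose K1 := e ^- (2 * 1) * (Cb C (2 * k) * (Kone R k ^+ 2 + Kpair R k)).
pose K2 := e ^- (2 * p) * (Kone R k ^+ (2 * p) * Cb C (2 * p * k)).
pose K3 := e ^- (2 * 1) * ((Cb C (2 * k) + 2 * Cb C k + 1) * Kpair R k).
pose K4 := e ^- (2 * 1) * Kone R k ^+ 2 * 2.
have Cb0 j : 0 <= Cb C j := le_trans ler01 (Cb_ge1 C j).
have ko : 0 <= Kone R k by rewrite exprn_ge0.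
have kp : 0 <= Kpair R k by rewrite !mulr_ge0 ?exprn_ge0.
have e0' j : 0 <= e ^- j by rewrite invr_ge0 exprn_ge0 // ltW.
have K10 : 0 <= K1 by rewrite !mulr_ge0 // addr_ge0 // exprn_ge0.
have K20 : 0 <= K2 by rewrite !mulr_ge0 // exprn_ge0.
have K30 : 0 <= K3 by rewrite !mulr_ge0 // !addr_ge0 // mulr_ge0.
have K40 : 0 <= K4 by rewrite !mulr_ge0 // exprn_ge0.
exists (K1 + K2 + K3 + K4); first by rewrite !addr_ge0.
move=> n n0; have bn0 := b_gt0 n0; have hbn := hb n0.
have Z0 : 0 < Z R n (b n) k.
  by rewrite /Z mulr_gt0 ?ltr0n // exprn_gt0 // sqrtr_gt0 ltr0n.
have intM (t : seq 'I_n) : P.-integrable setT (EFin \o mono a (cedges t)).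
  exact: (mono_integrable ha (@normal_cedges n t)).
have mS1 : measurable_fun setT (single_part a n (b n) k).
  by apply/measurable_EFinP/(measurable_int P); apply: integrable_EFin_sum => t _.
have mS2 : measurable_fun setT (rest_part a n (b n) k).
  by apply/measurable_EFinP/(measurable_int P); apply: integrable_EFin_sum => t _.
have mS3 : measurable_fun setT (tree_part a n (b n) k).
  apply/measurable_EFinP/(measurable_int P); apply: integrable_EFin_sum => t _.
  have i1 : P.-integrable setT (EFin \o (cst 1 : T -> R)).
    exact: finite_measure_integrable_cst.
  have := integrableB measurableT (intM t) i1.
  by apply: eq_integrable => // w _.
have q1 : n%:R * (b n)%:R^-1 * Num.sqrt (b n)%:R ^+ (2 * k) / Z R n (b n) k ^+ (2 * 1)
    = (n%:R * (b n)%:R)^-1 :> R.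
  have b0 : (b n)%:R != 0 :> R by rewrite pnatr_eq0 -lt0n.
  have n0' : n%:R != 0 :> R by rewrite pnatr_eq0 -lt0n.
  have : Num.sqrt (b n)%:R != 0 :> R by rewrite gt_eqF // sqrtr_gt0 ltr0n.
  rewrite /Z exprMn [(2 * k)%N]mulnC exprM muln1.
  move: (Num.sqrt (b n)%:R : R) => x x0.
  by have := expf_neq0 k x0; move: (x ^+ k) => y y0; field; rewrite b0 n0' y0.
have q2 j : n%:R * (b n)%:R^-1 * Num.sqrt (b n)%:R ^+ (k + j) / Z R n (b n) k
    = (b n)%:R^-1 * Num.sqrt (b n)%:R ^+ j :> R.
  have b0 : (b n)%:R != 0 :> R by rewrite pnatr_eq0 -lt0n.
  have n0' : n%:R != 0 :> R by rewrite pnatr_eq0 -lt0n.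
  have : Num.sqrt (b n)%:R != 0 :> R by rewrite gt_eqF // sqrtr_gt0 ltr0n.
  rewrite /Z exprD.
  move: (Num.sqrt (b n)%:R : R) => x x0.
  by have := expf_neq0 k x0; move: (x ^+ k) (x ^+ j) => y z y0; field; rewrite b0 n0' y0.
have sb : Num.sqrt (b n)%:R ^+ 2 = (b n)%:R :> R by rewrite sqr_sqrtr.
have x0 : 0 <= (n%:R * (b n)%:R)^-1 :> R by rewrite invr_ge0 mulr_ge0.
have y0 : 0 <= (b n)%:R ^- p :> R by rewrite invr_ge0 exprn_ge0.
pose z : R := `|Cl (maxn 1 (k./2 + k./2)) n| + `|Cl (maxn 1 k./2) n|.
have z0 : 0 <= z by rewrite addr_ge0.
have r1 : (n%:R * (b n)%:R)^-1 <= rate k p n by rewrite /rate -/z; lra.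
have r2 : (b n)%:R ^- p <= rate k p n by rewrite /rate -/z; lra.
have r3 : z <= rate k p n by rewrite /rate -/z; lra.
have t1 : (P [set w | (e <= `|single_part a n (b n) k w / Z R n (b n) k|)%R]
    <= (K1 * rate k p n)%:E)%E.
  have h := @markov_part (single_part a n (b n) k) _ _ e 1 e0 Z0 mS1 (single_part_integrable ha n (b n) k)
    (single_part_moment ha hbn bn0 k0).
  apply: le_trans h _.
  rewrite lee_fin (_ : _ * _ = K1 * (n%:R * (b n)%:R)^-1); first exact: ler_wpM2l.
  by rewrite /K1 -q1; ring.
have t2 : (P [set w | (e <= `|rest_part a n (b n) k w / Z R n (b n) k|)%R]
    <= (K2 * rate k p n)%:E)%E.
  have h := @markov_part (rest_part a n (b n) k) _ _ e p e0 Z0 mS2 (rest_part_integrable ha (b n) k n0 _)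
    (rest_part_moment ha n0 hbn bn0 k0 _).
  apply: le_trans h _.
  rewrite lee_fin (_ : _ * _ = K2 * (b n)%:R ^- p); first exact: ler_wpM2l.
  have -> : (b n)%:R ^- p = (n%:R / (b n)%:R * Num.sqrt (b n)%:R ^+ (k + 1) /
      Z R n (b n) k) ^+ (2 * p) :> R.
    have h2 : ((b n)%:R^-1 * Num.sqrt (b n)%:R) ^+ 2 = (b n)%:R^-1 :> R.
      rewrite expr2 mulrACA -[Num.sqrt _ * _]expr2 sb -mulrA mulVf ?mulr1 //.
      by rewrite pnatr_eq0 -lt0n.
    by rewrite q2 expr1 exprM h2 exprVn.
  rewrite /K2 addn1 expr_div_n -[Kone R k * _ * _]mulrA exprMn.
  by rewrite -!mulrA; congr (_ * (_ * _)); rewrite mulrCA.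
have t3 : (P [set w | (e <= `|tree_part a n (b n) k w / Z R n (b n) k|)%R]
    <= ((K3 + K4) * rate k p n)%:E)%E.
  have h := @markov_part (tree_part a n (b n) k) _ _ e 1 e0 Z0 mS3 (tree_part_integrable ha n (b n) k)
    (tree_part_moment ha n0 hbn bn0 k0).
  apply: le_trans h _.
  rewrite lee_fin (_ : _ * _ = K3 * (n%:R * (b n)%:R)^-1 +
    e ^- (2 * 1) * Kone R k ^+ 2 * Cdev Cl n k); last first.
    have -> : Kone R k ^+ 2 = Kone R k ^+ 2 *
      (n%:R / (b n)%:R * Num.sqrt (b n)%:R ^+ (k + 2) / Z R n (b n) k) ^+ 2 :> R.
      rewrite q2 sb mulVf ?expr1n ?mulr1 //.
      by rewrite pnatr_eq0 -lt0n.
    rewrite /K3 -q1 muln1 addn2 expr_div_n -[Kone R k * _ * _]mulrA [(Kone R k * _) ^+ 2]exprMn.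
    move: (Kone R k ^+ 2) (Kpair R k) (e ^- 2) (Z R n (b n) k ^- 2) => A1 A2 A3 A4.
    move: ((n%:R / (b n)%:R * Num.sqrt (b n)%:R ^+ k.+2) ^+ 2) => A5.
    move: (n%:R / (b n)%:R * Num.sqrt (b n)%:R ^+ (2 * k)) => A6.
    by ring.
  rewrite mulrDl lerD //; first exact: ler_wpM2l.
  rewrite /K4 -[leRHS]mulrA; apply: ler_wpM2l.
    by rewrite mulr_ge0 // exprn_ge0.
  have := normr_ge0 (Cl (maxn 1 (k./2 + k./2)) n).
  by have := r3; rewrite /Cdev /z; lra.
have mset (S : T -> R) c (mS : measurable_fun setT S) :
    measurable [set w | (e <= `|S w / c|)%R].
  by apply: measurable_norm_ge; exact: measurable_funM.
have m1 := mset _ (Z R n (b n) k) mS1.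
have m2 := mset _ (Z R n (b n) k) mS2.
have m3 := mset _ (Z R n (b n) k) mS3.
apply: (@le_trans _ _ (P (([set w | (e <= `|single_part a n (b n) k w / Z R n (b n) k|)%R] `|`
   [set w | (e <= `|rest_part a n (b n) k w / Z R n (b n) k|)%R]) `|`
   [set w | (e <= `|tree_part a n (b n) k w / Z R n (b n) k|)%R]))).
  apply: le_measure; rewrite ?inE.
  - apply: measurable_norm_ge; apply: measurable_funB => //.
    exact: measurable_emoment.
  - by apply: measurableU => //; exact: measurableU.
  - move=> w /=; rewrite (emoment_split ha) // => hw.
    have [|h1] := lerP e `|single_part a n (b n) k w / Z R n (b n) k|; first by left; left.
    have [|h2] := lerP e `|rest_part a n (b n) k w / Z R n (b n) k|; first by left; right.
    have [|h3] := lerP e `|tree_part a n (b n) k w / Z R n (b n) k|; first by right.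
    exfalso; move: hw; apply/negP; rewrite -ltNge.
    apply: le_lt_trans (ler_normD _ _) _.
    have := ler_normD (single_part a n (b n) k w / Z R n (b n) k) (rest_part a n (b n) k w / Z R n (b n) k).
    by move: h1 h2 h3; lra.
apply: le_trans (measureU2 _ _ _) _ => //; first exact: measurableU.
have -> : (K1 + K2 + K3 + K4) * rate k p n = K1 * rate k p n + K2 * rate k p n +
   (K3 + K4) * rate k p n by ring.
rewrite EFinD leeD // EFinD; apply: le_trans (measureU2 _ _ _) _ => //.
by rewrite leeD.
Qed.

Let n_to_b_ge M : exists2 N, (0 < N)%N & forall n, (N <= n)%N -> (M <= b n)%N.
Proof.
have /cvgnyPge /(_ M) [N _ hN] := hb_oo.
exists N.+1 => // n Nn; apply: hN; exact: ltnW.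
Qed.

(** The number of readings of closed walks, n b^(k/2) times the ballot number, is
    exactly the semicircle moment in units of the normalisation; it exceeds the
    number of tree walks by at most 2^k readings per walk of the middle class. *)
Lemma Ntree_approx k n : (0 < k)%N -> (0 < n)%N ->
  `|Ntree R n (b n) k / Z R n (b n) k - sc_moment R k| <=
   2 ^+ k * Kone R k / Num.sqrt (b n)%:R.
Proof.
move=> k0 n0; have bn0 := b_gt0 n0; have hbn := hb n0.
pose r := @relevant n (b n).
have rs : symmetric r by exact: relevant_sym.
have rr y : #|[set z | r y z]%SET| = b n by exact: relevant_reg.
have rle y : (#|[set z | r y z]%SET| <= b n)%N by rewrite rr.
have ble : (b n <= n)%N.
  by move: hbn; rewrite /is_bandwidth => /orP[/eqP ->|/and3P[_ _ /ltnW]].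
pose nt := (\sum_(t : k.-tuple 'I_n | cycle r t && treelike t) 1)%N.
pose nr := (\sum_(t : k.-tuple 'I_n | rest r t) 1)%N.
pose m := (n * (ballot k 0 * b n ^ k./2))%N.
have h1 : (nt <= m)%N := card_treelike_ge rs rr k0.
have h2 : (m <= nt + 2 ^ k * nr)%N := card_treelike_le rs rr k0.
have ntE : Ntree R n (b n) k = nt%:R by rewrite /Ntree /nt natr_sum.
have nrE : nr%:R <= Kone R k * (n%:R * (b n)%:R^-1) * Num.sqrt (b n)%:R ^+ k.+1 :> R.
  by have := count_rest R bn0 ble k0 rle; rewrite /nr natr_sum.
have x0 : 0 < Num.sqrt (b n)%:R :> R by rewrite sqrtr_gt0 ltr0n.
have sb : Num.sqrt (b n)%:R ^+ 2 = (b n)%:R :> R by rewrite sqr_sqrtr.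
have Z0 : 0 < Z R n (b n) k by rewrite mulr_gt0 ?ltr0n // exprn_gt0.
have mE : m%:R / Z R n (b n) k = sc_moment R k.
  rewrite sc_momentE /m; case: ifPn => ok.
    by rewrite ballot_odd ?addn0 // mul0n muln0 mul0r.
  have kj : k = (2 * k./2)%N.
    by rewrite mul2n -[LHS]odd_double_half (negbTE ok).
  have hc := ballot_catalan k./2; rewrite -kj in hc.
  have hcR : k./2.+1%:R * (ballot k 0)%:R = 'C(k, k./2)%:R :> R by rewrite -natrM hc.
  have bk : Num.sqrt (b n)%:R ^+ k = (b n)%:R ^+ k./2 :> R.
    by rewrite [in LHS]kj exprM sb.
  rewrite -hcR /Z bk !natrM natrX.
  have j0 : k./2.+1%:R != 0 :> R by rewrite pnatr_eq0.
  have n0' : n%:R != 0 :> R by rewrite pnatr_eq0 -lt0n.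
  have : (b n)%:R ^+ k./2 != 0 :> R by rewrite expf_neq0 // pnatr_eq0 -lt0n.
  move: (k./2.+1%:R : R) j0 (n%:R : R) n0' ((b n)%:R ^+ k./2) ((ballot k 0)%:R : R).
  move=> u u0 v v0 x y x0'.
  by rewrite mulrCA mulfK ?mulf_neq0 // [RHS]mulrC mulKf.
rewrite -mE ntE -mulrBl normrM [`|_^-1|]ger0_norm ?invr_ge0 ?(ltW Z0) //.
have -> : `|nt%:R - m%:R| = m%:R - nt%:R :> R.
  by rewrite distrC ger0_norm // subr_ge0 ler_nat.
rewrite ler_pdivrMr //.
apply: (@le_trans _ _ (2 ^+ k * nr%:R)).
  by rewrite lerBlDl -natrX -natrM -natrD ler_nat.
rewrite -!mulrA; apply: ler_wpM2l; first by rewrite exprn_ge0.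
apply: le_trans nrE _; rewrite -!mulrA; apply: ler_wpM2l.
  by rewrite exprn_ge0.
have : Num.sqrt (b n)%:R != 0 :> R by rewrite gt_eqF.
move: sb; rewrite /Z [_ ^+ k.+1]exprS.
move: ((b n)%:R : R) (n%:R : R) (Num.sqrt (b n)%:R : R) => c v x <- x_neq0.
rewrite le_eqVlt; apply/orP; left; apply/eqP.
by move: (x ^+ k) => y; field.
Qed.

Lemma moment_tail k p e : 0 < e ->
  exists2 K : R, 0 <= K & exists2 N, (0 < N)%N & forall n, (N <= n)%N ->
  (P [set w | (e <= `|emoment (X n w) k - sc_moment R k|)%R]
    <= (K * rate k p n)%:E)%E.
Proof.
move=> e0; case: k => [|k].
  exists 0 => //; exists 1%N => // n n0; rewrite mul0r.
  rewrite (_ : [set w | _] = set0) ?measure0 //; apply/seteqP; split => // w /=.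
  rewrite /emoment expr0 sc_moment0 mxtrace1 mulVf ?subrr ?normr0 ?pnatr_eq0 -?lt0n //.
  by rewrite leNgt e0.
have e6 : 0 < e / 6 by rewrite divr_gt0.
have [K K0 hK] := @emoment_tail k.+1 p _ isT e6.
pose L : R := 2 ^+ k.+1 * Kone R k.+1.
have L0 : 0 <= L by rewrite mulr_ge0 ?exprn_ge0.
have [N N0 hN] := n_to_b_ge (Num.truncn ((L / (e / 2)) ^+ 2)).+1.
exists K => //; exists N => // n Nn; have n0 : (0 < n)%N := leq_trans N0 Nn.
apply: le_trans (hK n n0); apply: le_measure; rewrite ?inE.
- by apply: measurable_norm_ge; apply: measurable_funB => //; exact: measurable_emoment.
- by apply: measurable_norm_ge; apply: measurable_funB => //; exact: measurable_emoment.
move=> w /= hw; have := @Ntree_approx k.+1 n isT n0; rewrite -/L => h1.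
have h2 : L / Num.sqrt (b n)%:R <= e / 2.
  have x0 : 0 < Num.sqrt (b n)%:R :> R by rewrite sqrtr_gt0 ltr0n b_gt0.
  have e2 : 0 < e / 2 by rewrite divr_gt0.
  rewrite ler_pdivrMr // [leRHS]mulrC -ler_pdivrMr //.
  have le0 : 0 <= L / (e / 2) by rewrite divr_ge0 // ltW.
  rewrite -[leLHS](ger0_norm le0) -sqrtr_sqr; apply: ler_wsqrtr.
  apply: le_trans (ltW (truncnS_gt _)) _.
  by rewrite ler_nat hN.
have h3 := le_trans h1 h2.
have := ler_distD (Ntree R n (b n) k.+1 / Z R n (b n) k.+1)
  (emoment (X n w) k.+1) (sc_moment R k.+1).
by move: hw h3; rewrite distrC; lra.
Qed.

End Convergence.

(** * Measurability of integrals against the spectral distribution *)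

Section Measurability.
Context d (T : measurableType d) (R : realType).

(** The integral of a polynomial is a combination of the measurable spectral
    moments.  Approximating f on [-(j+1), j+1] up to 1/(j+1) gives pointwise
    convergence, as the spectrum of a given matrix lies in these segments from
    some j on. *)
Lemma measurable_esd_integral n (Y : T -> 'M[R]_n) (f : R -> R) :
  (forall w, (Y w)^T = Y w) ->
  (forall k, measurable_fun setT (fun w => emoment (Y w) k)) ->
  continuous f -> measurable_fun setT (fun w => \int[esd (Y w)]_x f x).
Proof.
move=> Ys mY cf; case: n => [|n] in Y Ys mY *.
  rewrite (_ : (fun w => _) = cst (\int[esd (0 : 'M[R]_0)]_x f x)).
    exact: measurable_cst.
  by apply/funext => w /=; rewrite [Y w]flatmx0.
have j0 (j : nat) : 0 < j.+1%:R :> R by rewrite ltr0n.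
have j0V (j : nat) : 0 < j.+1%:R^-1 :> R by rewrite invr_gt0.
have [q hq] := choice (fun j => weierstrass cf (j0 j) (j0V j)).
have mf : measurable_fun setT f by exact: continuous_measurable_fun.
apply: (measurable_fun_cvg
  (h := fun j w => \sum_(i < size (q j)) (q j)`_i * emoment (Y w) i)) => [j|w _].
  by apply: measurable_sum => i; exact: measurable_funM.
apply/cvgrPdist_le => e e0.
pose B := \sum_(x <- spectrum (Y w)) `|x|.
near=> j.
have hj : B <= j.+1%:R.
  have : (Num.truncn B < j)%N by near: j; exact: nbhs_infty_gt.
  rewrite -(ltr_nat R) => h; apply: ltW; apply: lt_trans (truncnS_gt _) _.
  by rewrite ltr_nat ltnS -(ltr_nat R).
have je : j.+1%:R^-1 <= e.
  have : (Num.truncn e^-1 < j)%N by near: j; exact: nbhs_infty_gt.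
  move=> h; rewrite -[e]invrK lef_pV2 ?posrE ?invr_gt0 //.
  apply: ltW; apply: lt_trans (truncnS_gt _) _.
  by rewrite ltr_nat ltnS.
apply: le_trans je.
rewrite -(esd_poly _ (Ys w)) esd_integral // -mulrBr -sumrB.
rewrite -[leRHS](@esd_cst _ _ _ (Y w)) // normrM ger0_norm ?invr_ge0 ?ler0n //.
apply: ler_wpM2l; first by rewrite invr_ge0.
apply: le_trans (ler_norm_sum _ _ _) _.
rewrite big_seq [leRHS]big_seq; apply: ler_sum => x xs; apply: hq.
rewrite -ler_norml; apply: le_trans hj.
by rewrite /B (big_rem x) //= lerDl sumr_ge0.
Unshelve. all: by end_near.
Qed.

End Measurability.

(** * Convergence in probability and almost surely *)

Section Probability.
Context d (T : measurableType d) (R : realType) (P : probability T R).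

Lemma borel_cantelli (E : nat -> set T) (u : nat -> R) N :
  (forall n, measurable (E n)) -> (forall n, 0 <= u n) ->
  (forall n, (N <= n)%N -> (P (E n) <= (u n)%:E)%E) -> cvgn (series u) ->
  {ae P, forall w, \forall n \near \oo, ~ E n w}.
Proof.
move=> mE u0 hE su.
pose F n := if (N <= n)%N then E n else set0.
have mF n : measurable (F n) by rewrite /F; case: ifP.
have F0 : P (lim_sup_set F) = 0%E.
  apply: lim_sup_set_cvg0 => //.
  apply: (@le_lt_trans _ _ (\sum_(n <oo) (u n)%:E)%E).
    apply: lee_nneseries => // n _.
    by rewrite /F; case: ifP => [/hE //|_]; rewrite measure0 lee_fin.
  rewrite (_ : (\sum_(n <oo) (u n)%:E)%E = limn (EFin \o series u)).
    by rewrite EFin_lim // ltry.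
  by congr (limn _); apply/funext => n; rewrite /series /= sumEFin.
exists (lim_sup_set F); split => //.
  by apply: bigcap_measurable => // k _; exact: bigcup_measurable.
move=> w hw n _; apply: contrapT => nF; apply: hw.
exists (maxn n N) => // j /= nj Ej; apply: nF; exists j => /=.
  exact: leq_trans (leq_maxl _ _) nj.
by rewrite /F (leq_trans (leq_maxr _ _) nj).
Qed.

End Probability.

Section Laws.
Context d (T : measurableType d) (R : realType) (P : probability T R).
Variables (a : forall n : nat, T -> 'M[R]_n) (C : nat -> R) (Cl : nat -> nat -> R)
  (b : nat -> nat).
Hypothesis ha : approx_uncorrelated P a C Cl.
Hypothesis hb : forall n : nat, (0 < n)%N -> is_bandwidth n (b n).
Hypothesis hb_oo : b n @[n --> \oo] --> \oo.
Let X n w := band_matrix (b n) (a n w).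

Let X_sym n w : (X n w)^T = X n w.
Proof. exact/band_matrix_sym/(au_symmetric ha). Qed.

Let dev k e n : set T := [set w | e <= `|emoment (X n w) k - sc_moment R k|].

Let measurable_dev k e n : measurable (dev k e n).
Proof.
apply: measurable_norm_ge; apply: measurable_funB => //.
exact: (measurable_emoment b ha).
Qed.

Lemma rate_cvg0 k : rate Cl b k 1 n @[n --> \oo] --> 0.
Proof.
have boo : (b n)%:R^-1 @[n --> \oo] --> (0 : R).
  apply/gtr0_cvgV0; last exact/cvgrnyP.
  near=> n; rewrite ltr0n.
  by near: n; have /cvgnyPge /(_ 1%N) := hb_oo.
have c0 l : (0 < l)%N -> `|Cl l n| @[n --> \oo] --> (0 : R).
  by move=> l0; rewrite -[X in _ --> X](@normr0 R R); apply: cvg_norm; exact: (au_cvg0 ha).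
rewrite /rate -[X in _ --> X](addr0 0); apply: cvgD.
  rewrite -[X in _ --> X](addr0 0); apply: cvgD; last exact: boo.
  apply: (squeeze_cvgr (f := cst 0) (h := fun n => (b n)%:R^-1)) => //.
    near=> n; have n0 : (0 < n)%N by near: n; exact: nbhs_infty_gt.
    rewrite /= invr_ge0 mulr_ge0 //= invfM ler_piMl ?invr_ge0 //.
    by rewrite invf_le1 ?ltr0n // ler1n.
  exact: cvg_cst.
by rewrite -[X in _ --> X](addr0 0); apply: cvgD; apply: c0; rewrite leq_max.
Unshelve. all: by end_near.
Qed.

Let dev_cvg0 k e : 0 < e -> fine (P (dev k e n)) @[n --> \oo] --> 0.
Proof.
move=> e0; have [K K0 [N N0 hK]] := moment_tail ha hb hb_oo k 1 e0.
apply: (squeeze_cvgr (f := cst 0) (h := fun n => K * rate Cl b k 1 n)).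
- near=> n; rewrite fine_ge0 //= -lee_fin fineK ?fin_num_measure //.
  by apply: hK; near: n; exact: nbhs_infty_ge.
- exact: cvg_cst.
- by rewrite -[X in _ --> X](mulr0 K); apply: cvgMl_tmp; exact: rate_cvg0.
Unshelve. all: by end_near.
Qed.

Let cvg_fsum N (u : nat -> nat -> R) (l : nat -> R) :
  (forall k, u k n @[n --> \oo] --> l k) ->
  \sum_(k < N) u k n @[n --> \oo] --> \sum_(k < N) l k.
Proof.
move=> h; apply: (@cvg_big _ _ +%R 0 xpredT _ nat \oo _ (fun k : 'I_N => u k)) => //.
exact: add_continuous.
Qed.

(** If the first N moments are all within D of their limits, then the integral of f
    is within e of its limit; the choice of D makes K N D at most e/2. *)
Lemma law_in_probability : semicircle_law_in_probability P X.
Proof.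
move=> f cf bf; split=> [n|e e0].
  by apply: measurable_esd_integral => // k; exact: (measurable_emoment b ha).
have e2 : 0 < e / 2 by rewrite divr_gt0.
have [N [K [K0 hK]]] := esd_approx cf bf e2.
pose D := (e / 2) / (K * N%:R + 1).
have D1 : 0 < K * N%:R + 1 by rewrite ltr_wpDl // mulr_ge0.
have D0 : 0 < D by rewrite divr_gt0.
apply: (squeeze_cvge (f := cst 0%E)
  (h := fun n => (\sum_(k < N) fine (P (dev k D n)))%:E)).
- near=> n; have n0 : (0 < n)%N by near: n; exact: nbhs_infty_gt.
  rewrite measure_ge0 /=.
  apply: (@le_trans _ _ (P (\big[setU/set0]_(k < N) dev k D n))).
    have mY : measurable_fun setT (fun w => `|\int[esd (X n w)]_x f x -
        \int[@semicircle R]_x f x|).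
      apply: measurableT_comp => //; apply: measurable_funB => //.
      by apply: measurable_esd_integral => // k; exact: (measurable_emoment b ha).
    apply: le_measure; rewrite ?inE.
    + have := mY measurableT _ (measurable_itv `]e, +oo[); rewrite setTI.
      by congr measurable; apply/seteqP; split => w; rewrite /= in_itv /= andbT.
    + by apply: bigsetU_measurable => k _; exact: measurable_dev.
    rewrite -(bigcup_mkord N (fun k => dev k D n)) => w /= hw; apply: contrapT => hN.
    have small k : (k < N)%N -> `|emoment (X n w) k - sc_moment R k| <= D.
      move=> kN; rewrite leNgt; apply/negP => hD; apply: hN; exists k => //=.
      exact: ltW.
    move: hw; apply/negP; rewrite -leNgt.
    apply: le_trans (hK n (X n w) n0 (X_sym n w)) _.
    rewrite [leRHS](splitr e) lerD2l.
    apply: (@le_trans _ _ (K * (N%:R * D))).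
      apply: ler_wpM2l => //; rewrite -[N in leRHS]card_ord mulr_natl -sumr_const.
      by apply: ler_sum => k _; exact: small.
    rewrite mulrA /D mulrA ler_pdivrMr // mulrC ler_pM2l //.
    by rewrite lerDl.
  have union : (P (\big[setU/set0]_(k < N) dev k D n) <=
      \sum_(k < N) P (dev k D n))%E.
    exact: (Boole_inequality P (A := fun k => dev k D n)).
  apply: le_trans union _; rewrite -sumEFin lee_sum // => k _.
  by rewrite fineK // fin_num_measure.
- exact: cvg_cst.
- have h : \sum_(k < N) fine (P (dev k D n)) @[n --> \oo] --> (0 : R).
    rewrite [X in _ --> X](_ : 0 = \sum_(k < N) (0 : R)); last by rewrite big1.
    exact: (@cvg_fsum N (fun k n => fine (P (dev k D n))) (fun=> 0)
      (fun k => dev_cvg0 k D0)).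
  exact: (cvg_comp _ _ h).
Unshelve. all: by end_near.
Qed.

(** The error bounds an absolute value as soon as there are l distinct diagonal
    positions. *)
Lemma Cl_ge0 l n : (0 < l)%N -> (l <= n)%N -> 0 <= Cl l n.
Proof.
move=> l0 ln; pose Q (i : 'I_l) := (widen_ord ln i, widen_ord ln i).
rewrite -lee_fin; apply: le_trans (au_square ha l0 (Q := Q) _); first exact: abse_ge0.
move=> i j ij; rewrite !finset.setUid; apply: contra ij => /eqP /finset.set1_inj.
by move=> /(congr1 val) /= /val_inj ->.
Qed.

(** Only finitely many terms can be negative. *)
Lemma summable_norm_Cl l : (0 < l)%N -> cvgn (series (Cl l)) ->
  cvgn (series (fun n => `|Cl l n|)).
Proof.
move=> l0 sC; pose w i : R := if (i < l)%N then 2 * `|Cl l i| else 0.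
have w0 i : 0 <= w i by rewrite /w; case: ifP => // _; rewrite mulr_ge0.
have sw : cvgn (series w).
  apply: (@series_bounded_cvg _ w (\sum_(0 <= i < l) w i)) => // n.
  apply: (@le_trans _ _ (\sum_(0 <= i < n + l) w i)).
    by rewrite [leRHS](big_cat_nat (n := n)) ?leq_addr //= lerDl sumr_ge0.
  rewrite [leLHS](big_cat_nat (n := l)) ?leq_addl //=.
  rewrite gerDl big_nat_cond big1 // => i /andP[/andP[li _] _].
  by rewrite /w ltnNge li.
have le i : `|Cl l i| <= (Cl l + w) i.
  rewrite /GRing.add /= /w; case: ltnP => [_|li]; last by rewrite addr0 ger0_norm ?Cl_ge0.
  by have := ler_norm (- Cl l i); rewrite normrN; lra.
apply: (@series_le_cvg _ _ (Cl l + w)) => //.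
- by move=> i; apply: le_trans (le i).
- exact: is_cvg_seriesD.
Qed.

Lemma summable_rate k p : (0 < p)%N ->
  cvgn (series (fun n => ((b n)%:R : R) ^- p)) ->
  (forall l, (0 < l)%N -> cvgn (series (Cl l))) ->
  cvgn (series (rate Cl b k p)).
Proof.
move=> p0 sb sC.
have sr := @summable_root R p p0.
have s1 : cvgn (series (fun n => (n%:R * (b n)%:R)^-1 : R)).
  apply: (@series_le_cvg _ _ (fun n => (n%:R * root_nat R p n)^-1 + (b n)%:R ^- p)).
  - by move=> n; rewrite invr_ge0 mulr_ge0.
  - by move=> n; rewrite addr_ge0 // invr_ge0 ?exprn_ge0 // mulr_ge0 // powR_ge0.
  - case=> [|n]; last first.
      apply: inv_prod_le => //.
      have := hb (ltn0Sn n); rewrite /is_bandwidth => /orP[/eqP -> //|].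
      by case/and3P.
    by rewrite mul0r invr0 addr_ge0 // invr_ge0 ?exprn_ge0 // mulr_ge0 // powR_ge0.
  exact: is_cvg_seriesD sr sb.
have sN l : (0 < l)%N -> cvgn (series (fun n => `|Cl l n|)).
  by move=> l0; apply: summable_norm_Cl => //; exact: sC.
apply: is_cvg_seriesD; first exact: is_cvg_seriesD.
by apply: is_cvg_seriesD; apply: sN; rewrite leq_max.
Qed.

(** Borel-Cantelli is applied to the moments and to the deviations 1/(j+1) only, so
    that a single null event serves all orders k and all accuracies. *)
Lemma law_almost_surely p : (0 < p)%N ->
  cvgn (series (fun n => ((b n)%:R : R) ^- p)) ->
  (forall l, (0 < l)%N -> cvgn (series (Cl l))) ->
  semicircle_law_almost_surely P X.
Proof.
move=> p0 sb sC f cf bf.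
have ae1 : {ae P, forall w, forall k j, \forall n \near \oo, ~ dev k j.+1%:R^-1 n w}.
  apply: ae_foralln => k; apply: ae_foralln => j.
  have j0 : 0 < j.+1%:R^-1 :> R by rewrite invr_gt0.
  have [K K0 [N N0 hK]] := moment_tail ha hb hb_oo k p j0.
  apply: (@borel_cantelli _ _ _ _ _ (fun n => K * rate Cl b k p n) N) => //.
  - by move=> n; rewrite mulr_ge0 // rate_ge0.
  - rewrite (_ : (fun n => K * _) = K *: (rate Cl b k p : nat -> R)) //.
    by apply: is_cvg_seriesZ; exact: summable_rate.
apply: filterS ae1 => w hw.
have mc k : `|emoment (X n w) k - sc_moment R k| @[n --> \oo] --> (0 : R).
  apply/cvgr0Pnorm_le => e e0.
  have [j /ltW je] : exists j : nat, j.+1%:R^-1 < e.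
    exists (Num.truncn e^-1); rewrite -[ltRHS]invrK ltf_pV2 ?posrE ?invr_gt0 //.
    exact: truncnS_gt.
  apply: filterS (hw k j) => n hn; rewrite normr_id.
  by apply: le_trans je; rewrite leNgt; apply/negP => /ltW /hn.
apply/cvgrPdist_le => e e0.
have e2 : 0 < e / 2 by rewrite divr_gt0.
have [N [K [K0 hK]]] := esd_approx cf bf e2.
have h : K * \sum_(k < N) `|emoment (X n w) k - sc_moment R k| @[n --> \oo] --> (0 : R).
  rewrite -[X in _ --> X](mulr0 K); apply: cvgMl_tmp.
  rewrite [X in _ --> X](_ : 0 = \sum_(k < N) (0 : R)); last by rewrite big1.
  exact: (@cvg_fsum N (fun k n => `|emoment (X n w) k - sc_moment R k|) (fun=> 0)).
near=> n; have n0 : (0 < n)%N by near: n; exact: nbhs_infty_gt.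
rewrite distrC; apply: le_trans (hK n (X n w) n0 (X_sym n w)) _.
rewrite [leRHS](splitr e) lerD2l.
apply: le_trans (ler_norm _) _.
by near: n; move/cvgr0Pnorm_le: h; exact.
Unshelve. all: by end_near.
Qed.

End Laws.

Theorem theorem1 (d : measure_display) (T : measurableType d) (R : realType)
    (P : probability T R)
    (a : forall n : nat, T -> 'M[R]_n)
    (C : nat -> R) (Cl : nat -> nat -> R)
    (b : nat -> nat)
    (ha : approx_uncorrelated P a C Cl)
    (hb : forall n : nat, (0 < n)%N -> is_bandwidth n (b n))
    (hb_oo : b n @[n --> \oo] --> \oo) :
  semicircle_law_in_probability P (fun n w => band_matrix (b n) (a n w)) /\
  ((exists p : nat, (0 < p)%N /\
      cvgn (series (fun n : nat => ((b n)%:R : R) ^- p))) ->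
   (forall l : nat, (0 < l)%N -> cvgn (series (fun n : nat => Cl l n))) ->
   semicircle_law_almost_surely P (fun n w => band_matrix (b n) (a n w))).
Proof.
split; first exact: law_in_probability ha hb hb_oo.
move=> [p [p0 sb]] sC; exact: (law_almost_surely ha hb hb_oo p0 sb sC).
Qed.
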